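(* Let $\Gamma$ be a piecewise $C^2$ graph mapped into $\mathbb{R}^3$. Then its net total curvature has the representation $$\mathrm{NTC}(\Gamma)=\frac12\int_{S^2}\mu(e)\,dA_{S^2}(e),$$ where $\mu(e)=\mu_\Gamma(e)$ is the multiplicity of $\Gamma$ at $e\in S^2$.
   Context: Graphs: $\Gamma$ is a connected finite graph, consisting of finitely many vertices and finitely many edges (arcs), each edge having one or two of the vertices as endpoints. The degree $d(q)$ of a vertex $q$ is the number of edges with endpoint $q$ (a loop counts twice). Interior points of edges may be regarded as vertices of degree 2. $\Gamma$ is piecewise $C^2$ if, after adding finitely many vertices of degree 2, each edge is mapped as a regular $C^2$ arc up to its endpoints; $\Gamma_{\rm reg}$ denotes the union of the open $C^2$ edges, $s$ arc length and $\vec k$ the curvature vector. The map need not be an embedding. Net total curvature: at a vertex $q$ of degree $d$ let $T_1,\dots,T_d\in S^2$ be the unit tangent vectors at $q$ pointing into the edges ending at $q$. Let $\chi_i:S^2\to\{-1,+1\}$ be $-1$ on the open hemisphere centered at $T_i$ and $+1$ on the opposite hemisphere (a.e. defined). Put $$\mathrm{ntc}(q)=\frac14\int_{S^2}\Big[\sum_{i=1}^d\chi_i(e)\Big]^+dA_{S^2}(e),\qquad \mathrm{NTC}(\Gamma)=\sum_{q}\mathrm{ntc}(q)+\int_{\Gamma_{\rm reg}}|\vec k|\,ds,$$ the sum being over all vertices; $[x]^+=\max(x,0)$. Net local maxima: the double $\widetilde\Gamma$ of $\Gamma$ has the same vertices and two copies of each edge. A parameterization $\Gamma'$ of $\widetilde\Gamma$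 is a mapping from a (not necessarily connected) compact 1-manifold without boundary which covers each edge of $\widetilde\Gamma$ exactly once; over a vertex $q$ of degree $d$ of $\Gamma$ there are $d$ points $q_1,\dots,q_d$ of $\Gamma'$. For $e\in S^2$ let $\mathrm{lmax}(e,q)$ (resp. $\mathrm{lmin}(e,q)$) be the number of the points $q_1,\dots,q_d$ which are local maxima (resp. minima) of $\langle e,\cdot\rangle$ along $\Gamma'$; a local extremum $q$ interior to an edge is treated as a vertex of degree 2. Put $\mathrm{nlm}(e,q)=\frac12[\mathrm{lmax}(e,q)-\mathrm{lmin}(e,q)]$ (this does not depend on the choice of $\Gamma'$), and $\mathrm{nlm}^+=\max(\mathrm{nlm},0)$. Multiplicity: $\mu_\Gamma(e)=\sum\mathrm{nlm}^+(e,q)$, the sum over all $q$ which are vertices of $\Gamma$ or critical points of $\langle e,\cdot\rangle$ along $\Gamma$. It is defined for almost all $e$, namely those for which $\langle e,\cdot\rangle$ has finitely many critical points along $\Gamma$. *)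

(* Defs.v *)
From mathcomp Require Import all_boot all_order all_algebra.
From mathcomp Require Import all_classical all_reals all_analysis.

Set Implicit Arguments.
Unset Strict Implicit.
Unset Printing Implicit Defensive.

Import Order.TTheory GRing.Theory Num.Theory.
Import numFieldNormedType.Exports.

Local Open Scope ring_scope.
Local Open Scope classical_set_scope.

Section Space.
Variable R : realType.
Implicit Types (u v : 'rV[R]_3) (f : R -> 'rV[R]_3) (t : R).

Definition dot u v : R := (u *m v^T) 0 0.

(* The library norm on 'rV[R]_3 is the sup norm. *)
Definition enorm u : R := Num.sqrt (dot u u).

Definition unitize u : 'rV[R]_3 := (enorm u)^-1 *: u.

(* dT/ds, where T is the unit tangent vector and ds = |f'(t)| dt. *)
Definition curvature_vector f t : 'rV[R]_3 :=
  (enorm (derive1 f t))^-1 *: derive1 (fun x => unitize (derive1 f x)) t.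

(* C^2 up to the endpoints of [a, b]: restriction of a C^2 curve on the line. *)
Definition regular_C2_arc f (a b : R) : Prop :=
  exists2 g : R -> 'rV[R]_3, {in `[a, b], f =1 g} &
    [/\ forall t, derivable g t 1,
        forall t, derivable (derive1 g) t 1,
        continuous (derive1 (derive1 g)) &
        {in `[a, b], forall t, derive1 g t != 0}].

(* Spherical coordinates: p.1 in [0, pi] is the polar angle and p.2 in
   [0, 2 pi] the longitude; the area element is sin p.1 dp.1 dp.2. *)
Definition sphere_pt (p : R * R) : 'rV[R]_3 :=
  \row_(i < 3) nth 0 [:: sin p.1 * cos p.2; sin p.1 * sin p.2; cos p.1] i.

Definition sphere_chart : set (R * R) := `[0, pi] `*` `[0, 2 * pi].

Definition plane_measure := (@lebesgue_measure R \x @lebesgue_measure R)%E.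

Definition sphere_integral (F : 'rV[R]_3 -> \bar R) : \bar R :=
  (\int[plane_measure]_(p in sphere_chart)
     (F (sphere_pt p) * (sin p.1)%:E))%E.

(* sin p.1 > 0 almost everywhere on the chart, so the null sets of the area
   are the images of the Lebesgue null sets. *)
Definition sphere_ae (P : 'rV[R]_3 -> Prop) : Prop :=
  {ae plane_measure, forall p, sphere_chart p -> P (sphere_pt p)}.

End Space.

(* Multiple edges and loops are allowed. *)
Record graph := Graph {
  vert : finType;
  edge : finType;
  src : edge -> vert;
  tgt : edge -> vert }.

Definition adjacent (G : graph) : rel (vert G) := fun u v =>
  [exists e : edge G, ((src e == u) && (tgt e == v))
                   || ((src e == v) && (tgt e == u))].

Definition connected_graph (G : graph) : Prop :=
  n_comp (@adjacent G) (vert G) = 1%N.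

(* Each edge is parameterized by [0, 1], from its source to its target; the
   values of arc outside [0, 1] are irrelevant. *)
Record graph_map (R : realType) (G : graph) := GraphMap {
  pos : vert G -> 'rV[R]_3;
  arc : edge G -> R -> 'rV[R]_3;
  arc_continuous : forall e, {within `[0, 1], continuous (arc e)};
  arc_src : forall e, arc e 0 = pos (src e);
  arc_tgt : forall e, arc e 1 = pos (tgt e) }.

Section NetTotalCurvature.
Variables (R : realType) (G : graph) (X : graph_map R G).

(* Parameters, edge by edge, of the added vertices of degree 2. *)
Variable brk : edge G -> seq R.

Definition C2_subdivision : Prop := forall e : edge G,
  path <%R 0 (rcons (brk e) 1) /\
  forall a b : R, infix [:: a; b] (0 :: rcons (brk e) 1) ->
    regular_C2_arc (arc X e) a b.

(* inl v is an original vertex; inr (e, t), with 0 < t < 1, is an interior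
   point of the edge e. *)
Definition point : Type := (vert G + edge G * R)%type.

Definition vertices : seq point :=
  [seq inl v | v <- enum (vert G)] ++
  [seq inr (e, t) | e <- enum (edge G), t <- brk e].

Definition reg (e : edge G) : set R :=
  [set t | (0 < t < 1) && (t \notin brk e)].

(* A germ (e, t, b) is a side of the point of parameter t on the edge e: the
   one of increasing parameter if b, of decreasing parameter otherwise. *)
Definition germ : Type := (edge G * R * bool)%type.

(* The degree of q is size (germs q): a loop contributes two germs. *)
Definition germs (q : point) : seq germ :=
  match q with
  | inl v => [seq (e, 0, true) | e <- enum (edge G) & src e == v] ++
             [seq (e, 1, false) | e <- enum (edge G) & tgt e == v]
  | inr (e, t) => [:: (e, t, true); (e, t, false)]
  end.

Definition germ_curve (g : germ) (h : R) : 'rV[R]_3 :=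
  let: (e, t, b) := g in arc X e (if b then t + h else t - h).

Definition tangent (g : germ) : 'rV[R]_3 :=
  unitize (lim (h^-1 *: (germ_curve g h - germ_curve g 0) @[h --> 0^'+])).

Definition chi (T e : 'rV[R]_3) : R := if 0 < dot T e then -1 else 1.

Definition ntc (q : point) : \bar R :=
  ((4^-1)%:E * sphere_integral (fun e =>
     (Num.max (\sum_(g <- germs q) chi (tangent g) e) 0)%:E))%E.

Definition NTC : \bar R :=
  (\sum_(q <- vertices) ntc q +
   \sum_(a : edge G) \int[@lebesgue_measure R]_(t in reg a)
     (enorm (curvature_vector (arc X a) t) * enorm (derive1 (arc X a) t))%:E)%E.

(* A germ of the double, the boolean telling which copy of the edge. *)
Definition dgerm : Type := (germ * bool)%type.

Definition dgerms (q : point) : seq dgerm :=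
  [seq (g, c) | g <- germs q, c <- [:: false; true]].

(* A compact 1-manifold without boundary covering each edge of the double
   exactly once is obtained by gluing the ends of the edges of the double two
   by two at each vertex. It is encoded by these gluings: branches q lists the
   points of the manifold over q, each given by its two sides. It runs straight
   through each copy of an edge at the interior points that are not vertices. *)
Record double_param := DoubleParam {
  branches : point -> seq (dgerm * dgerm);
  branches_vertex : forall q, q \in vertices ->
    perm_eq (flatten [seq [:: x.1; x.2] | x <- branches q]) (dgerms q);
  branches_interior : forall e t, reg e t ->
    branches (inr (e, t)) =
      [seq ((e, t, false, c), (e, t, true, c)) | c <- [:: false; true]] }.

Variable D : double_param.
Implicit Types (e : 'rV[R]_3) (q : point) (x : dgerm * dgerm).

Definition side_max e (g : germ) : Prop :=
  \forall h \near 0^'+, dot e (germ_curve g h) <= dot e (germ_curve g 0).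

Definition side_min e (g : germ) : Prop :=
  \forall h \near 0^'+, dot e (germ_curve g 0) <= dot e (germ_curve g h).

Definition local_max e x : Prop := side_max e x.1.1 /\ side_max e x.2.1.

Definition local_min e x : Prop := side_min e x.1.1 /\ side_min e x.2.1.

Definition lmax e q : nat := count (fun x => `[< local_max e x >]) (branches D q).

Definition lmin e q : nat := count (fun x => `[< local_min e x >]) (branches D q).

Definition nlm e q : R := ((lmax e q)%:R - (lmin e q)%:R) / 2.

Definition nlm_pos e q : R := Num.max (nlm e q) 0.

Definition critical e : set point :=
  [set q | exists a t, [/\ q = inr (a, t), reg a t &
                           dot e (derive1 (arc X a) t) = 0]].

(* The sum has its intended meaning when critical e is finite; otherwise it is
   0 if infinitely many terms are nonzero. *)
Definition multiplicity e : R :=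
  \sum_(q \in [set` vertices] `|` critical e) nlm_pos e q.

End NetTotalCurvature.

(* Main.v *)
Require Import Defs.
From mathcomp Require Import all_boot all_order all_algebra.
From mathcomp Require Import all_classical all_reals all_analysis.
From mathcomp Require Import measurable_realfun.
From mathcomp Require Import ring lra.

(** The net total curvature is a sum over vertices and over C^2 pieces of edges,
    and so is the multiplicity of almost every direction; the two sums are
    compared term by term.

    At a vertex, let the direction be orthogonal to none of the tangents. Every
    germ then strictly ascends or strictly descends, and [chi] records which. A
    gluing of the germs of the double pairs them up, and each pair contributes
    half the sum of its two signs to the difference between maxima and minima,
    so the net number of local maxima is half the sum of the signs over the
    germs ([nlm_vertex]). Half of the integral of its positive part is [ntc].

    In the interior of a C^2 piece, the critical points of the height in the
    direction [e] are the zeros of [dot e (T t)], with [T] the unit tangent. For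
    almost every [e] these zeros are nondegenerate ([nondegenerate_zeros_ae], an
    instance of Sard's theorem), hence finite in number, and the ones that
    contribute, with weight 1, are the local maxima, where [dot e (T t)] passes
    from positive to negative ([nlm_pos_interior]). What remains is Crofton's
    formula ([crossing_number_integral]): the integral over the sphere of the
    number of downward zeros is twice the length of [T], that is, twice the
    integral of the curvature.

    Crofton's formula is proved by inscribed polygons. The directions positive on
    a unit vector [u] and negative on [v] form a lune of area twice the angle
    between [u] and [v] ([lune_area]); so the number of downward sign changes of
    the height over the n-th dyadic subdivision integrates to twice the length of
    the inscribed spherical polygon, which tends to the length of [T]
    ([sum_turn_cvg]). For almost every direction these numbers increase with [n]
    up to the number of downward zeros ([crossing_numberE]), and the integrals
    pass to the limit.

    The area of a lune is found in spherical coordinates. If [u] and [v] have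
    positive third coordinates, the lune cuts each meridian in an interval, of
    weight a difference of two cosines, whose integral over the longitude is
    elementary ([lune_area_pos]); reflections and a limit give the other cases.
    Lunes also cover a thin slab around a great circle, which bounds its area by
    a multiple of its width ([slab_area]); this is the estimate behind
    [nondegenerate_zeros_ae].

    The multiplicity as a function of the direction is not known to be
    measurable, only to be equal almost everywhere to a measurable function. For
    nonnegative functions this determines the integral
    ([ae_eq_ge0_integral]). *)

Set Implicit Arguments.
Unset Strict Implicit.
Unset Printing Implicit Defensive.

Import Order.TTheory GRing.Theory Num.Theory.
Import numFieldNormedType.Exports.

Local Open Scope ring_scope.
Local Open Scope classical_set_scope.

(** * Euclidean geometry of R^3 *)
Section Euclid.
Variable R : realType.
Implicit Types (u v w e : 'rV[R]_3) (k : R).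

Definition i0 : 'I_3 := ord0.
Definition i1 : 'I_3 := lift ord0 ord0.
Definition i2 : 'I_3 := ord_max.

Lemma ord3P (P : 'I_3 -> Prop) : P i0 -> P i1 -> P i2 -> forall i, P i.
Proof.
move=> P0 P1 P2 [[|[|[|//]]] lti].
- by rewrite (_ : Ordinal lti = i0)//; apply: val_inj.
- by rewrite (_ : Ordinal lti = i1)//; apply: val_inj.
- by rewrite (_ : Ordinal lti = i2)//; apply: val_inj.
Qed.

Lemma sum3 (F : 'I_3 -> R) : \sum_i F i = F i0 + F i1 + F i2.
Proof.
rewrite !big_ord_recl big_ord0 addr0 addrA.
by congr (_ + F _ + F _); apply: val_inj.
Qed.

Lemma dotE u v : dot u v = u 0 i0 * v 0 i0 + u 0 i1 * v 0 i1 + u 0 i2 * v 0 i2.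
Proof.
rewrite /dot mxE sum3.
by rewrite !mxE.
Qed.

Lemma dotC u v : dot u v = dot v u.
Proof. by rewrite !dotE; ring. Qed.

Lemma dotDl u v w : dot (u + v) w = dot u w + dot v w.
Proof. by rewrite !dotE !mxE; ring. Qed.

Lemma dotZl k u v : dot (k *: u) v = k * dot u v.
Proof. by rewrite !dotE !mxE; ring. Qed.

Lemma dotNl u v : dot (- u) v = - dot u v.
Proof. by rewrite !dotE !mxE; ring. Qed.

Lemma dotBl u v w : dot (u - v) w = dot u w - dot v w.
Proof. by rewrite dotDl dotNl. Qed.

Lemma dotDr u v w : dot w (u + v) = dot w u + dot w v.
Proof. by rewrite !(dotC w) dotDl. Qed.

Lemma dotZr k u v : dot v (k *: u) = k * dot v u.
Proof. by rewrite !(dotC v) dotZl. Qed.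

Lemma dotNr u v : dot v (- u) = - dot v u.
Proof. by rewrite !(dotC v) dotNl. Qed.

Lemma dotBr u v w : dot w (u - v) = dot w u - dot w v.
Proof. by rewrite dotDr dotNr. Qed.

Lemma dot_ge0 u : 0 <= dot u u.
Proof. by rewrite dotE; nra. Qed.

Lemma dot_gt0 u : u != 0 -> 0 < dot u u.
Proof.
move=> u0; rewrite lt_neqAle dot_ge0 andbT; apply: contra_neq u0.
rewrite dotE => /eqP u0; apply/rowP.
by apply: ord3P; rewrite mxE; apply/eqP; rewrite -sqrf_eq0; apply/eqP; nra.
Qed.

Lemma enorm_ge0 u : 0 <= enorm u. Proof. exact: sqrtr_ge0. Qed.

Lemma enorm_gt0 u : u != 0 -> 0 < enorm u.
Proof. by move=> u0; rewrite sqrtr_gt0 dot_gt0. Qed.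

Lemma sqr_enorm u : enorm u ^+ 2 = dot u u.
Proof. by rewrite sqr_sqrtr ?dot_ge0. Qed.

Lemma enorm1 u : enorm u = 1 <-> dot u u = 1.
Proof.
split=> [u1|]; first by rewrite -sqr_enorm u1 expr1n.
by rewrite /enorm => ->; rewrite sqrtr1.
Qed.

Lemma enormZ k u : enorm (k *: u) = `|k| * enorm u.
Proof.
by rewrite /enorm dotZl dotZr mulrA -expr2 sqrtrM ?sqr_ge0// sqrtr_sqr.
Qed.

Lemma dot_unitize u : u != 0 -> dot (unitize u) (unitize u) = 1.
Proof.
move=> u0; have n0 := enorm_gt0 u0.
rewrite /unitize dotZl dotZr -sqr_enorm.
by field; rewrite gt_eqF.
Qed.

Lemma enormN u : enorm (- u) = enorm u.
Proof. by rewrite /enorm dotNl dotNr opprK. Qed.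

Lemma dot_sqr_le u v : dot u v ^+ 2 <= dot u u * dot v v.
Proof.
rewrite !dotE -subr_ge0.
set a := u 0 i0; set b := u 0 i1; set c := u 0 i2.
set x := v 0 i0; set y := v 0 i1; set z := v 0 i2.
(* Lagrange's identity *)
have -> : (a * a + b * b + c * c) * (x * x + y * y + z * z) -
    (a * x + b * y + c * z) ^+ 2 =
    (a * y - b * x) ^+ 2 + (a * z - c * x) ^+ 2 + (b * z - c * y) ^+ 2 by ring.
by rewrite !addr_ge0// sqr_ge0.
Qed.

Lemma dot_le_enorm u v : dot u v <= enorm u * enorm v.
Proof.
rewrite /enorm -sqrtrM ?dot_ge0//.
by rewrite (le_trans (ler_norm _))// -sqrtr_sqr ler_wsqrtr// dot_sqr_le.
Qed.

Lemma ler_enormD u v : enorm (u + v) <= enorm u + enorm v.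
Proof.
rewrite -(@ler_pXn2r _ 2)// ?nnegrE ?addr_ge0 ?enorm_ge0//.
rewrite sqrrD !sqr_enorm dotDl !dotDr (dotC v u).
have := dot_le_enorm u v; lra.
Qed.

Lemma ler_dist_enorm u v : `|enorm u - enorm v| <= enorm (u - v).
Proof.
have h1 := ler_enormD (u - v) v; have h2 := ler_enormD (v - u) u.
rewrite !subrK in h1 h2; rewrite -(enormN (v - u)) opprB in h2.
by rewrite ler_norml; apply/andP; split; lra.
Qed.

Lemma norm_dot_unit e v : dot e e = 1 -> `|dot e v| <= enorm v.
Proof.
move=> e1; rewrite -sqrtr_sqr ler_wsqrtr//.
by rewrite (le_trans (dot_sqr_le _ _))// e1 mul1r.
Qed.

Lemma enorm_le_coords v k : 0 <= k ->
  (forall i, `|v 0 i| <= k) -> enorm v <= 2 * k.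
Proof.
move=> k0 vk; rewrite -(@ler_pXn2r _ 2)// ?nnegrE ?enorm_ge0 ?mulr_ge0//.
rewrite sqr_enorm dotE.
have h i : v 0 i * v 0 i <= k ^+ 2.
  by rewrite -expr2 -real_normK ?num_real// lerXn2r ?nnegrE.
have := h i0; have := h i1; have := h i2; nra.
Qed.

Lemma sphere_pt_unit (p : R * R) : dot (sphere_pt p) (sphere_pt p) = 1.
Proof.
rewrite dotE /sphere_pt !mxE /=.
have := cos2Dsin2 p.1; have := cos2Dsin2 p.2.
move: (cos p.1) (sin p.1) (cos p.2) (sin p.2) => a b c d cd ab.
have -> : b * c * (b * c) + b * d * (b * d) + a * a = b ^+ 2 * (c ^+ 2 + d ^+ 2) + a ^+ 2 by ring.
by rewrite cd mulr1 addrC.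
Qed.

Lemma dot_sphere_pt (p : R * R) u :
  dot (sphere_pt p) u =
  u 0 i2 * cos p.1 + (u 0 i0 * cos p.2 + u 0 i1 * sin p.2) * sin p.1.
Proof. by rewrite dotE /sphere_pt !mxE /=; ring. Qed.

End Euclid.

(** * Integration over the sphere *)

Lemma measurable_fun_limn_einf d (T : measurableType d) (R : realType) (D : set T)
    (f : (T -> \bar R)^nat) :
  (forall n, measurable_fun D (f n)) ->
  measurable_fun D (fun x => limn_einf (f ^~ x)).
Proof.
move=> mf.
rewrite (_ : (fun x => _) = (fun x => - limn_esup (fun n => - f n x))%E).
  apply: measurableT_comp => //; apply: measurable_fun_limn_esup => n.
  exact: measurableT_comp.
by apply/funext => x; rewrite (limn_esupN (f^~ x)) oppeK.
Qed.

Section LowerIntegral.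
Import HBNNSimple.

(** The integral of a nonnegative function is a supremum over the simple
    functions below it, whether or not that function is measurable. *)
Lemma ae_eq_ge0_integral d (T : measurableType d) (R : realType) (m : {measure set T -> \bar R})
    (D : set T) (f g : T -> \bar R) : measurable D ->
  (forall x, D x -> 0 <= f x)%E -> (forall x, D x -> 0 <= g x)%E ->
  ae_eq m D f g -> (\int[m]_(x in D) f x = \int[m]_(x in D) g x)%E.
Proof.
move=> mD; wlog suff: f g / (forall x, D x -> 0 <= f x)%E ->
    (forall x, D x -> 0 <= g x)%E -> ae_eq m D f g ->
    (\int[m]_(x in D) f x <= \int[m]_(x in D) g x)%E.
  move=> h f0 g0 fg; apply/eqP; rewrite eq_le h//= h//.
  exact: ae_eq_sym.
move=> f0 g0 [N [mN N0 fgN]].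
rewrite (ge0_integralE _ f0) (ge0_integralE _ g0).
apply: ub_ereal_sup => _ [h /= hf <-].
have -> : sintegral m h = sintegral m (proj_nnsfun h (measurableC mN)).
  rewrite -!integralT_nnsfun.
  apply: ge0_ae_eq_integral => //=.
  - exact/measurable_EFinP.
  - apply/measurable_EFinP; exact: (measurable_funPT (proj_nnsfun h (measurableC mN))).
  - by move=> x _; rewrite lee_fin.
  - by move=> x _; rewrite lee_fin mulr_ge0// mindicE.
  exists N; split => // x /= /not_implyP[_] hx; apply: contrapT => Nx.
  by apply: hx; rewrite /= mindicE mem_set// mulr1.
apply: ereal_sup_ubound; exists (proj_nnsfun h (measurableC mN)) => //= x.
rewrite mindicE; case: (pselect (N x)) => Nx.
  rewrite memNset ?mulr0; last by move=> /(_ Nx).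
  by rewrite erestrict_ge0.
rewrite mem_set// mulr1 (le_trans (hf x))//.
rewrite !patchE; case: ifPn => // /set_mem Dx.
by rewrite le_eqVlt; apply/orP; left; apply/eqP; apply: contrapT => fg; apply: Nx; apply: fgN => /=; apply/not_implyP.
Qed.

End LowerIntegral.

Section SphereIntegral.
Variable R : realType.
Local Notation mR := (measurableTypeR R).
Local Notation mu := (@lebesgue_measure R).
Local Notation pm := (mu \x mu)%E.
Local Notation chart := (@sphere_chart R).
Implicit Types (F G : 'rV[R]_3 -> \bar R) (E : set 'rV[R]_3).

(** Measurability is read in the chart, where both the area and its null sets
    are defined. *)
Definition sphere_measurable F :=
  measurable_fun setT ((F \o @sphere_pt R) : mR * mR -> \bar R).

Lemma measurable_chart : measurable (chart : set (mR * mR)).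
Proof. by apply: measurableX; exact: measurable_itv. Qed.

Lemma measurable_dot_sphere u :
  measurable_fun setT ((fun p => dot (sphere_pt p) u) : mR * mR -> R).
Proof.
under eq_fun do rewrite dot_sphere_pt.
have mc : measurable_fun setT (@cos R).
  by apply: continuous_measurable_fun; exact: continuous_cos.
have ms : measurable_fun setT (@sin R).
  by apply: continuous_measurable_fun; exact: continuous_sin.
have h1 (f : R -> R) : measurable_fun setT f ->
    measurable_fun setT ((fun p => f p.1) : mR * mR -> R).
  by move=> mf; apply: measurableT_comp mf _; exact: measurable_fst.
have h2 (f : R -> R) : measurable_fun setT f ->
    measurable_fun setT ((fun p => f p.2) : mR * mR -> R).
  by move=> mf; apply: measurableT_comp mf _; exact: measurable_snd.
by apply: measurable_funD; apply: measurable_funM => //; try exact: h1;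
  apply: measurable_funD; apply: measurable_funM => //; exact: h2.
Qed.

Lemma measurable_sin1 :
  measurable_fun setT ((fun p => (sin p.1)%:E) : mR * mR -> \bar R).
Proof.
apply/measurable_EFinP; apply: (@measurableT_comp _ _ _ _ _ _ (@sin R)).
  by apply: continuous_measurable_fun; exact: continuous_sin.
exact: measurable_fst.
Qed.

Lemma sphere_integrand_measurable F : sphere_measurable F ->
  measurable_fun chart ((fun p => F (sphere_pt p) * (sin p.1)%:E)%E : mR * mR -> \bar R).
Proof.
move=> mF; apply: (measurable_funS measurableT) => //.
by apply: emeasurable_funM => //; exact: measurable_sin1.
Qed.

Lemma sin_chart_ge0 p : chart p -> 0 <= sin p.1 :> R.
Proof.
case=> p1 _; apply: sin_ge0_pi; exact: p1.
Qed.

Lemma sphere_integrand_ge0 F : (forall e, 0 <= F e)%E ->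
  forall p, chart p -> (0 <= F (sphere_pt p) * (sin p.1)%:E)%E.
Proof. by move=> F0 p pc; rewrite mule_ge0// lee_fin sin_chart_ge0. Qed.

Lemma sphere_integral_ge0 F : (forall e, 0 <= F e)%E -> (0 <= sphere_integral F)%E.
Proof. by move=> F0; apply: integral_ge0; exact: sphere_integrand_ge0. Qed.

Lemma eq_sphere_integral F G : F =1 G -> sphere_integral F = sphere_integral G.
Proof. by move=> FG; congr sphere_integral; apply/funext. Qed.

Lemma sphere_integralD F G :
  (forall e, 0 <= F e)%E -> (forall e, 0 <= G e)%E ->
  sphere_measurable F -> sphere_measurable G ->
  (sphere_integral (fun e => F e + G e) = sphere_integral F + sphere_integral G)%E.
Proof.
move=> F0 G0 mF mG; rewrite /sphere_integral -ge0_integralD//.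
- by apply: eq_integral => p _; rewrite ge0_muleDl.
- exact: measurable_chart.
- exact: sphere_integrand_ge0.
- exact: sphere_integrand_measurable.
- exact: sphere_integrand_ge0.
- exact: sphere_integrand_measurable.
Qed.

Lemma sphere_measurable_sum (I : Type) (s : seq I) (F : I -> 'rV[R]_3 -> \bar R) :
  (forall i, sphere_measurable (F i)) ->
  sphere_measurable (fun e => \sum_(i <- s) F i e)%E.
Proof. by move=> mF; exact: emeasurable_sum. Qed.

Lemma sphere_integral_sum (I : Type) (s : seq I) (F : I -> 'rV[R]_3 -> \bar R) :
  (forall i e, 0 <= F i e)%E -> (forall i, sphere_measurable (F i)) ->
  (sphere_integral (fun e => \sum_(i <- s) F i e) =
   \sum_(i <- s) sphere_integral (F i))%E.
Proof.
move=> F0 mF; elim: s => [|i s IH].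
  rewrite big_nil /sphere_integral; under eq_integral do rewrite big_nil mul0e.
  exact: integral0.
rewrite big_cons -IH -sphere_integralD//.
- by apply: eq_sphere_integral => e; rewrite big_cons.
- by move=> e; apply: sume_ge0.
- exact: sphere_measurable_sum.
Qed.

Lemma sphere_integralZl k F : 0 <= k -> (forall e, 0 <= F e)%E ->
  sphere_measurable F ->
  (sphere_integral (fun e => k%:E * F e) = k%:E * sphere_integral F)%E.
Proof.
move=> k0 F0 mF; rewrite /sphere_integral -ge0_integralZl//.
- by apply: eq_integral => p _; rewrite muleA.
- exact: measurable_chart.
- exact: sphere_integrand_measurable.
- exact: sphere_integrand_ge0.
Qed.

#[global] Instance plane_ae_filter : Filter (almost_everywhere (@plane_measure R)).
Proof. exact: (ae_filter_ringOfSetsType pm). Qed.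

Lemma sphere_aeS (P Q : 'rV[R]_3 -> Prop) :
  (forall e, dot e e = 1 -> P e -> Q e) -> sphere_ae P -> sphere_ae Q.
Proof.
by move=> PQ; rewrite /sphere_ae; apply: filterS => p Pp pc; apply: PQ; [exact: sphere_pt_unit|exact: Pp].
Qed.

Lemma sphere_aeI (P Q : 'rV[R]_3 -> Prop) :
  sphere_ae P -> sphere_ae Q -> sphere_ae (fun e => P e /\ Q e).
Proof.
rewrite /sphere_ae => hP hQ; apply: filterS2 hP hQ => p Pp Qp pc.
by split; [exact: Pp|exact: Qp].
Qed.

Lemma sphere_ae_seq (I : eqType) (s : seq I) (P : I -> 'rV[R]_3 -> Prop) :
  (forall i, i \in s -> sphere_ae (P i)) ->
  sphere_ae (fun e => forall i, i \in s -> P i e).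
Proof.
elim: s => [|i s IH] hP; first by rewrite /sphere_ae; apply: nearW.
have hs : sphere_ae (fun e => forall j, j \in s -> P j e).
  by apply: IH => j js; apply: hP; rewrite inE js orbT.
move: (sphere_aeI (hP i (mem_head _ _)) hs); apply: sphere_aeS => e _ [Pi Ps] j.
by rewrite inE => /predU1P[->//|]; exact: Ps.
Qed.

Lemma sphere_ae_bigcap (P : nat -> 'rV[R]_3 -> Prop) :
  (forall n, sphere_ae (P n)) -> sphere_ae (fun e => forall n, P n e).
Proof.
move=> hP; rewrite /sphere_ae.
have := (negligible_bigcup hP); apply: negligibleS => p /=.
move=> /not_implyP[pc] /existsNP[n nP]; exists n => //= .
by apply/not_implyP.
Qed.

Lemma le_sphere_integral F G :
  (forall e, 0 <= F e)%E -> (forall e, 0 <= G e)%E ->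
  sphere_measurable F -> sphere_measurable G ->
  sphere_ae (fun e => F e <= G e)%E ->
  (sphere_integral F <= sphere_integral G)%E.
Proof.
move=> F0 G0 mF mG FG; apply: ae_ge0_le_integral => //.
- exact: measurable_chart.
- exact: sphere_integrand_ge0.
- exact: sphere_integrand_measurable.
- exact: sphere_integrand_ge0.
- exact: sphere_integrand_measurable.
- move: FG; rewrite /sphere_ae; apply: filterS => p h pc; apply: lee_wpmul2r; last exact: h.
  by rewrite lee_fin sin_chart_ge0.
Qed.

(** Fatou's lemma bounds the integral of the limit from above, the domination
    [F n <= G] from below; no integrable bound has to be known in advance. *)
Lemma sphere_integral_cvg (F : nat -> 'rV[R]_3 -> \bar R) G (l : \bar R) :
  (forall n e, 0 <= F n e)%E -> (forall n, sphere_measurable (F n)) ->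
  (forall e, 0 <= G e)%E -> sphere_measurable G ->
  (forall n, sphere_ae (fun e => F n e <= G e)%E) ->
  sphere_ae (fun e => F^~ e @ \oo --> G e) ->
  (fun n => sphere_integral (F n)) @ \oo --> l ->
  sphere_integral G = l.
Proof.
move=> F0 mF G0 mG FG cFG cI; apply/eqP; rewrite eq_le; apply/andP; split; last first.
  rewrite -(cvg_lim _ cI)//; apply: lime_le; first by apply/cvg_ex; exists l.
  by apply: nearW => n; exact: le_sphere_integral.
have mH n := sphere_integrand_measurable (mF n).
have H0 n p pc := sphere_integrand_ge0 (F0 n) (p := p) pc.
have := @fatou _ _ _ pm chart measurable_chart
  (fun n p => F n (sphere_pt p) * (sin p.1)%:E)%E mH H0.
rewrite (is_cvg_limn_einfE _); last by apply/cvg_ex; exists l.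
rewrite (cvg_lim _ cI)//; apply: le_trans; rewrite le_eqVlt; apply/orP; left; apply/eqP.
apply: ge0_ae_eq_integral.
- exact: measurable_chart.
- exact: sphere_integrand_measurable.
- exact: measurable_fun_limn_einf.
- exact: sphere_integrand_ge0.
- move=> p pc; rewrite limn_einf_lim; apply: lime_ge; first exact: is_cvg_einfs.
  apply: nearW => n; apply: le_ereal_inf_tmp.
  by move=> _ [k _ <-]; exact: H0.
- move: cFG; rewrite /sphere_ae; apply: filterS => p h pc.
  have c : (F n (sphere_pt p) * (sin p.1)%:E)%E @[n --> \oo] --> (G (sphere_pt p) * (sin p.1)%:E)%E.
    by apply: cvgeZr => //; exact: h.
  by rewrite is_cvg_limn_einfE ?(cvg_lim _ c)//; apply/cvg_ex; exists (G (sphere_pt p) * (sin p.1)%:E)%E.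
Qed.

Lemma ae_eq_sphere_integral F G :
  (forall e, 0 <= F e)%E -> (forall e, 0 <= G e)%E ->
  sphere_ae (fun e => F e = G e) -> sphere_integral F = sphere_integral G.
Proof.
move=> F0 G0 FG; apply: ae_eq_ge0_integral.
- exact: measurable_chart.
- exact: sphere_integrand_ge0.
- exact: sphere_integrand_ge0.
- by move: FG; rewrite /sphere_ae; apply: filterS => p h pc; rewrite h.
Qed.

(** The area element [sin p.1] vanishes on the chart only over the poles, so a
    set of area zero is null in the chart. *)
Lemma sphere_integral_eq0_ae F : (forall e, 0 <= F e)%E -> sphere_measurable F ->
  sphere_integral F = 0%E -> sphere_ae (fun e => F e = 0%E).
Proof.
move=> F0 mF IF.
have mH := sphere_integrand_measurable mF.
have /(ae_eq_integral_abs pm measurable_chart mH) h :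
    (\int[pm]_(p in chart) `|F (sphere_pt p) * (sin p.1)%:E| = 0)%E.
  rewrite -IF; apply: eq_integral => p /set_mem pc.
  by rewrite gee0_abs//; exact: sphere_integrand_ge0.
(* the two edges of the chart where the sine vanishes are null *)
have poles : {ae pm, forall p : mR * mR, p.1 != 0 /\ p.1 != pi}.
  have mS (r : R) : measurable ([set r] `*` setT : set (mR * mR)).
    by apply: measurableX.
  have NS (r : R) : pm ([set r] `*` setT) = 0%E.
    rewrite product_measure1E//=; first by rewrite lebesgue_measure_set1 mul0e.
  apply: (@filterS2 _ _ _ (fun p : mR * mR => p.1 != 0) (fun p => p.1 != pi)) => //.
    exists ([set 0] `*` setT); split => // p /=.
    by move=> /negP/negPn/eqP.
  exists ([set pi] `*` setT); split => // p /=.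
  by move=> /negP/negPn/eqP.
apply: filterS2 h poles => p /= hp [p0 p1] pc.
have /eqP := hp pc; rewrite mule_eq0 => /orP[/eqP//|].
have {pc} : p.1 \in `[0, pi]%R.
  by case: pc.
rewrite in_itv/= => /andP[q0 q1].
by rewrite eqe gt_eqF// sin_gt0_pi// lt_neqAle eq_sym p0 q0 lt_neqAle p1 q1.
Qed.

(** The colatitude is integrated first, because a hemisphere cuts each meridian
    in an interval. *)
Lemma sphere_integral_tonelli F :
  (forall e, 0 <= F e)%E -> sphere_measurable F ->
  sphere_integral F = (\int[mu]_(y in [set` `[0, 2 * pi]%R])
    \int[mu]_(x in [set` `[0, pi]%R]) (F (sphere_pt (x, y)) * (sin x)%:E))%E.
Proof.
move=> F0 mF; rewrite /sphere_integral integral_mkcond.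
rewrite (@fubini_tonelli2 _ _ _ _ _ mu mu); last 2 first.
- apply/(measurable_restrictT _ measurable_chart).
  exact: sphere_integrand_measurable.
- by move=> p; apply: erestrict_ge0 => q; exact: sphere_integrand_ge0.
rewrite [RHS]integral_mkcond; apply: eq_integral => y _.
rewrite /fubini_G patchE; case: ifPn => [/set_mem yc|ny].
  rewrite [RHS]integral_mkcond; apply: eq_integral => x _; rewrite !patchE.
  congr (if _ then _ else _).
  apply/idP/idP => /set_mem h; apply/mem_set; [by case: h|by split].
apply: integral0_eq => x _; rewrite patchE memNset// => -[_ /= h].
by move/negP: ny; apply; apply/mem_set.
Qed.

End SphereIntegral.

(** * The area of a lune *)
Section CalculusTools.
Variable R : realType.
Local Notation mu := (@lebesgue_measure R).

Lemma integral_derive (G g : R -> R) (x y : R) : x <= y ->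
  (forall t : R, is_derive t (1 : R) G (g t)) -> continuous g ->
  (\int[mu]_(t in [set` `[x, y]%R]) (g t)%:E = (G y - G x)%:E)%E.
Proof.
rewrite le_eqVlt => /predU1P[<-|xy] dG cg.
  by rewrite set_itv1 integral_set1 subrr.
have cG : continuous G.
  by move=> t; apply/differentiable_continuous/derivable1_diffP; apply: ex_derive.
rewrite EFinB; apply: continuous_FTC2 => //.
- exact: continuous_subspaceT.
- split => [t _||]; first exact: ex_derive.
  + exact/cvg_at_right_filter/cG.
  + exact/cvg_at_left_filter/cG.
- by move=> t _; rewrite derive1E; apply: derive_val.
Qed.

Lemma integral_itv_split (f : R -> \bar R) (a b c : R) : a <= b -> b <= c ->
  (forall x, 0 <= f x)%E -> measurable_fun setT f ->
  (\int[mu]_(t in [set` `[a, c]%R]) f t =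
   \int[mu]_(t in [set` `[a, b]%R]) f t + \int[mu]_(t in [set` `[b, c]%R]) f t)%E.
Proof.
move=> ab bc f0 mf.
rewrite (@itv_bndbnd_setU _ _ _ (BRight b)) ?bnd_simp//=.
rewrite ge0_integral_setU//=.
- by rewrite (@integral_itv_obnd_cbnd _ b (BRight c) f)//; exact: measurable_funS mf.
- exact: measurable_funS mf.
- apply/disj_set2P/seteqP; split => // t [] /=; rewrite !in_itv/= => /andP[_ tb] /andP[bt _].
  by move: (lt_le_trans bt tb); rewrite ltxx.
Qed.

Lemma asinN (x : R) : -1 <= x <= 1 -> asin (- x) = - asin x.
Proof.
move=> x1; rewrite -{1}(@asinK _ x); last by rewrite in_itv.
rewrite -sinN sinK// in_itv/=.
by rewrite lerN2 asin_lepi2//= lerNl asin_geNpi2.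
Qed.

End CalculusTools.

Section Lune.
Variable R : realType.
Local Notation mu := (@lebesgue_measure R).
Implicit Types (u v e : 'rV[R]_3).

(** A spherical lune, bounded by two great semicircles, kept as an indicator
    function so that its area is its integral. *)
Definition lune u v e : \bar R := (((0 < dot e u) && (dot e v < 0))%:R)%:E.

Lemma lune_ge0 u v e : (0 <= lune u v e)%E.
Proof. by rewrite lee_fin. Qed.

Lemma measurable_lune u v : sphere_measurable (lune u v).
Proof.
apply/measurable_EFinP => /=.
rewrite (_ : (fun _ => _) = fun p : R * R =>
  if (0 < dot (sphere_pt p) u) && (dot (sphere_pt p) v < 0) then 1 else 0); last first.
  by apply/funext => p; case: ifP.
apply: measurable_fun_ifT => //.
by apply: measurable_and; apply: measurable_fun_ltr => //;
  exact: measurable_dot_sphere.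
Qed.

(** Along a meridian a height function is a sinusoid of the colatitude, with one
    root in the open half turn. *)
Lemma meridian_root (a b : R) : 0 < b ->
  exists2 t, 0 < t < pi &
    [/\ cos t = - (a / Num.sqrt (a ^+ 2 + b ^+ 2)),
        sin t = b / Num.sqrt (a ^+ 2 + b ^+ 2) &
        forall x, b * cos x + a * sin x = Num.sqrt (a ^+ 2 + b ^+ 2) * sin (t - x)].
Proof.
move=> b0; set r := Num.sqrt _.
have ab : 0 < a ^+ 2 + b ^+ 2 by rewrite ltr_wpDl ?sqr_ge0 ?exprn_gt0.
have r0 : 0 < r by rewrite sqrtr_gt0.
have r2 : r ^+ 2 = a ^+ 2 + b ^+ 2 by rewrite sqr_sqrtr// ltW.
have z2 : (- (a / r)) ^+ 2 = 1 - (b / r) ^+ 2.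
  by field: r2; rewrite gt_eqF.
have br : 0 < b / r by rewrite divr_gt0.
have z1 : -1 < - (a / r) < 1.
  by rewrite -ltr_norml -(@ltr_pXn2r _ 2)// ?nnegrE ?expr1n// real_normK ?num_real// z2; nra.
have zle : -1 <= - (a / r) <= 1 by case/andP: z1 => h1 h2; rewrite !ltW.
exists (acos (- (a / r))).
  by rewrite acos_gt0 ?acos_ltpi//; case/andP: z1 => h1 h2; rewrite ?h1 ?h2 !ltW.
have c : cos (acos (- (a / r))) = - (a / r) by rewrite acosK// in_itv.
have s : sin (acos (- (a / r))) = b / r.
  by rewrite sin_acos// z2 opprB addrC subrK sqrtr_sqr gtr0_norm.
split => // x; rewrite sinB c s.
by field; rewrite gt_eqF.
Qed.

Lemma sin_sub_sgn (t x : R) : 0 < t < pi -> 0 <= x <= pi ->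
  (0 < sin (t - x)) = (x < t) /\ (sin (t - x) < 0) = (t < x).
Proof.
move=> /andP[t0 tpi] /andP[x0 xpi].
have [xt|tx|->] := ltgtP x t.
- have h : 0 < sin (t - x) by rewrite sin_gt0_pi//; apply/andP; split; lra.
  by rewrite h ltNge ltW.
- have h : 0 < sin (x - t) by rewrite sin_gt0_pi//; apply/andP; split; lra.
  by rewrite -(opprB x t) sinN oppr_gt0 oppr_lt0 h ltNge ltW.
- by rewrite subrr sin0 ltxx.
Qed.

(** A lune cuts the meridian in the interval between two such roots, and the
    weight [sin x] integrates to a difference of cosines. *)
Lemma meridian_lune (a b a' b' : R) : 0 < b -> 0 < b' ->
  (\int[mu]_(x in [set` `[0, pi]%R])
    ((((0 < b * cos x + a * sin x) && (b' * cos x + a' * sin x < 0))%:R)%:E * (sin x)%:E) =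
  (Num.max (a / Num.sqrt (a ^+ 2 + b ^+ 2) - a' / Num.sqrt (a' ^+ 2 + b' ^+ 2)) 0)%:E)%E.
Proof.
move=> b0 b'0.
have [t t01 [ct st ht]] := meridian_root a b0.
have [s s01 [cs ss hs]] := meridian_root a' b'0.
have r0 : 0 < Num.sqrt (a ^+ 2 + b ^+ 2) by rewrite sqrtr_gt0 ltr_wpDl ?sqr_ge0 ?exprn_gt0.
have r'0 : 0 < Num.sqrt (a' ^+ 2 + b' ^+ 2) by rewrite sqrtr_gt0 ltr_wpDl ?sqr_ge0 ?exprn_gt0.
have -> : a / Num.sqrt (a ^+ 2 + b ^+ 2) - a' / Num.sqrt (a' ^+ 2 + b' ^+ 2) = cos s - cos t.
  by rewrite ct cs; ring.
have tI : t \in `[0, pi]%R by case/andP: t01 => *; rewrite in_itv/= !ltW.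
have sI : s \in `[0, pi]%R by case/andP: s01 => *; rewrite in_itv/= !ltW.
have -> : (\int[mu]_(x in [set` `[0, pi]%R])
    ((((0 < b * cos x + a * sin x)%R && (b' * cos x + a' * sin x < 0)%R)%:R)%:E * (sin x)%:E) =
  \int[mu]_(x in [set` `]s, t[%R]) (sin x)%:E)%E.
  rewrite integral_mkcond [RHS]integral_mkcond; apply: eq_integral => x _.
  rewrite !patchE; case: ifPn => [/set_mem /= x0pi|nx].
    rewrite ht hs !pmulr_rgt0 ?pmulr_rlt0//.
    move: (x0pi); rewrite in_itv/= => x0pi'.
    rewrite (sin_sub_sgn t01 x0pi').1 (sin_sub_sgn s01 x0pi').2 andbC.
    case: ifPn => [/set_mem/=|]; first by rewrite in_itv/= => ->; rewrite mul1e.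
    by move=> /negP h; case: (boolP (_ && _)) => [h'|]; rewrite ?mul0e//; exfalso; apply: h; apply/mem_set; rewrite /= in_itv/=.
  rewrite memNset// => /=; rewrite in_itv/= => /andP[sx xt]; move/negP: nx; apply.
  apply/mem_set; rewrite /= in_itv/=; case/andP: t01 => _ tpi; case/andP: s01 => s0 _.
  by rewrite (ltW (lt_trans s0 sx)) (ltW (lt_trans xt tpi)).
have [st_|ts] := ltP s t.
  rewrite -(@integral_itv_bndoo _ s t _ true false); last first.
    apply: (measurable_funS measurableT) => //; apply/measurable_EFinP.
    by apply: continuous_measurable_fun; exact: continuous_sin.
  have dc (x : R) : is_derive x (1 : R) (fun x => - cos x) (sin x).
    by apply: is_derive_eq; rewrite opprK.
  rewrite (integral_derive (ltW st_) dc); last exact: continuous_sin.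
  rewrite max_l; first by congr EFin; ring.
  by rewrite subr_ge0 ltW// ltr_cos.
rewrite set_itv_ge ?integral_set0 -?leNgt ?bnd_simp//.
by rewrite max_r// subr_le0 leNgt ltr_cos// -leNgt.
Qed.

End Lune.

Section LunePositive.
Variable R : realType.
Local Notation mu := (@lebesgue_measure R).
Implicit Types (u v e w : 'rV[R]_3).

(** Horizontal coordinates of [w] in the orthonormal frame whose first vector
    points to the longitude [y]. *)
Definition hcos w (y : R) := w 0 i0 * cos y + w 0 i1 * sin y.
Definition hsin w (y : R) := w 0 i1 * cos y - w 0 i0 * sin y.
(** [1 + visible_height w y] is the area, per unit of longitude, of the part of
    the meridian [y] that lies in the hemisphere centered at [w]. *)
Definition visible_height w (y : R) :=
  hcos w y / Num.sqrt (hcos w y ^+ 2 + w 0 i2 ^+ 2).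

Lemma hcos_hsin u v y :
  hcos u y * hcos v y + hsin u y * hsin v y = u 0 i0 * v 0 i0 + u 0 i1 * v 0 i1.
Proof.
rewrite /hcos /hsin; have := cos2Dsin2 y; move: (cos y) (sin y) => c s cs.
rewrite -[RHS]mul1r -cs; ring.
Qed.

Lemma hsin_sqr w y : dot w w = 1 -> hcos w y ^+ 2 + w 0 i2 ^+ 2 = 1 - hsin w y ^+ 2.
Proof.
by rewrite dotE => w1; rewrite -w1 !expr2 -(hcos_hsin w w y); ring.
Qed.

Lemma hsin_bound w y : dot w w = 1 -> 0 < w 0 i2 -> -1 < hsin w y < 1.
Proof.
move=> w1 w0; have := hsin_sqr y w1 => h.
rewrite -ltr_norml -(@ltr_pXn2r _ 2)// ?nnegrE ?expr1n// real_normK ?num_real//.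
have := sqr_ge0 (hcos w y); have : 0 < w 0 i2 ^+ 2 by rewrite exprn_gt0.
lra.
Qed.

Lemma is_derive_hsin w (y : R) : is_derive y (1 : R) (hsin w) (- hcos w y).
Proof.
rewrite /hsin /hcos; apply: is_derive_eq.
by rewrite /GRing.scale/=; ring.
Qed.

(** This primitive makes the area of a lune computable: [hsin w] has derivative
    [- hcos w], and the square root in [visible_height] is the one in the
    derivative of the arcsine because [w] is a unit vector. *)
Lemma is_derive_asin_hsin w (y : R) : dot w w = 1 -> 0 < w 0 i2 ->
  is_derive y (1 : R) (fun y => - asin (hsin w y)) (visible_height w y).
Proof.
move=> w1 w0.
have da := is_derive1_asin (hsin_bound y w1 w0).
have dh := is_derive_hsin w y.
have dc := is_derive1_comp da dh.
apply: is_derive_eq.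
by rewrite /visible_height (hsin_sqr y w1); ring.
Qed.

Lemma continuous_hcos w : continuous (hcos w).
Proof.
move=> y; change {for y, continuous (hcos w)}.
by apply: continuousD; apply: continuousM; try exact: cst_continuous;
  [exact: continuous_cos|exact: continuous_sin].
Qed.

Lemma continuous_visible_height w : dot w w = 1 -> 0 < w 0 i2 ->
  continuous (visible_height w).
Proof.
move=> w1 w0 y; rewrite /visible_height.
have ch : {for y, continuous (hcos w)} by exact: continuous_hcos.
apply: continuousM => //; apply: continuousV.
  by rewrite gt_eqF// sqrtr_gt0 ltr_wpDl ?sqr_ge0 ?exprn_gt0.
apply: (@continuous_comp _ _ _ (fun y => hcos w y ^+ 2 + w 0 i2 ^+ 2)); last exact: sqrt_continuous.
apply: continuousD; last exact: cst_continuous.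
exact: (@continuous_comp _ _ _ (hcos w) (fun x => x ^+ 2)) ch (@exprn_continuous _ 2 _).
Qed.

(** Two visible heights compare as two roots on a meridian do, hence as the
    cotangents of these roots: the sign of their difference is the sign of a
    sinusoid of [y]. *)
Lemma visible_height_le u v y : 0 < u 0 i2 -> 0 < v 0 i2 ->
  0 <= hcos u y * v 0 i2 - hcos v y * u 0 i2 ->
  visible_height v y <= visible_height u y.
Proof.
move=> u0 v0; move=> d0; rewrite leNgt /visible_height; apply/negP => lt_uv.
move: d0; apply/negP; rewrite -ltNge.
have [t t01 [ct st _]] := meridian_root (hcos u y) u0.
have [s s01 [cs ss _]] := meridian_root (hcos v y) v0.
set ru := Num.sqrt _ in ct st lt_uv *; set rv := Num.sqrt _ in cs ss lt_uv *.
have ru0 : 0 < ru by rewrite sqrtr_gt0 ltr_wpDl ?sqr_ge0 ?exprn_gt0.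
have rv0 : 0 < rv by rewrite sqrtr_gt0 ltr_wpDl ?sqr_ge0 ?exprn_gt0.
have cst : cos s < cos t by rewrite ct cs ltrN2.
have ts : t < s.
  have tI : t \in `[0, pi]%R by case/andP: t01 => *; rewrite in_itv/= !ltW.
  have sI : s \in `[0, pi]%R by case/andP: s01 => *; rewrite in_itv/= !ltW.
  by rewrite -ltr_cos.
have sst : 0 < sin (s - t).
  by rewrite sin_gt0_pi//; apply/andP; split; move: s01 t01 => /andP[? ?] /andP[? ?]; lra.
rewrite sinB ss cs st ct in sst.
have := mulr_gt0 sst (mulr_gt0 ru0 rv0).
rewrite (_ : _ * (ru * rv) = - (hcos u y * v 0 i2 - hcos v y * u 0 i2)) ?oppr_gt0//.
by field; rewrite !gt_eqF.
Qed.

Lemma hcosDpi w y : hcos w (y + pi) = - hcos w y.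
Proof. by rewrite /hcos cosDpi sinDpi; ring. Qed.

Lemma hsinDpi w y : hsin w (y + pi) = - hsin w y.
Proof. by rewrite /hsin cosDpi sinDpi; ring. Qed.

(** A sinusoid is determined by one of its zeros and its slope there. *)
Lemma hcosB w y p : hcos w p = 0 -> hcos w y = - hsin w p * sin (p - y).
Proof.
rewrite /hcos /hsin sinB => e.
have := cos2Dsin2 p; move: (cos p) (sin p) (cos y) (sin y) e => c s c' s' e cs.
rewrite -[LHS]mul1r -cs.
have e1 : w 0 i0 * c = - (w 0 i1 * s) by lra.
apply/eqP; rewrite -subr_eq0; apply/eqP.
transitivity ((w 0 i0 * c + w 0 i1 * s) * (c * c' + s * s')); last by rewrite e mul0r.
ring.
Qed.

Section Area.
Variables u v : 'rV[R]_3.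
Hypotheses (u1 : dot u u = 1) (v1 : dot v v = 1).
Hypotheses (u0 : 0 < u 0 i2) (v0 : 0 < v 0 i2).

(* Density of the lune in the longitude, its primitive, and the vector whose
   sinusoid has the sign of that density. *)
Let g y := visible_height u y - visible_height v y.
Let G y := asin (hsin v y) - asin (hsin u y).
Let d : 'rV[R]_3 := v 0 i2 *: u - u 0 i2 *: v.

Let dG (y : R) : is_derive y (1 : R) G (g y).
Proof.
have h1 := is_derive_asin_hsin y u1 u0.
have h2 := is_derive_asin_hsin y v1 v0.
have h := is_deriveB h1 h2.
rewrite (_ : G = (fun y => - asin (hsin u y)) - (fun y => - asin (hsin v y))) //.
by apply/funext => x; rewrite /G !fctE opprK addrC.
Qed.

Let cg : continuous g.
Proof. by move=> y; apply: continuousB; exact: continuous_visible_height. Qed.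

Let GDpi y : G (y + pi) = - G y.
Proof.
have le (w : 'rV[R]_3) : dot w w = 1 -> 0 < w 0 i2 -> -1 <= hsin w y <= 1.
  by move=> w1 w0; have /andP[? ?] := hsin_bound y w1 w0; rewrite !ltW.
by rewrite /G !hsinDpi !asinN ?le//; ring.
Qed.

Let hcosd y : hcos d y = hcos u y * v 0 i2 - hcos v y * u 0 i2.
Proof. by rewrite /hcos !mxE; ring. Qed.

Let g_ge0 y : 0 <= hcos d y -> 0 <= g y.
Proof. by rewrite hcosd => h; rewrite subr_ge0; apply: visible_height_le. Qed.

Let g_le0 y : hcos d y <= 0 -> g y <= 0.
Proof.
rewrite hcosd subr_le0 => h; rewrite subr_le0; apply: visible_height_le => //.
by rewrite subr_ge0.
Qed.

Let lune_outer :
  sphere_integral (lune u v) = (\int[mu]_(y in [set` `[0, 2 * pi]%R]) (Num.max (g y) 0)%:E)%E.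
Proof.
rewrite sphere_integral_tonelli; [|exact: lune_ge0|exact: measurable_lune].
apply: eq_integral => y _; rewrite -meridian_lune//.
by apply: eq_integral => x _; rewrite /lune !dot_sphere_pt.
Qed.

Let max_pos x y : x <= y -> (forall t, x <= t <= y -> 0 <= hcos d t) ->
  (\int[mu]_(y in [set` `[x, y]%R]) (Num.max (g y) 0)%:E = (G y - G x)%:E)%E.
Proof.
move=> xy h; rewrite -(integral_derive xy dG cg); apply: eq_integral => t /set_mem /=.
by rewrite in_itv/= => /h/g_ge0 gt; rewrite max_l.
Qed.

Let max_neg x y : (forall t, x <= t <= y -> hcos d t <= 0) ->
  (\int[mu]_(y in [set` `[x, y]%R]) (Num.max (g y) 0)%:E = 0)%E.
Proof.
move=> h; apply: integral0_eq => t /=.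
by rewrite in_itv/= => /h/g_le0 gt; rewrite max_r.
Qed.

Let mg : measurable_fun setT (fun y => (Num.max (g y) 0)%:E).
Proof.
apply/measurable_EFinP; apply: measurable_maxr => //.
exact: continuous_measurable_fun.
Qed.

Let pi2 : (pi : R) <= 2 * pi. Proof. have := pi_gt0 R; lra. Qed.

(** The density is positive on a half turn starting or ending at a zero [p] of
    the sinusoid, so the area is [2 * `|A - B|], with [A], [B] the angles
    [asin (hsin _ p)]. The plane of [u] and [v] meets the horizontal plane at
    right angles to the longitude [p], so both angles are measured in that plane
    and [A - B] is, up to sign, the angle between [u] and [v]. *)
Lemma lune_area_pos : sphere_integral (lune u v) = (2 * acos (dot u v))%:E.
Proof.
have pi0 := pi_gt0 R.
(* a sinusoid takes opposite values at 0 and pi *)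
have [p p01 dp] : exists2 p, p \in `[0, pi]%R & hcos d p = 0.
  apply: IVT; first exact: pi_ge0.
    exact/continuous_subspaceT/continuous_hcos.
  have : hcos d pi = - hcos d 0 by rewrite -(add0r pi) hcosDpi.
  move: (hcos d pi) (hcos d 0) => x y ->.
  rewrite ge_min le_max oppr_le0 oppr_ge0.
  by rewrite orbC andbb le_total.
rewrite in_itv/= in p01; case/andP: p01 => p0 ppi.
have hd y := hcosB y dp.
set A := asin (hsin u p); set B := asin (hsin v p).
have Gp : G p = B - A by [].
have ubnd := hsin_bound p u1 u0; have vbnd := hsin_bound p v1 v0.
have ubnd' : -1 <= hsin u p <= 1 by case/andP: ubnd => *; rewrite !ltW.
have vbnd' : -1 <= hsin v p <= 1 by case/andP: vbnd => *; rewrite !ltW.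
(* at p the vectors u and v have parallel components off the hsin axis *)
have cAB : cos (A - B) = dot u v.
  rewrite cosB cos_asin// cos_asin// asinK ?in_itv// asinK ?in_itv//.
  rewrite -!hsin_sqr// -sqrtrM ?addr_ge0 ?sqr_ge0//.
  have e : hcos u p * v 0 i2 = hcos v p * u 0 i2.
    by apply/eqP; rewrite -subr_eq0 -hcosd dp.
  have -> : (hcos u p ^+ 2 + u 0 i2 ^+ 2) * (hcos v p ^+ 2 + v 0 i2 ^+ 2) =
      (hcos u p * hcos v p + u 0 i2 * v 0 i2) ^+ 2.
    apply/eqP; rewrite -subr_eq0; apply/eqP.
    transitivity ((hcos u p * v 0 i2 - hcos v p * u 0 i2) ^+ 2); first ring.
    by rewrite e subrr expr0n.
  rewrite sqrtr_sqr ger0_norm.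
    by rewrite dotE -(hcos_hsin u v p); ring.
  rewrite -(pmulr_rge0 _ u0) mulrDr addr_ge0//; last by rewrite !mulr_ge0// ltW.
  have -> : u 0 i2 * (hcos u p * hcos v p) = hcos u p * (hcos v p * u 0 i2) by ring.
  by rewrite -e mulrA -expr2 mulr_ge0 ?sqr_ge0// ltW.
have lA : `|A - B| <= pi.
  have := asin_geNpi2 ubnd'; have := asin_lepi2 ubnd'.
  have := asin_geNpi2 vbnd'; have := asin_lepi2 vbnd'.
  rewrite -/A -/B ler_norml => *; apply/andP; split; lra.
have acosE : acos (dot u v) = `|A - B|.
  by rewrite -cAB -cos_norm cosK// in_itv/= normr_ge0.
(* which of the two cases occurs depends on the sign of the slope at p, but the
   area is nonnegative *)
suff I2 : sphere_integral (lune u v) = (2 * (A - B))%:E \/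
          sphere_integral (lune u v) = (2 * (B - A))%:E.
  have I0 := sphere_integral_ge0 (@lune_ge0 _ u v).
  case: I2 => I2; rewrite I2 acosE; move: I0; rewrite I2 lee_fin pmulr_rge0// => I0.
    by rewrite ger0_norm.
  by rewrite distrC ger0_norm.
rewrite lune_outer.
rewrite (@integral_itv_split _ _ 0 p); [|exact: p0|exact: (le_trans ppi)| |exact: mg]; last first.
  by move=> t; rewrite lee_fin le_max lexx orbT.
rewrite (@integral_itv_split _ _ p (p + pi)); [| | | |exact: mg]; last 3 first.
- by rewrite lerDl ltW.
- by rewrite mulr_natl mulr2n lerD2r.
- by move=> t; rewrite lee_fin le_max lexx orbT.
have G2 : G (2 * pi) = G 0.
  by rewrite mulr_natl mulr2n GDpi -(add0r pi) GDpi opprK.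
have s1 t : p <= t <= p + pi -> sin (p - t) <= 0.
  move=> /andP[h1 h2]; rewrite -(opprB t p) sinN oppr_le0 sin_ge0_pi//.
  by apply/andP; split; lra.
have s2 t : 0 <= t <= p -> 0 <= sin (p - t).
  by move=> /andP[h1 h2]; rewrite sin_ge0_pi//; apply/andP; split; lra.
have s3 t : p + pi <= t <= 2 * pi -> 0 <= sin (p - t).
  move=> /andP[h1 h2]; rewrite -(opprK (p - t)) sinN opprB -[t](subrK pi) addrAC sinDpi opprK.
  by rewrite sin_ge0_pi//; apply/andP; split; lra.
have [k0|k0] := leP 0 (hsin d p).
- left; rewrite (@max_neg 0 p); last first.
    by move=> t /s2 h; rewrite hd mulNr oppr_le0 mulr_ge0.
  rewrite (@max_pos p (p + pi)); [|by rewrite lerDl ltW|]; last first.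
    by move=> t /s1 h; rewrite hd mulNr oppr_ge0 mulr_ge0_le0.
  rewrite max_neg; last by move=> t /s3 h; rewrite hd mulNr oppr_le0 mulr_ge0.
  by rewrite add0e adde0 GDpi Gp; congr EFin; ring.
- right; rewrite (@max_pos 0 p)//; last first.
    by move=> t /s2 h; rewrite hd mulr_ge0// oppr_ge0 ltW.
  rewrite (@max_neg p (p + pi)); last first.
    by move=> t /s1 h; rewrite hd mulr_ge0_le0// oppr_ge0 ltW.
  rewrite max_pos; [|by rewrite mulr_natl mulr2n lerD2r|]; last first.
    by move=> t /s3 h; rewrite hd mulr_ge0// oppr_ge0 ltW.
  by rewrite add0e GDpi Gp G2 -EFinD; congr EFin; ring: Gp.
Qed.

End Area.
End LunePositive.

Section LuneGeneral.
Variable R : realType.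
Local Notation mu := (@lebesgue_measure R).
Local Notation mR := (measurableTypeR R).
Local Notation pm := (mu \x mu)%E.
Local Notation chart := (@sphere_chart R).
Implicit Types (u v e w : 'rV[R]_3).

Let pi0 : 0 < pi :> R := pi_gt0 R.

Lemma integral_sin (x y : R) : x <= y ->
  (\int[mu]_(t in [set` `[x, y]%R]) (sin t)%:E = (cos x - cos y)%:E)%E.
Proof.
move=> xy; have dc (t : R) : is_derive t (1 : R) (fun x => - cos x) (sin t).
  by apply: is_derive_eq; rewrite opprK.
rewrite (integral_derive xy dc); last exact: continuous_sin.
by congr EFin; ring.
Qed.

Lemma adde_EFin_eq (x : \bar R) (a b : R) : (x + a%:E = b%:E)%E -> x = (b - a)%:E.
Proof. by case: x => [r [<-]| |]//; rewrite addrK. Qed.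

Lemma measurable_cst1 : sphere_measurable (fun=> 1%E : \bar R).
Proof. exact: measurable_cst. Qed.

Lemma sphere_area : sphere_integral (fun=> 1%E : \bar R) = (4 * pi)%:E.
Proof.
rewrite sphere_integral_tonelli//; last exact: measurable_cst1.
under eq_integral do under eq_integral do rewrite mul1e.
under eq_integral do rewrite integral_sin ?pi_ge0// cos0 cospi opprK.
rewrite integral_cst//= lebesgue_measure_itv/= lte_fin mulr_gt0//.
by rewrite -EFinB -EFinM; congr EFin; ring.
Qed.

(** The counterpart of [meridian_lune] for a single height function. *)
Lemma meridian_hemisphere (a b : R) : 0 < b ->
  (\int[mu]_(x in [set` `[0, pi]%R])
    (((0 < b * cos x + a * sin x)%R%:R)%:E * (sin x)%:E) =
  (1 + a / Num.sqrt (a ^+ 2 + b ^+ 2))%:E)%E.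
Proof.
move=> b0; have [t t01 [ct st ht]] := meridian_root a b0.
have r0 : 0 < Num.sqrt (a ^+ 2 + b ^+ 2) by rewrite sqrtr_gt0 ltr_wpDl ?sqr_ge0 ?exprn_gt0.
rewrite (_ : 1 + _ = cos 0 - cos t); last by rewrite cos0 ct; ring.
have /andP[t0 tpi] := t01.
rewrite -integral_sin ?ltW// -(@integral_itv_bndo_bndc _ (BLeft 0) t (EFin \o sin)); last first.
  apply: (measurable_funS measurableT) => //; apply/measurable_EFinP.
  by apply: continuous_measurable_fun; exact: continuous_sin.
rewrite integral_mkcond [RHS]integral_mkcond; apply: eq_integral => x _.
rewrite !patchE; case: ifPn => [/set_mem /=|nx].
  rewrite in_itv/= => x0pi; rewrite ht pmulr_rgt0// (sin_sub_sgn t01 x0pi).1.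
  case: ifPn => [/set_mem/=|]; first by rewrite in_itv/= => /andP[_ ->]; rewrite mul1e.
  move=> /negP h; case: (boolP (x < t)) => [h'|]; rewrite ?mul0e//.
  by exfalso; apply: h; apply/mem_set; rewrite /= in_itv/= h' andbT; case/andP: x0pi.
rewrite memNset// => /=; rewrite in_itv/= => /andP[sx xt]; move/negP: nx; apply.
by apply/mem_set; rewrite /= in_itv/= sx (ltW (lt_trans xt tpi)).
Qed.

(** Off the equator, a great circle meets each meridian in one point. *)
Lemma great_circle_null_nz u : u 0 i2 != 0 -> sphere_ae (fun e => dot e u != 0).
Proof.
move=> u0; pose F e : \bar R := (((dot e u == 0)%:R)%:E)%E.
have F0 e : (0 <= F e)%E by rewrite lee_fin.
have mF : sphere_measurable F.
  apply/measurable_EFinP => /=.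
  rewrite (_ : (fun _ => _) = fun p : R * R => if dot (sphere_pt p) u == 0 then 1 else 0); last first.
    by apply/funext => p; rewrite /F; case: ifP.
  apply: measurable_fun_ifT => //; apply: measurable_fun_eqr => //.
  exact: measurable_dot_sphere.
suff F_0 : sphere_integral F = 0%E.
  have := sphere_integral_eq0_ae F0 mF F_0; apply: sphere_aeS => e _.
  by rewrite /F => -[]; case: (dot e u == 0) => // /eqP; rewrite oner_eq0.
rewrite sphere_integral_tonelli//; apply: integral0_eq => y _.
pose s : R := Num.sg (u 0 i2); pose a := s * (u 0 i0 * cos y + u 0 i1 * sin y).
have b0 : 0 < s * u 0 i2 by rewrite -normrEsg normr_gt0.
have s0 : s != 0 by rewrite sgr_eq0.
have [t t01 [_ _ ht]] := meridian_root a b0.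
rewrite integral_mkcond.
rewrite (_ : _ \_ _ = (fun x => F (sphere_pt (x, y)) * (sin x)%:E)%E \_ [set t]).
  by rewrite -integral_mkcond integral_set1.
apply/funext => x; rewrite !patchE; case: ifPn => [/set_mem /=|nx].
  rewrite in_itv/= => x0pi; case: ifPn => // /negP xt.
  rewrite /F dot_sphere_pt; case: eqP => [E|]; last by rewrite mul0e.
  have := ht x; rewrite /a -!mulrA -mulrDr E mulr0 => /esym/eqP.
  have r0 : 0 < Num.sqrt (a ^+ 2 + (s * u 0 i2) ^+ 2) by rewrite sqrtr_gt0 ltr_wpDl ?sqr_ge0 ?exprn_gt0.
  rewrite mulf_eq0 gt_eqF//= => /eqP st0.
  have [] := sin_sub_sgn t01 x0pi; rewrite st0 ltxx => /esym h1 /esym h2.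
  exfalso; apply: xt; apply/mem_set => /=; apply/eqP.
  by rewrite eq_le !leNgt h1 h2.
case: ifPn => // /set_mem/= xt; exfalso; move/negP: nx; apply; apply/mem_set => /=.
by case/andP: t01 => *; rewrite xt in_itv/= !ltW.
Qed.

Lemma lune_negl u v : (lune (- u) (- v)) = lune v u.
Proof.
by apply/funext => e; rewrite /lune !dotNr oppr_gt0 oppr_lt0 andbC.
Qed.

Lemma hemisphere_area_pos u : dot u u = 1 -> 0 < u 0 i2 ->
  sphere_integral (lune u (- u)) = (2 * pi)%:E.
Proof.
move=> u1 u0; rewrite sphere_integral_tonelli; [|exact: lune_ge0|exact: measurable_lune].
transitivity (\int[mu]_(y in [set` `[0, 2 * pi]%R]) (1 + visible_height u y)%:E)%E.
  apply: eq_integral => y _; rewrite -meridian_hemisphere//.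
  apply: eq_integral => x _; rewrite /lune dotNr oppr_lt0 andbb.
  by rewrite dot_sphere_pt.
have dG (y : R) : is_derive y (1 : R) (fun y => y - asin (hsin u y)) (1 + visible_height u y).
  have h := is_derive_asin_hsin y u1 u0.
  exact: (is_deriveD (is_derive_id y 1) h).
rewrite (integral_derive _ dG).
- congr EFin; rewrite mulr_natl mulr2n.
  have -> : hsin u (pi + pi) = hsin u 0 by rewrite hsinDpi -(add0r pi) hsinDpi opprK.
  by ring.
- by rewrite mulr_ge0// pi_ge0.
- move=> y; apply: continuousD; [exact: cst_continuous|exact: continuous_visible_height].
Qed.

(** The points of a hemisphere are seen either from v or from its antipode,
    except on the great circle orthogonal to v. *)
Lemma lune_complement u v : v 0 i2 != 0 ->
  (sphere_integral (lune u v) + sphere_integral (lune u (- v)) =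
   sphere_integral (lune u (- u)))%E.
Proof.
move=> v0; rewrite -sphere_integralD//; try exact: lune_ge0; try exact: measurable_lune.
apply: ae_eq_sphere_integral.
- by move=> e; rewrite adde_ge0 ?lune_ge0.
- exact: lune_ge0.
- move: (great_circle_null_nz v0); apply: sphere_aeS => e _ ev.
  rewrite /lune !dotNr !oppr_lt0 andbb -EFinD; congr EFin.
  have [|] := boolP (0 < dot e u) => _; last by rewrite /= addr0.
  by have [| |/eqP] := ltgtP (dot e v) 0; rewrite ?addr0 ?add0r ?(negbTE ev).
Qed.

(** Two opposite hemispheres fill the sphere, so the sign of the third
    coordinate of the center can be reversed. *)
Lemma hemisphere_area u : dot u u = 1 -> u 0 i2 != 0 ->
  sphere_integral (lune u (- u)) = (2 * pi)%:E.
Proof.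
move=> u1; rewrite neq_lt => /orP[u0|]; last exact: hemisphere_area_pos.
have v1 : dot (- u) (- u) = 1 by rewrite dotNl dotNr opprK.
have v0 : 0 < (- u) 0 i2 by rewrite mxE oppr_gt0.
have hv := hemisphere_area_pos v1 v0; rewrite opprK in hv.
have : (sphere_integral (lune u (- u)) + sphere_integral (lune (- u) u) = (4 * pi)%:E)%E.
  rewrite -sphere_area -sphere_integralD; try exact: lune_ge0; try exact: measurable_lune.
  apply: ae_eq_sphere_integral => //.
  - by move=> e; rewrite adde_ge0 ?lune_ge0.
  - move: (great_circle_null_nz (negbT (lt_eqF u0))); apply: sphere_aeS => e _ eu.
    rewrite /lune !dotNr !oppr_lt0 oppr_gt0 !andbb -EFinD; congr EFin.
    by have [| |/eqP] := ltgtP (dot e u) 0; rewrite ?addr0 ?add0r ?(negbTE eu).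
rewrite hv => /adde_EFin_eq ->.
by congr EFin; ring.
Qed.

Lemma dot_unit_bound u v : dot u u = 1 -> dot v v = 1 -> -1 <= dot u v <= 1.
Proof.
move=> u1 v1; rewrite -ler_norml -(@ler_pXn2r _ 2)// ?nnegrE// expr1n real_normK ?num_real//.
by rewrite (le_trans (dot_sqr_le _ _))// u1 v1 mulr1.
Qed.

(** The case of two positive third coordinates gives the others: simultaneous
    reflection of [u] and [v] swaps the sides of the lune, and reflection of [v]
    alone replaces the lune by its complement in a hemisphere. *)
Lemma lune_area_nz u v : dot u u = 1 -> dot v v = 1 -> u 0 i2 != 0 -> v 0 i2 != 0 ->
  sphere_integral (lune u v) = (2 * acos (dot u v))%:E.
Proof.
move=> u1 v1.
have N1 w : dot w w = 1 -> dot (- w) (- w) = 1 by rewrite dotNl dotNr opprK.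
have same w w' : dot w w = 1 -> dot w' w' = 1 -> 0 < w 0 i2 * w' 0 i2 ->
    sphere_integral (lune w w') = (2 * acos (dot w w'))%:E.
  move=> w1 w1' ww; have [w0|w0|w0] := ltgtP 0 (w 0 i2).
  - by apply: lune_area_pos => //; rewrite -(pmulr_rgt0 _ w0).
  - rewrite -lune_negl lune_area_pos ?N1// ?mxE ?oppr_gt0//.
      by rewrite dotNl dotNr opprK dotC.
    by rewrite -(nmulr_rgt0 _ w0).
  - by move: ww; rewrite -w0 mul0r ltxx.
move=> u0 v0; have [uv|uv|/esym/eqP] := ltgtP 0 (u 0 i2 * v 0 i2).
- exact: same.
- have := lune_complement u v0; rewrite hemisphere_area// (same u (- v))// ?N1//; last first.
    by rewrite mxE mulrN oppr_gt0.
  move=> /adde_EFin_eq ->; congr EFin.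
  by rewrite dotNr acosN ?dot_unit_bound//; ring.
- by rewrite mulf_eq0 (negbTE u0) (negbTE v0).
Qed.

(** The area of the sphere is finite, so a constant dominates. *)
Lemma sphere_integral_dct (F : nat -> 'rV[R]_3 -> \bar R) (G : 'rV[R]_3 -> \bar R) :
  (forall n e, 0 <= F n e <= 1)%E -> (forall n, sphere_measurable (F n)) ->
  sphere_measurable G ->
  sphere_ae (fun e => F^~ e @ \oo --> G e) ->
  sphere_integral (F n) @[n --> \oo] --> sphere_integral G.
Proof.
move=> F01 mF mG FG; rewrite /sphere_integral.
have mH n := sphere_integrand_measurable (mF n).
have ms : measurable_fun chart ((fun p => (sin p.1)%:E) : mR * mR -> \bar R).
  exact: (measurable_funS measurableT _ (@measurable_sin1 R)).
have ins : pm.-integrable chart (fun p : mR * mR => (sin p.1)%:E).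
  apply/integrableP; split => //.
  apply: (@le_lt_trans _ _ (4 * pi)%:E); last exact: ltry.
  rewrite -sphere_area /sphere_integral le_eqVlt; apply/orP; left; apply/eqP.
  apply: eq_integral => p /set_mem pc; rewrite mul1e gee0_abs//.
  by rewrite lee_fin sin_chart_ge0.
have [||_ _ h] := @dominated_convergence _ _ _ pm chart (@measurable_chart R)
  (fun n p => F n (sphere_pt p) * (sin p.1)%:E)%E
  (fun p => G (sphere_pt p) * (sin p.1)%:E)%E _ mH (sphere_integrand_measurable mG) _ ins; last exact: h.
- move: FG; rewrite /sphere_ae; apply: filterS => p h pc.
  by apply: cvgeZr => //; exact: h.
- apply: nearW => p n pc; have /andP[f0 f1] := F01 n (sphere_pt p).
  rewrite gee0_abs ?sphere_integrand_ge0//; last by move=> e; case/andP: (F01 n e).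
  rewrite -[leRHS]mul1e lee_wpmul2r// lee_fin.
  exact: sin_chart_ge0.
Qed.

End LuneGeneral.

Section LuneArea.
Variable R : realType.
Implicit Types (u v e w : 'rV[R]_3).

Definition north : 'rV[R]_3 := delta_mx 0 i2.

(** For [u] on the equator, a rotation that moves [u] off the equator. *)
Definition tilt u (s : R) := cos s *: u + sin s *: north.

Lemma dot_north u : dot u north = u 0 i2.
Proof. by rewrite dotE !mxE /=; ring. Qed.

Lemma north_unit : dot north north = 1.
Proof. by rewrite dot_north mxE !eqxx. Qed.

Lemma tilt_unit u s : dot u u = 1 -> u 0 i2 = 0 -> dot (tilt u s) (tilt u s) = 1.
Proof.
move=> u1 u0; rewrite /tilt !(dotDl, dotDr, dotZl, dotZr) u1 north_unit dot_north.
by rewrite (dotC north) dot_north u0 !mulr0 !mulr1 addr0 add0r -!expr2 cos2Dsin2.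
Qed.

Lemma tilt_north u s : u 0 i2 = 0 -> tilt u s 0 i2 = sin s.
Proof. by move=> u0; rewrite !mxE u0 !eqxx mulr0 add0r mulr1. Qed.

Lemma sphere_measurable_bool (P : 'rV[R]_3 -> bool) :
  measurable_fun setT ((fun p => P (sphere_pt p)) : measurableTypeR R * measurableTypeR R -> bool) ->
  sphere_measurable (fun e => ((P e)%:R)%:E).
Proof.
move=> mP; apply/measurable_EFinP => /=.
rewrite (_ : (fun _ => _) = fun p : R * R => if P (sphere_pt p) then 1 else 0); last first.
  by apply/funext => p /=; case: ifP.
exact: measurable_fun_ifT.
Qed.

Lemma le0_all_eps (x : \bar R) (k : R) : (0 <= x)%E -> 0 < k ->
  (forall s, 0 < s <= 1 -> (x <= (k * s)%:E)%E) -> x = 0%E.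
Proof.
move=> x0 k0 h; apply/eqP; rewrite eq_le x0 andbT.
apply/lee_addgt0Pr => e e0; rewrite add0e.
pose s := Num.min 1 (e / k).
have s01 : 0 < s <= 1 by rewrite ge_min lexx/= lt_min ltr01 divr_gt0.
rewrite (le_trans (h _ s01))// lee_fin mulrC -ler_pdivlMr//.
by rewrite ge_min lexx orbT.
Qed.

(** If [u] lies on the equator its great circle consists of two meridians. Away
    from the equator its points lie in the two lunes between two slight tilts of [u],
    whose total area [8 * s] is arbitrarily small. *)
Lemma great_circle_null u : dot u u = 1 -> sphere_ae (fun e => dot e u != 0).
Proof.
move=> u1; have [u0|] := eqVneq (u 0 i2) 0; last exact: great_circle_null_nz.
have n0 : sphere_ae (fun e => dot e north != 0).
  by apply: great_circle_null_nz; rewrite mxE !eqxx oner_eq0.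
pose F e : \bar R := (((dot e u == 0) && (dot e north != 0))%:R)%:E.
have F0 e : (0 <= F e)%E by rewrite lee_fin.
have mF : sphere_measurable F.
  apply: sphere_measurable_bool; apply: measurable_and.
    by apply: measurable_fun_eqr => //; exact: measurable_dot_sphere.
  apply: (@measurableT_comp _ _ _ _ _ _ negb) => //.
  by apply: measurable_fun_eqr => //; exact: measurable_dot_sphere.
suff F_0 : sphere_integral F = 0%E.
  move: (sphere_aeI (sphere_integral_eq0_ae F0 mF F_0) n0); apply: sphere_aeS => e _ [].
  rewrite /F => -[h] nz; apply/negP => eu.
  by move/eqP: h; rewrite eu nz oner_eq0.
apply: (@le0_all_eps _ 8) => //; first exact: sphere_integral_ge0.
move=> s /andP[s0 s1].
have pi2 := pi_ge2 R.
have ss : 0 < sin s by rewrite sin_gt0_pi// s0/=; lra.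
have area w w' : dot w w = 1 -> dot w' w' = 1 -> w 0 i2 != 0 -> w' 0 i2 != 0 ->
    dot w w' = cos (2 * s) -> sphere_integral (lune w w') = (4 * s)%:E.
  move=> w1 w1' w0 w0' ww; rewrite lune_area_nz// ww cosK; first by congr EFin; ring.
  by rewrite in_itv/=; apply/andP; split; lra.
have tt : dot (tilt u s) (tilt u (- s)) = cos (2 * s).
  rewrite /tilt !(dotDl, dotDr, dotZl, dotZr) u1 north_unit dot_north.
  rewrite (dotC north) dot_north u0 cosN sinN mulr_natl cos_mulr2n.
  by have := cos2Dsin2 s; lra.
have sp : tilt u s 0 i2 != 0 by rewrite tilt_north// gt_eqF.
have sn : tilt u (- s) 0 i2 != 0 by rewrite tilt_north// sinN oppr_eq0 gt_eqF.
rewrite (_ : 8 * s = 4 * s + 4 * s); last ring.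
have tt' : dot (tilt u (- s)) (tilt u s) = cos (2 * s) by rewrite dotC.
rewrite EFinD -{1}(area _ _ _ _ sp sn tt) ?tilt_unit//.
rewrite -(area _ _ _ _ sn sp tt') ?tilt_unit//.
rewrite -sphere_integralD; try exact: lune_ge0; try exact: measurable_lune.
apply: le_sphere_integral => //.
- by move=> e; rewrite adde_ge0 ?lune_ge0.
- by apply: emeasurable_funD; exact: measurable_lune.
- have h e : F e = 1%E -> (1 <= lune (tilt u s) (tilt u (- s)) e + lune (tilt u (- s)) (tilt u s) e)%E.
    rewrite /F => -[]; case: eqP => [eu|_] /=; last by move/esym/eqP; rewrite oner_eq0.
    case: eqP => [_|/eqP en _]; first by move/esym/eqP; rewrite oner_eq0.
    rewrite /lune -EFinD lee_fin /tilt cosN sinN !(dotDr, dotZr) eu !mulr0 !add0r.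
    rewrite mulNr oppr_lt0 oppr_gt0 !pmulr_rgt0// !pmulr_rlt0// !andbb.
    by have [| |/eqP] := ltgtP (dot e north) 0; rewrite ?addr0 ?add0r ?(negbTE en).
  apply: (@sphere_aeS _ (fun=> True)); last by rewrite /sphere_ae; apply: nearW.
  move=> e _ _; have [//|f] : F e = 1%E \/ F e = 0%E.
    by rewrite /F; case: (_ && _); [left|right].
  + by move=> f; rewrite [X in (X <= _)%E]f; exact: h.
  + by rewrite f adde_ge0 ?lune_ge0.
Qed.

Lemma cvg_dot (w_ : nat -> 'rV[R]_3) w e :
  (forall i, w_ n 0 i @[n --> \oo] --> w 0 i) -> dot e (w_ n) @[n --> \oo] --> dot e w.
Proof.
move=> h; rewrite dotE; under eq_fun do rewrite dotE.
by apply: cvgD; [apply: cvgD|]; apply: cvgMr; exact: h.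
Qed.

(** The indicators converge off two great circles, which are null. *)
Lemma sphere_integral_lune_cvg (u_ v_ : nat -> 'rV[R]_3) u v :
  dot u u = 1 -> dot v v = 1 ->
  (forall i, u_ n 0 i @[n --> \oo] --> u 0 i) ->
  (forall i, v_ n 0 i @[n --> \oo] --> v 0 i) ->
  sphere_integral (lune (u_ n) (v_ n)) @[n --> \oo] --> sphere_integral (lune u v).
Proof.
move=> u1 v1 uu vv; apply: sphere_integral_dct.
- by move=> n e; rewrite lune_ge0 lee_fin lern1 leq_b1.
- by move=> n; exact: measurable_lune.
- exact: measurable_lune.
move: (sphere_aeI (great_circle_null u1) (great_circle_null v1)).
apply: sphere_aeS => e _ [eu ev].
have sgu : \forall n \near \oo, (0 < dot e (u_ n)) = (0 < dot e u).
  have c := cvg_dot (e := e) uu.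
  have [h|h|/eqP] := ltgtP (dot e u) 0; last by rewrite (negbTE eu).
  - by near=> n; apply/negbTE; rewrite -leNgt ltW//; near: n; exact: (cvgr_lt _ c).
  - by near=> n; near: n; exact: (cvgr_gt _ c).
have sgv : \forall n \near \oo, (dot e (v_ n) < 0) = (dot e v < 0).
  have c := cvg_dot (e := e) vv.
  have [h|h|/eqP] := ltgtP (dot e v) 0; last by rewrite (negbTE ev).
  - by near=> n; near: n; exact: (cvgr_lt _ c).
  - by near=> n; apply/negbTE; rewrite -leNgt ltW//; near: n; exact: (cvgr_gt _ c).
apply: cvg_near_cst; near=> n; rewrite /lune; congr (_%:R)%:E.
by congr nat_of_bool; congr andb; near: n.
Unshelve. all: by end_near.
Qed.

Lemma unit_approx u : dot u u = 1 -> exists2 u_ : nat -> 'rV[R]_3,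
  forall n, dot (u_ n) (u_ n) = 1 /\ u_ n 0 i2 != 0 &
  forall i, u_ n 0 i @[n --> \oo] --> u 0 i.
Proof.
move=> u1; have [u0|u0] := eqVneq (u 0 i2) 0; last first.
  by exists (fun=> u) => // i; exact: cvg_cst.
pose s (n : nat) : R := n.+1%:R^-1.
have s0 : s @ \oo --> (0 : R) by exact: cvg_harmonic.
exists (fun n => tilt u (s n)) => [n|i].
  split; first exact: tilt_unit.
  rewrite tilt_north// gt_eqF// sin_gt0_pi// invr_gt0 ltr0n/=.
  apply: (@le_lt_trans _ _ 1); first by rewrite invf_le1 ?ler1n ?ltr0n.
  by apply: lt_le_trans (pi_ge2 R); rewrite ltr1n.
rewrite [X in _ --> X](_ : _ = tilt u 0 0 i); last by rewrite !mxE cos0 sin0; ring.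
rewrite !mxE; under eq_fun do rewrite !mxE.
have cc : cos (s n) @[n --> \oo] --> cos 0 by apply: (cvg_comp _ _ s0); exact: continuous_cos.
have cs : sin (s n) @[n --> \oo] --> sin 0 by apply: (cvg_comp _ _ s0); exact: continuous_sin.
by apply: cvgD; apply: cvgMl.
Qed.

(** Both sides are continuous in [u] and [v]; comparing the cosines of the
    limits avoids the continuity of the arc cosine at the ends of its domain. *)
Lemma lune_area u v : dot u u = 1 -> dot v v = 1 ->
  sphere_integral (lune u v) = (2 * acos (dot u v))%:E.
Proof.
move=> u1 v1.
have [u_ hu cu] := unit_approx u1; have [v_ hv cv] := unit_approx v1.
have c := sphere_integral_lune_cvg u1 v1 cu cv.
have fc : dot (u_ n) (v_ n) @[n --> \oo] --> dot u v.
  rewrite dotE; under eq_fun do rewrite dotE.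
  by apply: cvgD; [apply: cvgD|]; apply: cvgM; (exact: cu || exact: cv).
pose a n := acos (dot (u_ n) (v_ n)).
have bnd n : -1 <= dot (u_ n) (v_ n) <= 1 by apply: dot_unit_bound; case: (hu n); case: (hv n).
have ea n : sphere_integral (lune (u_ n) (v_ n)) = (2 * a n)%:E.
  by apply: lune_area_nz; case: (hu n); case: (hv n).
rewrite (_ : (fun n => _) = (fun n => (2 * a n)%:E)) in c; last exact/funext.

have a_ge0 n : 0 <= a n by exact: acos_ge0.
have a_le n : a n <= pi by exact: acos_lepi.
have [l lE] : exists l, sphere_integral (lune u v) = l%:E.
  have I0 : (0 <= sphere_integral (lune u v))%E by apply: sphere_integral_ge0; exact: lune_ge0.
  have I1 : (sphere_integral (lune u v) <= (2 * pi)%:E)%E.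
    rewrite -(cvg_lim _ c)//; apply: lime_le; first by apply/cvg_ex; eexists; exact: c.
    by apply: nearW => n; rewrite lee_fin ler_pM2l.
  by exists (fine (sphere_integral (lune u v))); rewrite fineK// ge0_fin_numE// (le_lt_trans I1)// ltry.
rewrite lE; rewrite lE in c; congr EFin.
have {}c : 2 * a n @[n --> \oo] --> l by move/fine_cvg: c.
have {}c : a n @[n --> \oo] --> l / 2.
  rewrite (_ : a = fun n => (2 * a n) / 2); first exact: cvgMl.
  by apply/funext => n; rewrite mulrAC mulfV ?mul1r.
have l01 : 0 <= l / 2 <= pi.
  have ca : cvgn a by apply/cvg_ex; exists (l / 2).
  rewrite -(cvg_lim _ c)//; apply/andP; split.
    by apply: limr_ge => //; apply: nearW.
  by apply: limr_le => //; apply: nearW.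
have cl : cos (l / 2) = dot u v.
  rewrite -(cvg_lim _ fc)//; apply/esym/cvg_lim => //.
  rewrite (_ : (fun n => _) = cos \o a).
    by apply: (cvg_comp _ _ c); exact: continuous_cos.
  by apply/funext => n; rewrite /= /a acosK// in_itv/=.
by rewrite -cl cosK ?in_itv//=; field.
Qed.

End LuneArea.

(** * Thin slabs and nondegenerate zeros *)
Section AngleChord.
Variable R : realType.
Implicit Types (u v e w : 'rV[R]_3) (x t : R).

Lemma sin_le x : 0 <= x -> sin x <= x.
Proof.
rewrite le_eqVlt => /predU1P[<-|x0]; first by rewrite sin0.
have [c _] := MVT x0 (fun t _ => is_derive_sin t) (continuous_subspaceT (@continuous_sin R)).
rewrite sin0 !subr0 => ->; rewrite -[leRHS]mul1r ler_wpM2r ?cos_le1//.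
exact: ltW.
Qed.

Lemma cos_ge x : 0 <= x -> 1 - x <= cos x.
Proof.
rewrite le_eqVlt => /predU1P[<-|x0]; first by rewrite cos0 subr0.
have [c _] := MVT x0 (fun t _ => is_derive_cos t) (continuous_subspaceT (@continuous_cos R)).
rewrite cos0 subr0 => h.
have : sin c * x <= x by rewrite -[leRHS]mul1r ler_wpM2r ?sin_le1// ltW.
by lra.
Qed.

(** A bound of second order is enough to compare an angle with its chord. *)
Lemma sin_ge x : 0 <= x -> x * (1 - x) <= sin x.
Proof.
rewrite le_eqVlt => /predU1P[<-|x0]; first by rewrite sin0 mul0r.
have [c /[!in_itv]/= /andP[c0 cx]] := MVT x0 (fun t _ => is_derive_sin t) (continuous_subspaceT (@continuous_sin R)).
rewrite sin0 !subr0 => ->; rewrite mulrC ler_wpM2r//; first exact: ltW.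
by apply: le_trans (cos_ge (ltW c0)); lra.
Qed.

Lemma chord_sin u v : dot u u = 1 -> dot v v = 1 ->
  enorm (u - v) = 2 * sin (acos (dot u v) / 2).
Proof.
move=> u1 v1; have uv := dot_unit_bound u1 v1.
set t := acos (dot u v).
have t0 : 0 <= t by exact: acos_ge0.
have tpi : t <= pi by exact: acos_lepi.
have s0 : 0 <= sin (t / 2) by rewrite sin_ge0_pi//; apply/andP; split; lra.
apply/eqP; rewrite -(@eqrXn2 _ 2)// ?enorm_ge0 ?mulr_ge0//; apply/eqP.
rewrite sqr_enorm !(dotBl, dotBr) u1 v1 (dotC v u).
have -> : dot u v = cos (t / 2 *+ 2).
  by rewrite -mulr_natr divfK// acosK// in_itv.
by rewrite cos_mulr2n cos2sin2; ring.
Qed.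

(** The chord of an angle [t] is [2 * sin (t / 2)], so it differs from [t] by a
    quadratic error, once the angle is known to be small. *)
Lemma angle_chord u v : dot u u = 1 -> dot v v = 1 -> enorm (u - v) <= 2^-1 ->
  [/\ enorm (u - v) <= acos (dot u v),
      acos (dot u v) <= 2 * enorm (u - v) &
      acos (dot u v) - enorm (u - v) <= 2 * enorm (u - v) ^+ 2].
Proof.
move=> u1 v1; rewrite chord_sin//; have uv := dot_unit_bound u1 v1.
set t := acos (dot u v); set c := 2 * sin (t / 2) => c1.
have t0 : 0 <= t by exact: acos_ge0.
have tpi : t <= pi by exact: acos_lepi.
have t2 : 0 <= t / 2 by rewrite divr_ge0.
have ct : c <= t by rewrite /c; have := sin_le t2; lra.
have tc : t * (1 - t / 2) <= c by rewrite /c; have := sin_ge t2; lra.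
have pi2 := pi_ge2 R.
have t1 : t <= 1.
  rewrite leNgt; apply/negP => t1.
  have h : (2^-1 : R) * (1 - 2^-1) <= sin 2^-1 by apply: sin_ge.
  have h' : sin 2^-1 < sin (t / 2).
    by rewrite ltr_sin ?in_itv/=; [lra|apply/andP; split; lra|apply/andP; split; lra].
  by move: c1; rewrite /c; lra.
have c0 : 0 <= c by nra.
split => //; nra.
Qed.

End AngleChord.

Section Slab.
Variable R : realType.
Implicit Types (u v e w : 'rV[R]_3).

Definition slab u (k : R) e : \bar R := ((`|dot e u| <= k)%R%:R)%:E.

Lemma slab_ge0 u k e : (0 <= slab u k e)%E. Proof. by rewrite lee_fin. Qed.

Lemma measurable_slab u k : sphere_measurable (slab u k).
Proof.
apply: sphere_measurable_bool; apply: measurable_fun_ler => //.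
by apply: measurableT_comp => //; exact: measurable_dot_sphere.
Qed.

Lemma delta_dot (i : 'I_3) e : dot e (delta_mx 0 i) = e 0 i.
Proof.
rewrite dotE !mxE eqxx /=; move: i.
by apply: ord3P; rewrite /= !(mulr1, mulr0, addr0, add0r).
Qed.

Lemma enorm_unitizeB w : w != 0 -> enorm (unitize w - w) = `|1 - enorm w|.
Proof.
move=> w0; have n0 := enorm_gt0 w0.
rewrite /unitize -[X in _ - X]scale1r -scalerBl enormZ -{2}(gtr0_norm n0) -normrM.
by rewrite mulrBl mulVf ?gt_eqF// mul1r.
Qed.

Lemma lune_unitize u v e : u != 0 -> v != 0 ->
  lune (unitize u) (unitize v) e = lune u v e.
Proof.
move=> u0 v0; rewrite /lune /unitize !dotZr.
by rewrite pmulr_rgt0 ?pmulr_rlt0 ?invr_gt0 ?enorm_gt0.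
Qed.

(** The two centers are at distance at most [4 * `|s|] after normalization. *)
Lemma lune_perturb_area u (i : 'I_3) (s : R) : dot u u = 1 -> `|s| <= 8^-1 ->
  (sphere_integral (lune (u + s *: delta_mx 0 i)%R (u - s *: delta_mx 0 i)%R) <= (16 * `|s|)%:E)%E.
Proof.
move=> u1 s8; set d : 'rV[R]_3 := delta_mx 0 i.
have d1 : enorm d = 1 by apply/enorm1; rewrite delta_dot mxE !eqxx.
have nu : enorm u = 1 by apply/enorm1.
have near1 (k : R) : `|k| <= 8^-1 -> `|1 - enorm (u + k *: d)| <= `|k| /\ u + k *: d != 0.
  move=> k8; have h : `|1 - enorm (u + k *: d)| <= `|k|.
    rewrite -{1}nu (le_trans (ler_dist_enorm _ _))// opprD addNKr.
    by rewrite enormN enormZ d1 mulr1.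
  split => //; apply: contraTneq h => ->; rewrite -(scale0r 0) enormZ normr0 mul0r subr0 normr1.
  by rewrite -ltNge; apply: (le_lt_trans k8); lra.
have [h1 n1] := near1 _ s8.
have [h2 n2] : `|1 - enorm (u - s *: d)| <= `|s| /\ u - s *: d != 0.
  by rewrite -scaleNr -(normrN s); apply: near1; rewrite normrN.
rewrite (_ : lune _ _ = lune (unitize (u + s *: d)) (unitize (u - s *: d))); last first.
  by apply/funext => e; rewrite lune_unitize.
rewrite lune_area ?dot_unitize// lee_fin.
set p := unitize _; set q := unitize _.
have pq : enorm (p - q) <= 4 * `|s|.
  have -> : p - q = (p - (u + s *: d)) + ((u + s *: d) - (u - s *: d)) + ((u - s *: d) - q).
    by rewrite !subrKA.
  apply: (le_trans (ler_enormD _ _)); apply: (@le_trans _ _ (`|s| + 2 * `|s| + `|s|)); last lra.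
  apply: lerD; [apply: (le_trans (ler_enormD _ _)); apply: lerD|].
  - by rewrite enorm_unitizeB.
  - rewrite (_ : _ - _ = (2 * s) *: d); first by rewrite enormZ d1 mulr1 normrM ger0_norm.
    by rewrite opprB addrC addrA subrK mulr_natl mulr2n scalerDl.
  - by rewrite -opprB enormN enorm_unitizeB.
have [|_ h _] := @angle_chord _ p q (dot_unitize n1) (dot_unitize n2); first lra.
lra.
Qed.

(** The area of a slab is proportional to its width. A unit vector has a
    coordinate of absolute value at least one half; perturbing [u] along the
    corresponding axis, by a multiple of the width, changes the sign of the
    height of every point of the slab. So the slab is covered by six lunes. *)
Lemma slab_area u (k : R) : dot u u = 1 -> 0 < k <= 24^-1 ->
  (sphere_integral (slab u k) <= (288 * k)%:E)%E.
Proof.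
move=> u1 /andP[k0 k1].
(* the factor 3 exceeds the factor 2 lost on the coordinate of e *)
pose A (s : R) (i : 'I_3) := lune (u + s *: delta_mx 0 i) (u - s *: delta_mx 0 i).
pose L (i : 'I_3) e : \bar R := (A (3 * k)%R i e + A (- (3 * k))%R i e)%E.
have L0 i e : (0 <= L i e)%E by rewrite adde_ge0 ?lune_ge0.
have mL i : sphere_measurable (L i) by apply: emeasurable_funD; exact: measurable_lune.
apply: (@le_trans _ _ (sphere_integral (fun e => \sum_(i <- enum 'I_3) L i e)%E)); last first.
  rewrite sphere_integral_sum//.
  apply: (@le_trans _ _ (\sum_(i <- enum 'I_3) (96 * k)%:E)%E).
    apply: lee_sum => i _; rewrite sphere_integralD; try exact: lune_ge0; try exact: measurable_lune.
    rewrite (_ : 96 * k = 16 * `|3 * k| + 16 * `|- (3 * k)|); last first.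
      by rewrite normrN gtr0_norm ?mulr_gt0//; ring.
    by rewrite EFinD leeD// lune_perturb_area// ?normrN gtr0_norm ?mulr_gt0//; lra.
  rewrite sumEFin lee_fin big_const_seq count_predT size_enum_ord iter_addr_0.
  by rewrite -mulr_natl; lra.
apply: le_sphere_integral.
- exact: slab_ge0.
- by move=> e; apply: sume_ge0.
- exact: measurable_slab.
- exact: sphere_measurable_sum.
apply: (@sphere_aeS _ (fun=> True)); last by rewrite /sphere_ae; apply: nearW.
move=> e e1 _; rewrite /slab; case: (leP `|dot e u| k) => [|_] /=; last by apply: sume_ge0.
rewrite ler_norml => /andP[h1 h2].
have [i ei] : exists i, 2^-1 < `|e 0 i|.
  apply/not_existsP => h; move: e1; rewrite dotE.
  have hh i : e 0 i * e 0 i <= (2^-1) ^+ 2.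
    rewrite -expr2 -real_normK ?num_real// lerXn2r ?nnegrE//.
    by rewrite leNgt; apply/negP; exact: h.
  have := hh i0; have := hh i1; have := hh i2.
  by rewrite expr2; lra.
rewrite (bigD1_seq i) ?enum_uniq ?mem_enum//= -[leLHS]adde0 leeD//; last by apply: sume_ge0.
rewrite /L /A /lune !(dotDr, dotZr, dotNr) delta_dot -EFinD lee_fin.
have [e0|e0] := leP 0 (e 0 i).
- rewrite ger0_norm// in ei.
  have -> : 0 < dot e u + 3 * k * e 0 i by nra.
  have -> : dot e u - 3 * k * e 0 i < 0 by nra.
  by rewrite lerDl.
- rewrite ltr0_norm// in ei.
  have -> : 0 < dot e u + - (3 * k) * e 0 i by nra.
  have -> : dot e u - (- (3 * k)) * e 0 i < 0 by nra.
  by rewrite lerDr.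
Qed.

(** This replaces outer measure: the set of exceptional directions need not be
    measurable. *)
Lemma sphere_ae_of_small (P : 'rV[R]_3 -> Prop) :
  (forall k : R, 0 < k -> exists F : 'rV[R]_3 -> \bar R,
     [/\ forall e, (0 <= F e)%E, sphere_measurable F,
         forall e, dot e e = 1 -> ~ P e -> (1 <= F e)%E &
         (sphere_integral F <= k%:E)%E]) ->
  sphere_ae P.
Proof.
move=> h; have {}h n : exists F : 'rV[R]_3 -> \bar R,
     [/\ forall e, (0 <= F e)%E, sphere_measurable F,
         forall e, dot e e = 1 -> ~ P e -> (1 <= F e)%E &
         (sphere_integral F <= (n.+1%:R^-1)%:E)%E].
  by apply: h; rewrite invr_gt0.
have [F hF] := choice h.
pose G e := einfs (F^~ e) 0%N.
have G_le n e : (G e <= F n e)%E by apply: ereal_inf_lbound; exists n.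
have G0 e : (0 <= G e)%E.
  by apply: le_ereal_inf_tmp => _ [n _ <-]; case: (hF n).
have mG : sphere_measurable G.
  apply: (@measurable_fun_einfs _ _ _ setT (fun n => F n \o @sphere_pt R)) => n.
  by case: (hF n).
have I0 : sphere_integral G = 0%E.
  apply/eqP; rewrite eq_le sphere_integral_ge0// andbT.
  apply/lee_addgt0Pr => k k0; rewrite add0e.
  have [n nk] : exists n, n.+1%:R^-1 < k.
    have := near_infty_natSinv_lt (PosNum k0) => -[n _ /(_ n)/= hn].
    by exists n; exact: hn.
  have [F0 mF _ IF] := hF n.
  apply: (@le_trans _ _ (sphere_integral (F n))).
    apply: le_sphere_integral => //.
    apply: (@sphere_aeS _ (fun=> True)); last by rewrite /sphere_ae; apply: nearW.
    by move=> e _ _; exact: G_le.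
  by rewrite (le_trans IF)// lee_fin ltW.
have := sphere_integral_eq0_ae G0 mG I0; apply: sphere_aeS => e e1 Ge.
apply: contrapT => Pe; have : (1 <= G e)%E.
  by apply: le_ereal_inf_tmp => _ [n _ <-]; case: (hF n) => _ _ + _; exact.
by rewrite Ge lee_fin ler10.
Qed.

End Slab.

(** * Crofton's formula for the tangent indicatrix *)
Section Dyadic.
Variable R : realType.
Variables a b : R.
Hypothesis ab : a < b.

(** Dyadic subdivisions are nested, which makes the number of sign changes
    monotone in [n]. *)
Definition mesh (n : nat) : R := (b - a) / (2 ^ n)%:R.
Definition dyad (n i : nat) : R := a + mesh n * i%:R.

Let p2 n : 0 < (2 ^ n)%:R :> R. Proof. by rewrite ltr0n expn_gt0. Qed.

Lemma mesh_gt0 n : 0 < mesh n.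
Proof. by rewrite divr_gt0 ?subr_gt0. Qed.

Lemma mesh_sum n : mesh n * (2 ^ n)%:R = b - a.
Proof. by rewrite /mesh divfK ?gt_eqF. Qed.

Lemma dyad0 n : dyad n 0 = a. Proof. by rewrite /dyad mulr0 addr0. Qed.

Lemma dyad_last n : dyad n (2 ^ n) = b.
Proof. by rewrite /dyad mesh_sum addrC subrK. Qed.

Lemma dyadS n i : dyad n i.+1 = dyad n i + mesh n.
Proof. by rewrite /dyad -natr1 mulrDr mulr1 addrA. Qed.

Lemma dyad_lt n i : dyad n i < dyad n i.+1.
Proof. by rewrite dyadS ltrDl mesh_gt0. Qed.

Lemma dyad_double n i : dyad n.+1 i.*2 = dyad n i.
Proof.
rewrite /dyad /mesh expnS natrM -muln2 natrM.
by field; rewrite gt_eqF.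
Qed.

Lemma dyad_itv n i : (i <= 2 ^ n)%N -> a <= dyad n i <= b.
Proof.
move=> i2; apply/andP; split; first by rewrite /dyad lerDl mulr_ge0// ltW ?mesh_gt0.
by rewrite -(dyad_last n) /dyad lerD2l ler_pM2l ?mesh_gt0// ler_nat.
Qed.

Lemma dyad_le n i j : (i <= j)%N -> dyad n i <= dyad n j.
Proof. by move=> ij; rewrite /dyad lerD2l ler_pM2l ?mesh_gt0// ler_nat. Qed.

Lemma dyad_cover n t : a <= t <= b ->
  exists2 i, (i < 2 ^ n)%N & dyad n i <= t <= dyad n i.+1.
Proof.
move=> /andP[at_ tb].
have H k : t <= dyad n k.+1 -> exists2 i, (i <= k)%N & dyad n i <= t <= dyad n i.+1.
  elim: k => [|k IH] tk; first by exists 0%N => //; rewrite dyad0 at_.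
  have [/IH [i ik it]|kt] := leP t (dyad n k.+1).
    by exists i => //; exact: leqW.
  by exists k.+1 => //; rewrite tk ltW.
have [|i ik it] := H (2 ^ n).-1; first by rewrite prednK ?expn_gt0// dyad_last.
by exists i => //; rewrite -(prednK (n := 2 ^ n)) ?ltnS ?expn_gt0.
Qed.

Lemma mesh_small (d : R) : 0 < d -> exists N, forall n, (N <= n)%N -> mesh n < d.
Proof.
move=> d0; have ba : 0 < b - a by rewrite subr_gt0.
have [N _ hN] := near_infty_natSinv_lt (PosNum (divr_gt0 d0 ba)).
exists N => n Nn; rewrite /mesh mulrC -ltr_pdivlMr//.
apply: le_lt_trans (hN n Nn); rewrite /= lef_pV2 ?posrE ?p2 ?ltr0n//.
by rewrite ler_nat ltn_expl.
Qed.

End Dyadic.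

Section Curve.
Variable R : realType.
Local Notation mu := (@lebesgue_measure R).
Implicit Types (u v e w : 'rV[R]_3).

(** The derivative is required two-sidedly at the ends of [a, b], as is the case
    for the restriction of a curve defined on the line; its continuity is stated
    uniformly because the estimates below sum over small intervals. *)
Definition C1_spherical (T T1 : R -> 'rV[R]_3) (a b : R) : Prop :=
  [/\ forall t, a <= t <= b -> dot (T t) (T t) = 1,
      forall e t, a <= t <= b -> is_derive t (1 : R) (fun x => dot e (T x)) (dot e (T1 t)) &
      forall k : R, 0 < k -> exists2 d : R, 0 < d &
        forall x y, a <= x <= b -> a <= y <= b -> `|x - y| < d -> enorm (T1 x - T1 y) <= k].

Variables (T T1 : R -> 'rV[R]_3) (a b : R).
Hypothesis ab : a < b.
Hypothesis TT1 : C1_spherical T T1 a b.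

Let T_unit := let: And3 h _ _ := TT1 in h.
Let dT := let: And3 _ h _ := TT1 in h.
Let T1_unif := let: And3 _ _ h := TT1 in h.

Lemma curve_MVT e x y : a <= x -> x < y -> y <= b -> exists2 z, x < z < y &
  dot e (T y) - dot e (T x) = dot e (T1 z) * (y - x).
Proof.
move=> ax xy yb.
have dxy z : x <= z <= y -> is_derive z (1 : R) (fun x => dot e (T x)) (dot e (T1 z)).
  by move=> /andP[xz zy]; apply: dT; rewrite (le_trans ax)//= (le_trans zy).
have [||z] := @MVT R (fun x => dot e (T x)) (fun z => dot e (T1 z)) x y xy.
- by move=> z /[!in_itv]/= /andP[xz zy]; apply: dxy; rewrite !ltW.
- apply: derivable_within_continuous => z /[!in_itv]/= /dxy h.
  exact: ex_derive.
by rewrite in_itv/= => h1 h2; exists z.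
Qed.

(** An instance of Sard's theorem. If the height and its derivative vanish
    together at a point of an interval of length [h] of a subdivision, the height
    at the left end is at most [eta * h], with [eta] the oscillation of [T1]:
    the direction lies in a slab of area proportional to [eta * h]. There are
    [(b - a) / h] intervals, and [eta] tends to 0 with [h]. *)
Lemma nondegenerate_zeros_ae : sphere_ae (fun e =>
  forall t, a <= t <= b -> dot e (T t) = 0 -> dot e (T1 t) != 0).
Proof.
have ba : 0 < b - a by rewrite subr_gt0.
apply: sphere_ae_of_small => k k0.
(* 288 is the constant of slab_area *)
pose eta := k / (288 * (b - a)).
have eta0 : 0 < eta := divr_gt0 k0 (mulr_gt0 (ltr0Sn R 287) ba).
have [d d0 hd] := T1_unif eta0.
have [N1 hN1] := mesh_small ab d0.
have [N2 hN2] : exists N, forall n, (N <= n)%N -> mesh a b n < (24 * eta)^-1.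
  by apply: mesh_small => //; rewrite invr_gt0 mulr_gt0.
pose n := maxn N1 N2.
have hd' : mesh a b n < d by apply: hN1; rewrite leq_maxl.
have h0 := mesh_gt0 ab n.
have eh0 : 0 < eta * mesh a b n by rewrite mulr_gt0.
have eh1 : eta * mesh a b n <= 24^-1.
  have : mesh a b n < (24 * eta)^-1 by apply: hN2; rewrite leq_maxr.
  rewrite -(ltr_pM2l eta0) => /ltW /le_trans; apply.
  by rewrite invfM mulrCA mulfV ?mulr1// gt_eqF.
pose F e := (\sum_(i <- iota 0 (2 ^ n)) slab (T (dyad a b n i)) (eta * mesh a b n)%R e)%E.
exists F; split.
- by move=> e; apply: sume_ge0 => i _; exact: slab_ge0.
- by apply: sphere_measurable_sum => i; exact: measurable_slab.
- move=> e e1 /existsNP[t] /not_implyP[tab] /not_implyP[et0] /negP/negPn/eqP et1.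
  have [i i2 /andP[it ti]] := dyad_cover n tab.
  have slab1 : slab (T (dyad a b n i)) (eta * mesh a b n)%R e = 1%E.
    rewrite /slab; suff -> : `|dot e (T (dyad a b n i))| <= eta * mesh a b n by [].
    move: it; rewrite le_eqVlt => /predU1P[->|it]; first by rewrite et0 normr0 ltW.
    have /andP[ai ib] := dyad_itv ab (ltnW i2); have /andP[at_ tb] := tab.
    have [z /andP[iz zt]] := curve_MVT e ai it tb.
    rewrite et0 sub0r => /(congr1 Num.norm); rewrite normrN => ->.
    have tc : t - dyad a b n i <= mesh a b n by rewrite lerBlDl -dyadS.
    rewrite normrM; apply: ler_pM => //.
      rewrite -[dot e (T1 z)]subr0 -et1 -dotBr (le_trans (norm_dot_unit _ e1))//.
      apply: hd => //.
        by rewrite (le_trans ai (ltW iz)) (le_trans (ltW zt) tb).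
      rewrite ltr_norml; apply/andP; split; lra.
    by rewrite gtr0_norm ?subr_gt0.
  rewrite /F (bigD1_seq i) ?iota_uniq//= ?mem_iota//.
  rewrite slab1 -[leLHS]adde0 leeD//.
  by apply: sume_ge0 => j _; exact: slab_ge0.
- rewrite /F sphere_integral_sum; [|by move=> i e; exact: slab_ge0|by move=> i; exact: measurable_slab].
  apply: (@le_trans _ _ (\sum_(i <- iota 0 (2 ^ n)) (288 * (eta * mesh a b n))%:E)%E).
    rewrite big_seq [leRHS]big_seq; apply: lee_sum => i; rewrite mem_iota => /andP[_ i2].
    apply: slab_area; last by rewrite eh0.
    by apply: T_unit; apply: dyad_itv => //; exact: ltnW.
  rewrite sumEFin lee_fin big_const_seq count_predT size_iota iter_addr_0.
  have -> : 288 * (eta * mesh a b n) *+ 2 ^ n = 288 * (eta * (mesh a b n * (2 ^ n)%:R)).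
    by rewrite -[LHS]mulr_natr !mulrA.
  rewrite mesh_sum /eta le_eqVlt; apply/orP; left; apply/eqP.
  by field; rewrite gt_eqF.
Qed.
End Curve.

Section AngleSum.
Variable R : realType.
Local Notation mu := (@lebesgue_measure R).
Implicit Types (u v e w : 'rV[R]_3).
Variables (T T1 : R -> 'rV[R]_3) (a b : R).
Hypothesis ab : a < b.
Hypothesis TT1 : C1_spherical T T1 a b.

Let T_unit := let: And3 h _ _ := TT1 in h.
Let T1_unif := let: And3 _ _ h := TT1 in h.

(** Extending the speed by constants makes it continuous on the line, so that
    its integrals split at the dyadic points. *)
Definition clamp (t : R) := Num.max a (Num.min t b).

Let clampE t : a <= t <= b -> clamp t = t.
Proof. by move=> /andP[at_ tb]; rewrite /clamp min_l// max_r. Qed.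

Let clamp_itv t : a <= clamp t <= b.
Proof. by rewrite /clamp le_max lexx /= ge_max ltW//= ge_min lexx orbT. Qed.

Let clamp_lip x y : `|clamp x - clamp y| <= `|x - y|.
Proof.
have ab' := ab.
have := ler_norm (x - y); have := ler_norm (y - x); rewrite (distrC y x) => h1 h2.
rewrite /clamp ler_norml !maxEle !minEle.
by case: (leP x b) => xb; case: (leP y b) => yb; rewrite ?(ltW ab);
  case: (leP a x) => ax; case: (leP a y) => ay; rewrite ?(ltW ab) /=; apply/andP; split; lra.
Qed.

Let f t := enorm (T1 (clamp t)).

Let f_unif (k : R) : 0 < k -> exists2 d : R, 0 < d & forall x y, `|x - y| < d -> `|f x - f y| <= k.
Proof.
move=> k0; have [d d0 hd] := T1_unif k0; exists d => // x y xy.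
by rewrite (le_trans (ler_dist_enorm _ _))// hd// (le_lt_trans (clamp_lip _ _)).
Qed.

Let cf : continuous f.
Proof.
move=> x; apply/cvgrPdist_le => k k0.
have [d d0 hd] := f_unif k0.
apply/nbhs_ballP; exists d => //= y; exact: hd.
Qed.

Let f0 t : 0 <= f t. Proof. exact: enorm_ge0. Qed.

Let mf : measurable_fun setT (fun t => (f t)%:E).
Proof. by apply/measurable_EFinP; exact: continuous_measurable_fun. Qed.

Let f_bounded : exists2 M, 0 < M & forall t, f t <= M.
Proof.
have [c _ hc] := EVT_max (ltW ab) (continuous_subspaceT cf).
exists (f c + 1) => [|t]; first by rewrite ltr_wpDl.
have -> : f t = f (clamp t) by rewrite /f [clamp (clamp t)]clampE.
have h : clamp t \in `[a, b]%R by rewrite in_itv/= clamp_itv.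
by rewrite (le_trans (hc _ h))// lerDl.
Qed.

Let J (x y : R) := (\int[mu]_(t in [set` `[x, y]%R]) (f t)%:E)%E.

Let J_cst (x y k : R) : x <= y ->
  (\int[mu]_(t in [set` `[x, y]%R]) k%:E)%E = (k * (y - x))%:E.
Proof.
move=> xy; rewrite integral_cst//= lebesgue_measure_itv/= lte_fin.
case: ltP => [_|yx]; first by rewrite -EFinB -EFinM.
have -> : y = x by apply/eqP; rewrite eq_le xy yx.
by rewrite subrr mulr0 mule0.
Qed.

Let J_est (x y k : R) : x <= y -> 0 <= k -> (forall t, x <= t <= y -> `|f t - f x| <= k) ->
  J x y \is a fin_num /\ `|fine (J x y) - f x * (y - x)| <= k * (y - x).
Proof.
move=> xy k0 h.
have J0 : (0 <= J x y)%E by apply: integral_ge0 => t _; rewrite lee_fin.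
have m : measurable [set` `[x, y]%R] by [].
have mf' : measurable_fun [set` `[x, y]%R] (fun t => (f t)%:E) by exact: measurable_funS mf.
have J1 : (J x y <= ((f x + k) * (y - x))%:E)%E.
  rewrite -J_cst//; apply: ge0_le_integral => //.
  - by move=> t _; rewrite lee_fin.
  - move=> t; rewrite /= in_itv/= => /h; rewrite ler_norml lee_fin => /andP[_]; lra.
have J2 : ((f x * (y - x))%:E <= J x y + (k * (y - x))%:E)%E.
  rewrite -!J_cst// -ge0_integralD//; last first.
    by move=> t _; rewrite lee_fin.
  apply: ge0_le_integral => //.
  - by move=> t _; rewrite lee_fin.
  - exact: emeasurable_funD.
  - move=> t; rewrite /= in_itv/= => /h; rewrite ler_norml -EFinD lee_fin => /andP[+ _]; lra.
have Jfin : J x y \is a fin_num by rewrite ge0_fin_numE// (le_lt_trans J1)// ltry.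
split => //; move: J1 J2; rewrite -(fineK Jfin) -EFinD !lee_fin /= => J1 J2.
by rewrite ler_norml; apply/andP; split; lra.
Qed.

Let J_sum n k : (k <= 2 ^ n)%N ->
  J a (dyad a b n k) = (\sum_(i <- iota 0 k) J (dyad a b n i) (dyad a b n i.+1))%E.
Proof.
elim: k => [_|k IH k2].
  by rewrite big_nil /J dyad0 set_itv1 integral_set1.
rewrite -addn1 iotaD big_cat/= big_seq1 add0n -IH; last exact: ltnW.
rewrite /J (@integral_itv_split _ _ a (dyad a b n k)) ?addn1//.
- by have /andP[] := dyad_itv ab (ltnW k2).
- by rewrite ltW// dyad_lt.
Qed.

Definition turn n i := acos (dot (T (dyad a b n i)) (T (dyad a b n i.+1))).

(* Over an interval of a fine subdivision, the angle, its chord, the speed times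
   the mesh and the integral of the speed agree up to a small multiple of the
   mesh. *)
Let turn_est (k : R) : 0 < k -> exists N, forall n i, (N <= n)%N -> (i < 2 ^ n)%N ->
  J (dyad a b n i) (dyad a b n i.+1) \is a fin_num /\
  `|turn n i - fine (J (dyad a b n i) (dyad a b n i.+1))| <= 3 * k * mesh a b n.
Proof.
move=> k0; have [M M0 hM] := f_bounded.
have [d d0 hd] := T1_unif k0.
have Mk : 0 < M + k by rewrite addr_gt0.
have [N1 hN1] := mesh_small ab d0.
have [N2 hN2] : exists N, forall n, (N <= n)%N -> mesh a b n < (2 * (M + k))^-1.
  by apply: mesh_small => //; rewrite invr_gt0 mulr_gt0.
have [N3 hN3] : exists N, forall n, (N <= n)%N -> mesh a b n < k / (2 * (M + k) ^+ 2).
  by apply: mesh_small => //; rewrite divr_gt0// mulr_gt0// exprn_gt0.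
exists (maxn N1 (maxn N2 N3)) => n i; rewrite !geq_max => /andP[n1 /andP[n2 n3]] i2.
have h0 := mesh_gt0 ab n.
have {}hN1 := hN1 _ n1; have {}hN2 := hN2 _ n2; have {}hN3 := hN3 _ n3.
have /andP[xa xb] := dyad_itv ab (ltnW i2).
have /andP[ya yb] := dyad_itv ab i2.
have xy := dyad_lt ab n i.
set x := dyad a b n i in xa xb xy *; set y := dyad a b n i.+1 in ya yb xy *.
have yx : y - x = mesh a b n by rewrite /y dyadS addrC addKr.
set h := mesh a b n in h0 hN1 hN2 hN3 yx *.
have itv z : x <= z <= y -> a <= z <= b.
  by move=> /andP[h1 h2]; rewrite (le_trans xa)//= (le_trans h2).
have near_x z : x <= z <= y -> enorm (T1 z - T1 x) <= k.
  move=> zxy; apply: hd; [exact: itv|by rewrite xa xb|].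
  by move/andP: zxy => [h1 h2]; rewrite ger0_norm ?subr_ge0//; lra.
have fx : f x = enorm (T1 x) by rewrite /f clampE// xa xb.
have near_f z : x <= z <= y -> `|f z - f x| <= k.
  move=> hz; rewrite fx /f clampE; last exact: itv.
  by rewrite (le_trans (ler_dist_enorm _ _))// near_x.
have [Jfin Jest] := J_est (ltW xy) (ltW k0) near_f.
split => //.
(* the mean value theorem is applied to the height in the direction of w itself *)
pose w := T y - T x - h *: T1 x.
have wk : enorm w <= k * h.
  have [->|w0] := eqVneq w 0; first by rewrite -(scale0r 0) enormZ normr0 mul0r mulr_ge0 ?ltW.
  have -> : enorm w = dot (unitize w) w.
    by rewrite /unitize dotZl -sqr_enorm expr2 mulKf// gt_eqF ?enorm_gt0.
  have [z /andP[xz zy] hz] := curve_MVT TT1 (unitize w) xa xy yb.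
  rewrite !dotBr dotZr hz yx mulrC -mulrBr -dotBr mulrC ler_pM2r//.
  rewrite (le_trans (ler_norm _))// (le_trans (norm_dot_unit _ (dot_unitize w0)))//.
  by apply: near_x; rewrite !ltW.
pose c := enorm (T x - T y).
have cE : `|c - h * f x| <= k * h.
  rewrite (_ : c = enorm (T y - T x)); last by rewrite /c -enormN opprB.
  rewrite fx -{1}(gtr0_norm h0) -enormZ.
  exact: (le_trans (ler_dist_enorm _ _)).
have fM := hM x.
have ck : c <= (M + k) * h.
  by move: cE; rewrite ler_norml => /andP[_]; nra.
have c0 : 0 <= c by exact: enorm_ge0.
have c2 : c <= 2^-1.
  apply: (le_trans ck); rewrite -(ler_pM2l (x := 2))// mulrA mulfV//.
  by move: hN2; rewrite -(ltr_pM2l (x := 2 * (M + k))) ?mulr_gt0// mulfV ?gt_eqF ?mulr_gt0// => /ltW.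
have [t1 _ t2] := angle_chord (T_unit (introT andP (conj xa xb))) (T_unit (introT andP (conj ya yb))) c2.
have cc : 2 * c ^+ 2 <= k * h.
  have : c ^+ 2 <= ((M + k) * h) ^+ 2 by rewrite lerXn2r ?nnegrE// mulr_ge0 ?ltW.
  move: hN3; rewrite ltr_pdivlMr ?mulr_gt0 ?exprn_gt0// => hN3.
  rewrite exprMn => hc; apply: (@le_trans _ _ (2 * ((M + k) ^+ 2 * h ^+ 2))); first by rewrite ler_pM2l.
  rewrite expr2 -/h; have := ltW hN3; rewrite -(ler_pM2r h0).
  by apply: le_trans; rewrite le_eqVlt; apply/orP; left; apply/eqP; ring.
rewrite -/c in t1 t2; rewrite -/(turn n i) in t1 t2.
rewrite yx in Jest.
move: Jest cE; rewrite !ler_norml => /andP[j1 j2] /andP[c3 c4].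
by apply/andP; split; lra.
Qed.

(** The total turning of inscribed spherical polygons tends to the length of the
    curve. *)
Lemma sum_turn_cvg :
  (\sum_(i <- iota 0 (2 ^ n)) (2 * turn n i)%:E)%E @[n --> \oo] -->
  (2%:E * \int[mu]_(t in [set` `[a, b]%R]) (enorm (T1 t))%:E)%E.
Proof.
have -> : (\int[mu]_(t in [set` `[a, b]%R]) (enorm (T1 t))%:E)%E = J a b.
  by apply: eq_integral => t /set_mem /=; rewrite in_itv/= => tab; rewrite /f clampE.
pose j n i := fine (J (dyad a b n i) (dyad a b n i.+1)).
have JE (k : R) : 0 < k -> exists N, forall n, (N <= n)%N ->
    J a b = (\sum_(i <- iota 0 (2 ^ n)) j n i)%:E /\
    `|\sum_(i <- iota 0 (2 ^ n)) turn n i - \sum_(i <- iota 0 (2 ^ n)) j n i|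
      <= 3 * k * (b - a).
  move=> k0; have [N hN] := turn_est k0; exists N => n Nn; split.
    rewrite -{1}(dyad_last a b n) J_sum// -sumEFin big_seq [RHS]big_seq.
    apply: eq_bigr => i; rewrite mem_iota => /andP[_ i2].
    by rewrite /j fineK//; have [] := hN n i Nn i2.
  rewrite -sumrB (le_trans (ler_norm_sum _ _ _))//.
  apply: (@le_trans _ _ (\sum_(i <- iota 0 (2 ^ n)) 3 * k * mesh a b n)).
    rewrite big_seq [leRHS]big_seq; apply: ler_sum => i; rewrite mem_iota => /andP[_ i2].
    by have [] := hN n i Nn i2.
  rewrite big_const_seq count_predT size_iota iter_addr_0.
  by rewrite -[leLHS]mulr_natr -mulrA mesh_sum.
have [N1 hN1] := JE _ (ltr01 : 0 < 1 :> R).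
have [J1 _] := hN1 _ (leqnn _); set S1 : R := \sum_(i <- _) j _ i in J1.
rewrite J1 -EFinM; under eq_fun do rewrite sumEFin -mulr_sumr.
apply: cvg_EFin; first exact: nearW.
apply: cvgMr; apply/cvgrPdist_le => k k0.
have ba : 0 < b - a by rewrite subr_gt0.
have [|N hN] := JE (k / (3 * (b - a))); first by rewrite divr_gt0// mulr_gt0.
exists N => // n /= Nn; have [J2 hn] := hN n Nn.
move: J2; rewrite J1 => -[->]; rewrite distrC (le_trans hn)//.
rewrite le_eqVlt; apply/orP; left; apply/eqP.
by field; rewrite gt_eqF.
Qed.

End AngleSum.

Section SimpleZeros.
Variable R : realType.
Implicit Types f : R -> R.

Lemma derive_neg_sign f (z c : R) : is_derive z (1 : R) f c -> c < 0 ->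
  exists2 d : R, 0 < d &
    forall w, `|w - z| < d -> (w < z -> f z < f w) /\ (z < w -> f w < f z).
Proof.
move=> [df fc] c0.
have : h^-1 *: (f (h *: (1 : R) + z) - f z) @[h --> (0 : R)^'] --> c.
  by rewrite -fc; exact: df.
move=> /cvgr_lt/(_ _ c0); rewrite near_withinE => /nbhs_ballP[d /= d0 hd].
exists d => // w wd.
have q0 : w != z -> (w - z)^-1 * (f w - f z) < 0.
  move=> wz; have := hd (w - z); rewrite /ball/= sub0r normrN => /(_ wd).
  rewrite subr_eq0 => /(_ wz).
  by rewrite /GRing.scale/= mulr1 subrK.
split => wz; have := q0 _.
- by rewrite lt_eqF// nmulr_rlt0 ?invr_lt0 ?subr_lt0// subr_gt0 => ->.
- by rewrite gt_eqF// pmulr_rlt0 ?invr_gt0 ?subr_gt0// subr_lt0 => ->.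
Qed.

Lemma derive_pos_sign f (z c : R) : is_derive z (1 : R) f c -> 0 < c ->
  exists2 d : R, 0 < d &
    forall w, `|w - z| < d -> (w < z -> f w < f z) /\ (z < w -> f z < f w).
Proof.
move=> df c0; have dN : is_derive z (1 : R) (fun x => - f x) (- c) by exact: is_deriveN.
have [|d d0 hd] := derive_neg_sign dN; first by rewrite oppr_lt0.
by exists d => // w /hd; rewrite !ltrN2.
Qed.

Lemma IVT_zero f (x y : R) : x <= y -> {within `[x, y], continuous f} ->
  f x * f y <= 0 -> exists2 z, x <= z <= y & f z = 0.
Proof.
move=> xy cf fxy; have [|z zxy fz] := @IVT R f x y 0 xy cf.
  rewrite ge_min le_max; move: fxy; case: (ltP (f x) 0) => [fx|fx].
    by rewrite (ltW fx) nmulr_rle0// => ->; rewrite orbT.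
  case: (ltP (f y) 0) => [fy|fy]; first by rewrite (ltW fy) orbT.
  move: fx; rewrite le_eqVlt => /predU1P[<-|fx]; first by rewrite lexx.
  by rewrite pmulr_rle0// => fy'; rewrite fy' !orbT.
by exists z => //; move: zxy; rewrite in_itv.
Qed.

(** Near a zero of negative derivative the function passes from positive to
    negative; if there is no other zero, the intermediate value theorem carries
    these signs to the ends of the interval. *)
Lemma down_crossing f f1 (x y : R) : x < y ->
  (forall t, x <= t <= y -> is_derive t (1 : R) f (f1 t)) ->
  (forall t, x <= t <= y -> f t = 0 -> f1 t != 0) ->
  (forall s t, x <= s <= y -> x <= t <= y -> f s = 0 -> f t = 0 -> s = t) ->
  f x != 0 -> f y != 0 ->
  (0 < f x) && (f y < 0) <-> exists2 z, x <= z <= y & f z = 0 /\ f1 z < 0.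
Proof.
move=> xy df nd uni fx fy.
have cf s t : x <= s -> t <= y -> {within `[s, t], continuous f}.
  move=> xs ty; apply: derivable_within_continuous => z /[!in_itv]/= /andP[sz zt].
  by apply: ex_derive; apply: df; rewrite (le_trans xs)//= (le_trans zt).
have left_pt (z d : R) : x < z -> 0 < d -> exists2 w, x < w < z & `|w - z| < d.
  move=> xz d0; exists (Num.max ((x + z) / 2) (z - d / 2)).
    by rewrite lt_max gt_max; apply/andP; split; [apply/orP; left; lra|apply/andP; split; lra].
  by rewrite ltr_norml; case: (leP ((x + z) / 2)) => h; apply/andP; split; lra.
have right_pt (z d : R) : z < y -> 0 < d -> exists2 w, z < w < y & `|w - z| < d.
  move=> zy d0; exists (Num.min ((y + z) / 2) (z + d / 2)).
    by rewrite lt_min gt_min; apply/andP; split; [apply/andP; split; lra|apply/orP; left; lra].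
  by rewrite ltr_norml; case: (leP ((y + z) / 2)) => h; apply/andP; split; lra.
have inner z : x <= z <= y -> f z = 0 -> x < z < y.
  move=> /andP[xz zy] fz; rewrite !lt_neqAle xz zy !andbT; apply/andP; split.
    by apply: contraNneq fx => ->; rewrite fz.
  by apply: contraNneq fy => <-; rewrite fz.
split=> [/andP[fx0 fy0]|[z zxy [fz f1z]]].
  have [|z zxy fz] := IVT_zero (ltW xy) (cf _ _ (lexx _) (lexx _)).
    by rewrite pmulr_rle0// ltW.
  exists z => //; split => //; rewrite ltNge le_eqVlt; apply/negP => /orP[/eqP h|f1z].
    by have := nd z zxy fz; rewrite -h eqxx.
  have /andP[xz zy] := inner z zxy fz.
  have [d d0 hd] := derive_pos_sign (df z zxy) f1z.
  have [w /andP[xw wz] wd] := left_pt z d xz d0.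
  have [/(_ wz) fw _] := hd w wd.
  have [||t /andP[xt tw] ft] := IVT_zero (ltW xw) (cf _ _ (lexx _) _).
  - by rewrite (le_trans (ltW wz))// ltW.
  - by rewrite pmulr_rle0// -fz ltW.
  have tz : t = z by apply: uni => //; rewrite xt (le_trans tw)// ltW// (lt_trans wz).
  by move: tw; rewrite tz leNgt wz.
have /andP[xz zy] := inner z zxy fz.
have [d d0 hd] := derive_neg_sign (df z zxy) f1z.
apply/andP; split.
- have [w /andP[xw wz] wd] := left_pt z d xz d0.
  have [/(_ wz) fw _] := hd w wd; rewrite fz in fw.
  rewrite lt_neqAle eq_sym fx/= leNgt; apply/negP => fx0.
  have [||t /andP[xt tw] ft] := IVT_zero (ltW xw) (cf _ _ (lexx _) _).
  - by rewrite (le_trans (ltW wz))// ltW.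
  - by rewrite nmulr_rle0// ltW.
  have tz : t = z by apply: uni => //; rewrite xt (le_trans tw)// ltW// (lt_trans wz).
  by move: tw; rewrite tz leNgt wz.
- have [w /andP[zw wy] wd] := right_pt z d zy d0.
  have [_ /(_ zw) fw] := hd w wd; rewrite fz in fw.
  rewrite lt_neqAle fy/= leNgt; apply/negP => fy0.
  have [||t /andP[wt ty] ft] := IVT_zero (ltW wy) (cf _ _ _ (lexx _)).
  - by rewrite (le_trans (ltW xz))// ltW.
  - by rewrite nmulr_rle0// ltW.
  have tz : t = z by apply: uni => //; rewrite ty andbT (le_trans _ wt)// ltW// (lt_trans xz).
  by move: wt; rewrite tz leNgt zw.
Qed.

End SimpleZeros.

Section Crofton.
Variable R : realType.
Local Notation mu := (@lebesgue_measure R).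
Implicit Types (u v e w : 'rV[R]_3).
Variables (T T1 : R -> 'rV[R]_3) (a b : R).
Hypothesis ab : a < b.
Hypothesis TT1 : C1_spherical T T1 a b.

Let T_unit := let: And3 h _ _ := TT1 in h.
Let dT := let: And3 _ h _ := TT1 in h.
Let T1_unif := let: And3 _ _ h := TT1 in h.

(** The sign changes from positive to negative seen at the points of the [n]-th
    subdivision. Each term is a lune, of area twice the angle turned. *)
Definition crossings n e : \bar R :=
  (\sum_(i <- iota 0 (2 ^ n)) lune (T (dyad a b n i)) (T (dyad a b n i.+1)) e)%E.

(** The lower limit exists and is measurable everywhere; it is a limit for almost
    every direction only. *)
Definition crossing_number e : \bar R := limn_einf (crossings^~ e).

(** Directions for which the sign changes at dyadic points count the zeros of
    the height. *)
Definition generic e : Prop :=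
  (forall n i, (i <= 2 ^ n)%N -> dot e (T (dyad a b n i)) != 0) /\
  (forall t, a <= t <= b -> dot e (T t) = 0 -> dot e (T1 t) != 0).

Lemma generic_ae : sphere_ae generic.
Proof.
apply: sphere_aeI; last exact: nondegenerate_zeros_ae.
apply: sphere_ae_bigcap => n; apply: sphere_ae_bigcap => i.
have [i2|i2] := leqP i (2 ^ n).
  have := great_circle_null (T_unit (dyad_itv ab i2)).
  by apply: sphere_aeS => e _ h _.
by rewrite /sphere_ae; apply: nearW.
Qed.

Lemma crossings_ge0 n e : (0 <= crossings n e)%E.
Proof. by apply: sume_ge0 => i _; exact: lune_ge0. Qed.

Lemma measurable_crossings n : sphere_measurable (crossings n).
Proof. by apply: sphere_measurable_sum => i; exact: measurable_lune. Qed.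

Lemma crossing_number_ge0 e : (0 <= crossing_number e)%E.
Proof.
rewrite /crossing_number limn_einf_lim; apply: lime_ge; first exact: is_cvg_einfs.
apply: nearW => n; apply: le_ereal_inf_tmp.
by move=> _ [k _ <-]; exact: crossings_ge0.
Qed.

Lemma measurable_crossing_number : sphere_measurable crossing_number.
Proof.
exact: (@measurable_fun_limn_einf _ _ _ setT (fun n => crossings n \o @sphere_pt R)) measurable_crossings.
Qed.

Lemma crossings_integral_cvg :
  sphere_integral (crossings n) @[n --> \oo] -->
  (2%:E * \int[mu]_(t in [set` `[a, b]%R]) (enorm (T1 t))%:E)%E.
Proof.
have := sum_turn_cvg ab TT1; apply: cvg_trans; apply: near_eq_cvg; apply: nearW => n.
rewrite /crossings sphere_integral_sum; [|by move=> i e; exact: lune_ge0|by move=> i; exact: measurable_lune].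
rewrite big_seq [RHS]big_seq; apply: eq_bigr => i; rewrite mem_iota => /andP[_ i2].
by rewrite lune_area// T_unit// dyad_itv// ltnW.
Qed.

Lemma sum_iota_double (F : nat -> \bar R) k :
  (\sum_(i <- iota 0 k.*2) F i = \sum_(i <- iota 0 k) (F i.*2 + F i.*2.+1))%E.
Proof.
elim: k => [|k IH]; first by rewrite !big_nil.
rewrite doubleS -addn2 -[in RHS]addn1 !iotaD !big_cat/= IH !add0n.
by rewrite !big_cons !big_nil !adde0.
Qed.

(** A sign change over an interval is inherited by one of its halves. *)
Lemma crossings_mono e : generic e -> {homo crossings^~ e : n m / (n <= m)%N >-> (n <= m)%E}.
Proof.
move=> [ge _]; apply: homo_leq => // [x y z|n]; first exact: le_trans.
rewrite /crossings expnS mul2n sum_iota_double big_seq [leRHS]big_seq.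
apply: lee_sum => i; rewrite mem_iota => /andP[_ i2].
have i2' : (i.*2.+1 <= 2 ^ n.+1)%N by rewrite expnS mul2n ltn_double.
rewrite /lune !dyad_double -doubleS dyad_double.
have := ge n.+1 _ i2'; rewrite -EFinD lee_fin.
by have [|] := ltP 0 (dot e (T (dyad a b n i))); have [|] := ltP (dot e (T (dyad a b n i.+1))) 0;
  have [| |//] := ltgtP (dot e (T (dyad a b n.+1 i.*2.+1))) 0 => //=; rewrite ?addr0 ?add0r ?addr_ge0.
Qed.

Lemma within_continuous_unif (g : R -> R) :
  (forall k : R, 0 < k -> exists2 d : R, 0 < d &
    forall x y, a <= x <= b -> a <= y <= b -> `|x - y| < d -> `|g x - g y| <= k) ->
  {within `[a, b], continuous g}.
Proof.
move=> h; apply/subspace_continuousP => x /=; rewrite in_itv/= => xab.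
apply/cvgrPdist_le => k k0; have [d d0 hd] := h k k0.
rewrite near_withinE; apply/nbhs_ballP; exists d => //= y xy.
by rewrite in_itv/= => yab; exact: hd.
Qed.

(** By compactness the height and its derivative are nowhere both small. Between
    two zeros the derivative vanishes somewhere, so if they are close it is small
    at both of them. *)
Lemma zeros_separated e : dot e e = 1 -> generic e ->
  exists N, forall n i s t, (N <= n)%N -> (i < 2 ^ n)%N ->
    dyad a b n i <= s <= dyad a b n i.+1 -> dyad a b n i <= t <= dyad a b n i.+1 ->
    dot e (T s) = 0 -> dot e (T t) = 0 -> s = t.
Proof.
move=> e1 [_ nd].
have d1 x y : `|dot e (T1 x) - dot e (T1 y)| <= enorm (T1 x - T1 y).
  by rewrite -dotBr norm_dot_unit.
have c0 : {within `[a, b], continuous (fun t => dot e (T t))}.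
  apply: derivable_within_continuous => z /[!in_itv]/= zab.
  by apply: ex_derive; apply: dT.
have c1 : {within `[a, b], continuous (fun t => dot e (T1 t))}.
  apply: within_continuous_unif => k k0; have [d d0 hd] := T1_unif k0.
  by exists d => // x y xab yab xy; rewrite (le_trans (d1 _ _))// hd.
have [c cab hc] := @EVT_min R (fun t => `|dot e (T t)| + `|dot e (T1 t)|) a b (ltW ab)
  (fun x => continuousD (continuous_comp (c0 x) (@norm_continuous _ _ _))
                        (continuous_comp (c1 x) (@norm_continuous _ _ _))).
rewrite in_itv/= in cab.
set m := `|_| + `|_| in hc.
have m0 : 0 < m.
  rewrite /m; have [h|h] := eqVneq (dot e (T c)) 0.
    by rewrite ltr_wpDl// normr_gt0 nd.
  by rewrite ltr_pwDl// normr_gt0.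
have [d d0 hd] := T1_unif (divr_gt0 m0 (ltr0Sn R 1)).
have [N hN] := mesh_small ab d0; exists N => n i s t Nn i2.
wlog st : s t / s < t.
  move=> W hs ht fs ft; have [h|h|//] := ltgtP s t; first exact: W.
  by apply/esym; exact: W.
move=> /andP[s1 s2] /andP[t1 t2] fs ft; exfalso.
have /andP[xa _] := dyad_itv ab (ltnW i2); have /andP[_ yb] := dyad_itv ab i2.
have as_ : a <= s by rewrite (le_trans xa).
have tb : t <= b by rewrite (le_trans t2).
have [z /andP[sz zt]] := curve_MVT TT1 e as_ st tb.
rewrite fs ft subrr => /esym/eqP; rewrite mulf_eq0 subr_eq0 (gt_eqF st) orbF => /eqP f1z.
have : m <= `|dot e (T1 s)|.
  by have := hc s; rewrite in_itv/= fs normr0 add0r; apply; rewrite as_ (le_trans (ltW st)).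
have : `|dot e (T1 s)| <= m / 2.
  rewrite -[dot e (T1 s)]subr0 -f1z (le_trans (d1 _ _))// hd//.
  - by rewrite as_ (le_trans (ltW st)).
  - by rewrite (le_trans as_ (ltW sz)) (le_trans (ltW zt)).
  - have := hN n Nn; rewrite dyadS in s2 t2; rewrite ltr_norml => h; apply/andP; split; lra.
by lra.
Qed.

Lemma zeros_finite e : dot e e = 1 -> generic e ->
  exists2 s : seq R, uniq s &
    forall t, (t \in s) = (a < t < b) && (dot e (T t) == 0).
Proof.
move=> e1 ge; have [N hN] := zeros_separated e1 ge.
pose Z : set R := [set t | (a < t < b) && (dot e (T t) == 0)].
have fZ : finite_set Z.
  apply: (@sub_finite_set _ _ (\bigcup_(i in `I_(2 ^ N))
      (Z `&` [set t | dyad a b N i <= t <= dyad a b N i.+1]))).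
    move=> t Zt; have /andP[/andP[at_ tb] _] := Zt.
    have [|i i2 it] := @dyad_cover _ a b N t; first by rewrite !ltW.
    by exists i.
  apply: bigcup_finite; first exact: finite_II.
  move=> i /= i2; have [[z [/andP[_ /eqP z0] zi]]|nz] :=
      pselect (exists z, Z z /\ dyad a b N i <= z <= dyad a b N i.+1).
    apply: (@sub_finite_set _ _ [set z]); last exact: finite_set1.
    by move=> t [/andP[_ /eqP t0] ti]; exact: hN t z (leqnn _) i2 ti zi t0 z0.
  rewrite (_ : _ `&` _ = set0); first exact: finite_set0.
  by apply/seteqP; split => // t [Zt it]; apply: nz; exists t.
have /finite_seqP[s Zs] := fZ.
exists (undup s) => [|t]; first exact: undup_uniq.
have E : Z t = [set` s] t by rewrite Zs.
rewrite mem_undup; apply/idP/idP => [h|h]; first by change (Z t); rewrite E.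
by change ([set` s] t); rewrite -E.
Qed.

(** On a fine subdivision every interval contains at most one zero, and
    [down_crossing] applies to each of them. *)
Lemma crossings_eventually e (s : seq R) : dot e e = 1 -> generic e -> uniq s ->
  (forall t, (t \in s) = (a < t < b) && (dot e (T t) == 0)) ->
  exists N, forall n, (N <= n)%N ->
    crossings n e = (\sum_(t <- s) (dot e (T1 t) < 0)%R%:R)%:E.
Proof.
move=> e1 ge us hs; have [N hN] := zeros_separated e1 ge; exists N => n Nn.
pose I i t := dyad a b n i <= t <= dyad a b n i.+1.
have step i : (i < 2 ^ n)%N -> lune (T (dyad a b n i)) (T (dyad a b n i.+1)) e =
    (\sum_(t <- s) ((I i t) && (dot e (T1 t) < 0)%R)%:R)%:E.
  move=> i2; rewrite /lune; congr EFin.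
  have /andP[xa xb] := dyad_itv ab (ltnW i2); have /andP[ya yb] := dyad_itv ab i2.
  have xy := dyad_lt ab n i.
  have itv t : I i t -> a <= t <= b.
    by move=> /andP[h1 h2]; rewrite (le_trans xa)//= (le_trans h2).
  have sI t : I i t -> dot e (T t) = 0 -> t \in s.
    move=> It t0; rewrite hs t0 eqxx andbT; have /andP[h1 h2] := itv t It.
    rewrite !lt_neqAle h1 h2 !andbT; apply/andP; split.
      apply/negP => /eqP at_; have := ge.1 n 0%N (leq0n _).
      by rewrite dyad0 at_ t0 eqxx.
    apply/negP => /eqP tb; have := ge.1 n (2 ^ n)%N (leqnn _).
    by rewrite dyad_last -tb t0 eqxx.
  have uni t t' : I i t -> I i t' -> dot e (T t) = 0 -> dot e (T t') = 0 -> t = t'.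
    exact: hN.
  have dc := down_crossing xy (fun t ht => dT e (itv t ht))
    (fun t ht => ge.2 t (itv t ht)) uni (ge.1 n i (ltnW i2)) (ge.1 n i.+1 i2).
  case: (boolP ((0 < _) && _)) => [/dc[z Iz [z0 z1]]|ndc].
    have Iz' : I i z := Iz; rewrite (bigD1_seq z) ?sI//= Iz' z1 big_seq_cond big1 ?addr0// => t.
    move=> /andP[]; rewrite hs => /andP[_ /eqP t0] tz.
    by case: (boolP (I i t)) => // It; rewrite (uni t z) ?eqxx in tz.
  rewrite big_seq big1// => t; rewrite hs => /andP[_ /eqP t0].
  case: (boolP (I i t)) => //= It; case: (ltP (dot e (T1 t)) 0) => // t1.
  by exfalso; move/negP: ndc; apply; apply/dc; exists t.
have -> : crossings n e =
    (\sum_(i <- iota 0 (2 ^ n)) (\sum_(t <- s) ((I i t) && (dot e (T1 t) < 0)%R)%:R)%:E)%E.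
  rewrite /crossings big_seq [RHS]big_seq; apply: eq_bigr => i.
  by rewrite mem_iota => /andP[_]; exact: step.
rewrite sumEFin; congr EFin; rewrite exchange_big/=.
rewrite big_seq [RHS]big_seq; apply: eq_bigr => t; rewrite hs => /andP[/andP[at_ tb] /eqP t0].
have [|i i2 it] := @dyad_cover _ a b n t; first by rewrite !ltW.
rewrite (bigD1_seq i) ?iota_uniq ?mem_iota//= /I it/= big_seq_cond big1 ?addr0// => j.
rewrite mem_iota => /andP[/andP[_ j2] ji].
case: (boolP (_ <= t <= _)) => //= /andP[t1 t2]; exfalso.
have nodyad k : (k <= 2 ^ n)%N -> dyad a b n k != t.
  by move=> k2; apply: contraNneq (ge.1 n k k2) => ->; rewrite t0.
have /andP[t3 t4] := it.
have [ij|ij|ij] := ltngtP i j.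
- have := dyad_le ab n ij => h; have /eqP := nodyad _ i2; apply.
  by apply/eqP; rewrite eq_le t4 (le_trans h)// andbT.
- have := dyad_le ab n ij => h; have /eqP := nodyad _ j2; apply.
  by apply/eqP; rewrite eq_le t2 (le_trans h)// andbT.
- by rewrite ij eqxx in ji.
Qed.

Lemma crossing_numberE e (s : seq R) : dot e e = 1 -> generic e -> uniq s ->
  (forall t, (t \in s) = (a < t < b) && (dot e (T t) == 0)) ->
  [/\ crossing_number e = (\sum_(t <- s) (dot e (T1 t) < 0)%R%:R)%:E,
     crossings n e @[n --> \oo] --> crossing_number e &
     forall n, (crossings n e <= crossing_number e)%E].
Proof.
move=> e1 ge us hs; have [N hN] := crossings_eventually e1 ge us hs.
set c : R := \sum_(t <- s) _ in hN *.
have cv : crossings n e @[n --> \oo] --> c%:E.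
  by apply: cvg_near_cst; exists N => // n /= Nn; exact: hN.
have E : crossing_number e = c%:E.
  rewrite /crossing_number is_cvg_limn_einfE; first exact/cvg_lim.
  by apply/cvg_ex; exists c%:E.
rewrite E; split => // n; rewrite -(hN (maxn N n)) ?leq_maxl//.
by apply: crossings_mono => //; exact: leq_maxr.
Qed.

(** Crofton's formula: the length of a spherical curve is half the integral over
    all directions of the number of downward zeros of its height. *)
Lemma crossing_number_integral :
  sphere_integral crossing_number =
  (2%:E * \int[mu]_(t in [set` `[a, b]%R]) (enorm (T1 t))%:E)%E.
Proof.
apply: (sphere_integral_cvg crossings_ge0 measurable_crossings crossing_number_ge0
  measurable_crossing_number) crossings_integral_cvg.
- move=> n; move: generic_ae; apply: sphere_aeS => e e1 ge.
  have [s us hs] := zeros_finite e1 ge.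
  by have [_ _] := crossing_numberE e1 ge us hs.
- move: generic_ae; apply: sphere_aeS => e e1 ge.
  have [s us hs] := zeros_finite e1 ge.
  by have [_] := crossing_numberE e1 ge us hs.
Qed.

End Crofton.

(** * Tangent indicatrix of a regular C^2 arc *)
Section VectorDerivative.
Variable R : realType.
Implicit Types (e : 'rV[R]_3) (F : R -> 'rV[R]_3).

Lemma coord_is_derive F (t : R) i : derivable F t 1 ->
  is_derive t (1 : R) (fun x => F x 0 i) (derive1 F t 0 i).
Proof.
move=> dF; have /derivable_mxP dFi := dF.
by split; [exact: dFi|rewrite derive1E derive_mx// mxE].
Qed.

Lemma is_derive_dot F e (t : R) (w : 'rV[R]_3) :
  (forall i, is_derive t (1 : R) (fun x => F x 0 i) (w 0 i)) ->
  is_derive t (1 : R) (fun x => dot e (F x)) (dot e w).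
Proof.
move=> h; rewrite (_ : (fun x => _) =
  (fun x => e 0 i0 * F x 0 i0 + e 0 i1 * F x 0 i1 + e 0 i2 * F x 0 i2)); last first.
  by apply/funext => x; rewrite dotE.
have h0 := h i0; have h1 := h i1; have h2 := h i2.
apply: is_derive_eq; rewrite dotE /GRing.scale/=; ring.
Qed.

Lemma is_derive_dot_sqr F (t : R) (w : 'rV[R]_3) :
  (forall i, is_derive t (1 : R) (fun x => F x 0 i) (w 0 i)) ->
  is_derive t (1 : R) (fun x => dot (F x) (F x)) (2 * dot (F t) w).
Proof.
move=> h; rewrite (_ : (fun x => _) =
  (fun x => F x 0 i0 * F x 0 i0 + F x 0 i1 * F x 0 i1 + F x 0 i2 * F x 0 i2)); last first.
  by apply/funext => x; rewrite dotE.
have h0 := h i0; have h1 := h i1; have h2 := h i2.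
apply: is_derive_eq; rewrite dotE /GRing.scale/=; ring.
Qed.

(** Heine's theorem. *)
Lemma segment_unif_continuous (f : R -> R) (a b : R) :
  (forall t, a <= t <= b -> {for t, continuous f}) ->
  forall k : R, 0 < k -> exists2 d : R, 0 < d &
    forall x y, a <= x <= b -> a <= y <= b -> `|x - y| < d -> `|f x - f y| <= k.
Proof.
move=> cf k k0.
pose P (d x : R) := forall y, `|x - y| < d -> `|f x - f y| <= k.
have /compact_near_coveringP cov := @segment_compact R a b.
have : \forall d \near (0 : R)^'+, `[a, b] `<=` P d.
  apply: cov => x /=; rewrite in_itv/= => /cf/cvgrPdist_le/(_ _ (divr_gt0 k0 (ltr0Sn R 1))).
  move=> /nbhs_ballP[r /= r0 hr].
  have r2 : 0 < r / 2 by rewrite divr_gt0.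
  exists (ball x (r / 2), [set d | d < r / 2]) => /=.
    split; first by apply: nbhsx_ballx.
    by apply: nbhs_right_lt.
  move=> [x' d] /= [xx' dr] y x'y.
  have h1 := hr x' (le_ball _ xx'); have h2 := hr y.
  have {}h1 : `|f x - f x'| <= k / 2.
    by apply: h1; lra.
  have {}h2 : `|f x - f y| <= k / 2.
    apply: h2; rewrite /ball/= in xx' *.
    have := ler_normD (x - x') (x' - y); rewrite subrKA; lra.
  have := ler_normD (f x' - f x) (f x - f y); rewrite subrKA (distrC (f x') (f x)); lra.
rewrite near_withinE => /nbhs_ballP[r /= r0 hr].
exists (r / 2); first by rewrite divr_gt0.
move=> x y xab _ xy; apply: (hr (r / 2)) => //=.
- by rewrite /ball/= sub0r normrN gtr0_norm ?divr_gt0//; lra.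
- by rewrite divr_gt0.
Qed.

End VectorDerivative.

Section Indicatrix.
Variable R : realType.
Implicit Types (e : 'rV[R]_3).
Variables (g : R -> 'rV[R]_3).
Hypothesis dg : forall t, derivable g t 1.
Hypothesis dv : forall t, derivable (derive1 g) t 1.
Hypothesis cw : continuous (derive1 (derive1 g)).

Let v := derive1 g.
Let w := derive1 v.
Let n t := enorm (v t).
Let T t := unitize (v t).
Let w_ t : 'rV[R]_3 := (n t)^-1 *: w t - (dot (v t) (w t) / n t ^+ 3) *: v t.

Let dvi t i : is_derive t (1 : R) (fun x => v x 0 i) (w t 0 i).
Proof. exact: coord_is_derive. Qed.

Let dn t : v t != 0 -> is_derive t (1 : R) n (dot (v t) (w t) / n t).
Proof.
move=> v0; have d2 := is_derive_dot_sqr (dvi t).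
have ds := is_derive1_sqrt (dot_gt0 v0).
have := is_derive1_comp ds d2.
rewrite (_ : _ \o _ = n)// => h; apply: is_derive_eq.
by rewrite -/(enorm (v t)) -/(n t); field; rewrite gt_eqF// enorm_gt0.
Qed.

Let dT t i : v t != 0 -> is_derive t (1 : R) (fun x => T x 0 i) (w_ t 0 i).
Proof.
move=> v0; have n0 : n t != 0 by rewrite gt_eqF// enorm_gt0.
rewrite (_ : (fun x => _) = (fun x => (n x)^-1 * v x 0 i)); last first.
  by apply/funext => x; rewrite /T /unitize mxE.
have d1 := is_deriveV n0 (dn v0); have d2 := dvi t i.
apply: is_derive_eq; rewrite /w_ !mxE /GRing.scale/=.
by field.
Qed.

Let dTt t : v t != 0 -> derive1 T t = w_ t.
Proof.
move=> v0; have dTt : derivable T t 1.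
  by apply/derivable_mxP => i j; rewrite ord1; have := dT j v0 => -[].
apply/rowP => j; rewrite derive1E derive_mx// mxE.
by have := dT j v0 => -[].
Qed.

Let cvi t i : {for t, continuous (fun x => v x 0 i)}.
Proof. by apply/differentiable_continuous/derivable1_diffP; have [] := dvi t i. Qed.

Let cwi t i : {for t, continuous (fun x => w x 0 i)}.
Proof.
apply: (@continuous_comp _ _ _ w (fun M : 'rV[R]_3 => M 0 i)); first exact: cw.
exact: coord_continuous.
Qed.

Let cn t : {for t, continuous n}.
Proof.
apply: (@continuous_comp _ _ _ (fun x => dot (v x) (v x))); last exact: sqrt_continuous.
by apply/differentiable_continuous/derivable1_diffP; have [] := is_derive_dot_sqr (dvi t).
Qed.

Let cw_ t i : v t != 0 -> {for t, continuous (fun x => w_ x 0 i)}.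
Proof.
move=> v0; have n0 : n t != 0 by rewrite gt_eqF// enorm_gt0.
rewrite (_ : (fun x => _) = (fun x => (n x)^-1 * w x 0 i -
   (v x 0 i0 * w x 0 i0 + v x 0 i1 * w x 0 i1 + v x 0 i2 * w x 0 i2)
    * (n x * n x * n x)^-1 * v x 0 i)); last first.
  by apply/funext => x; rewrite /w_ !mxE dotE !exprS expr0 mulr1 mulrA.
apply: continuousB; apply: continuousM => //.
- exact: continuousV.
- apply: continuousM.
    by apply: continuousD; [apply: continuousD|]; apply: continuousM.
  apply: continuousV; first by rewrite !mulf_neq0.
  by apply: continuousM => //; apply: continuousM.
Qed.

(** The tangent is differentiable because its denominator, the speed, does not
    vanish on [a, b]; the explicit derivative is continuous there. *)
Lemma indicatrix_C1 (a b : R) : (forall t, a <= t <= b -> derive1 g t != 0) ->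
  C1_spherical (fun t => unitize (derive1 g t)) (derive1 (fun t => unitize (derive1 g t))) a b.
Proof.
move=> v0; split => [t tab|e t tab|k k0].
- by rewrite dot_unitize// v0.
- apply: is_derive_dot => i; rewrite -/v -/(T) dTt ?v0//.
  exact: dT (v0 _ tab).
- have H i : exists2 d : R, 0 < d & forall x y, a <= x <= b -> a <= y <= b ->
      `|x - y| < d -> `|w_ x 0 i - w_ y 0 i| <= k / 2.
    apply: segment_unif_continuous => //; last by rewrite divr_gt0.
    by move=> t tab; apply: cw_; exact: v0.
  have [d0 d00 h0] := H i0; have [d1 d10 h1] := H i1; have [d2 d20 h2] := H i2.
  exists (Num.min d0 (Num.min d1 d2)); first by rewrite !lt_min d00 d10.
  move=> x y xab yab; rewrite !lt_min => /andP[x0 /andP[x1 x2]].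
  rewrite -/v -/(T) !dTt ?v0// (_ : k = 2 * (k / 2)); last by field.
  apply: enorm_le_coords; first by rewrite divr_ge0// ltW.
  have mxB (A B : 'rV[R]_3) i : (A - B) 0 i = A 0 i - B 0 i by rewrite !mxE.
  by apply: ord3P; rewrite mxB; [exact: h0|exact: h1|exact: h2].
Qed.

End Indicatrix.

(** * Local behaviour of height functions *)
Lemma cvg_dnbhs_right (R : realType) (U : topologicalType) (F : R -> U) (l : U) :
  F h @[h --> (0 : R)^'] --> l -> F h @[h --> (0 : R)^'+] --> l.
Proof.
apply: cvg_trans; apply: cvg_app; apply: within_subset => z /= z0.
by rewrite gt_eqF.
Qed.

Lemma cvg_dnbhs_left (R : realType) (U : topologicalType) (F : R -> U) (l : U) :
  F h @[h --> (0 : R)^'] --> l -> F (- h) @[h --> (0 : R)^'+] --> l.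
Proof.
move=> H; rewrite -[in X in X --> _]oppr0; apply/cvg_at_leftNP.
apply: cvg_trans H; apply: cvg_app; apply: within_subset => z /= z0.
by rewrite lt_eqF.
Qed.

Lemma near_right_contra (R : realType) (A B : R -> Prop) :
  (\forall h \near (0 : R)^'+, A h) -> (\forall h \near (0 : R)^'+, B h) ->
  (forall h, A h -> B h -> False) -> False.
Proof.
move=> hA hB AB; have : \forall h \near (0 : R)^'+, False.
  by apply: filterS2 hA hB => h; exact: AB.
by move=> /filter_ex[].
Qed.

Section GermDerivative.
Variable R : realType.
Implicit Types (e V : 'rV[R]_3) (c : R -> 'rV[R]_3).

Lemma continuous_dot e : continuous (fun u : 'rV[R]_3 => dot e u).
Proof.
move=> u; rewrite (_ : (fun u => _) =
  (fun u : 'rV[R]_3 => e 0 i0 * u 0 i0 + e 0 i1 * u 0 i1 + e 0 i2 * u 0 i2)); last first.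
  by apply/funext => x; rewrite dotE.
have h i : {for u, continuous (fun u : 'rV[R]_3 => e 0 i * u 0 i)}.
  by apply: continuousM; [exact: cst_continuous|exact: coord_continuous].
exact: (continuousD (continuousD (h i0) (h i1)) (h i2)).
Qed.

(** One-sided derivative at the base point of a germ. *)
Definition germ_derivative c V :=
  h^-1 *: (c h - c 0) @[h --> (0 : R)^'+] --> V.

Lemma germ_increasing c V e : germ_derivative c V -> 0 < dot e V ->
  \forall h \near (0 : R)^'+, dot e (c 0) < dot e (c h).
Proof.
move=> cV eV.
have : dot e (h^-1 *: (c h - c 0)) @[h --> (0 : R)^'+] --> dot e V.
  exact: (cvg_comp _ (fun u => dot e u) cV (@continuous_dot e V)).
move=> /cvgr_gt/(_ _ eV) H; near=> h.
have h0 : 0 < h by [].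
have : 0 < dot e (h^-1 *: (c h - c 0)) by near: h.
by rewrite dotZr dotBr pmulr_rgt0 ?invr_gt0// subr_gt0.
Unshelve. all: by end_near. Qed.

Lemma germ_decreasing c V e : germ_derivative c V -> dot e V < 0 ->
  \forall h \near (0 : R)^'+, dot e (c h) < dot e (c 0).
Proof.
move=> cV eV; have := @germ_increasing c V (- e) cV; rewrite dotNl oppr_gt0 => /(_ eV).
by apply: filterS => h; rewrite !dotNl ltrN2.
Qed.

Lemma germ_derivativeE c V : germ_derivative c V ->
  lim (h^-1 *: (c h - c 0) @[h --> (0 : R)^'+]) = V.
Proof. exact: cvg_lim. Qed.

End GermDerivative.

Section Piece.
Variable R : realType.
Implicit Types (e : 'rV[R]_3).
Variables (f g : R -> 'rV[R]_3) (a b : R).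
Hypothesis ab : a < b.
Hypothesis gf : {in `[a, b], f =1 g}.
Hypothesis dg : forall t, derivable g t 1.
Hypothesis dv : forall t, derivable (derive1 g) t 1.
Hypothesis cw : continuous (derive1 (derive1 g)).
Hypothesis v0 : {in `[a, b], forall t, derive1 g t != 0}.

Let T := fun t => unitize (derive1 g t).
Let T1 := derive1 T.

Let gfE t : a <= t <= b -> f t = g t. Proof. by move=> tab; apply: gf; rewrite inE/= in_itv. Qed.
Let v0E t : a <= t <= b -> derive1 g t != 0. Proof. by move=> tab; apply: v0; rewrite inE/= in_itv. Qed.

Let TC1 : C1_spherical T T1 a b.
Proof. exact: indicatrix_C1. Qed.

Let near_fg t : a < t < b -> \forall x \near t, f x = g x.
Proof.
move=> tab; have : \forall x \near t, x \in `]a, b[%R by apply: near_in_itvoo; rewrite in_itv.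
by apply: filterS => x; rewrite in_itv/= => /andP[ax xb]; apply: gfE; rewrite !ltW.
Qed.

Lemma piece_derive1 t : a < t < b -> derive1 f t = derive1 g t.
Proof. by move=> tab; rewrite !derive1E; apply: near_eq_derive; exact: near_fg. Qed.

Lemma piece_curvature t : a < t < b ->
  enorm (curvature_vector f t) * enorm (derive1 f t) = enorm (T1 t).
Proof.
move=> tab; have tab' : a <= t <= b by case/andP: tab => *; rewrite !ltW.
have nv : 0 < enorm (derive1 g t) by rewrite enorm_gt0// v0E.
rewrite /curvature_vector piece_derive1// enormZ gtr0_norm ?invr_gt0// mulrAC mulVf ?gt_eqF// mul1r.
suff -> : derive1 (fun x => unitize (derive1 f x)) t = T1 t by [].
rewrite /T1 !derive1E; apply: near_eq_derive.
have : \forall x \near t, x \in `]a, b[%R by apply: near_in_itvoo; rewrite in_itv.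
by apply: filterS => x; rewrite in_itv/= => xab; rewrite /T piece_derive1.
Qed.

Lemma piece_critical e t : a < t < b -> dot e (derive1 f t) = 0 <-> dot e (T t) = 0.
Proof.
move=> tab; have tab' : a <= t <= b by case/andP: tab => *; rewrite !ltW.
have nv : 0 < enorm (derive1 g t) by rewrite enorm_gt0// v0E.
rewrite piece_derive1// /T /unitize dotZr; split => [->|/eqP]; first by rewrite mulr0.
by rewrite mulf_eq0 gt_eqF ?invr_gt0//= => /eqP.
Qed.

Lemma piece_germ_right : germ_derivative (fun h => f (a + h)) (derive1 g a).
Proof.
have dga := @dg a; rewrite /derivable in dga.
have : h^-1 *: (g (h *: (1 : R) + a) - g a) @[h --> (0 : R)^'] --> derive1 g a.
  by rewrite derive1E; exact: dga.
move=> /cvg_dnbhs_right H.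
apply: cvg_trans H; apply: near_eq_cvg; near=> h.
have h0 : 0 < h by [].
have hb : h < b - a by near: h; apply: nbhs_right_lt; rewrite subr_gt0.
have hE : h *: (1 : R) = h by rewrite /GRing.scale/= mulr1.
rewrite hE addr0 !gfE//.
- by rewrite (addrC h).
- by rewrite lexx ltW.
- by apply/andP; split; lra.
Unshelve. all: by end_near. Qed.

Lemma piece_germ_left : germ_derivative (fun h => f (b - h)) (- derive1 g b).
Proof.
have dgb := @dg b; rewrite /derivable in dgb.
have : h^-1 *: (g (h *: (1 : R) + b) - g b) @[h --> (0 : R)^'] --> derive1 g b.
  by rewrite derive1E; exact: dgb.
move=> /cvg_dnbhs_left H.
apply: cvg_trans (cvgN H); apply: near_eq_cvg; near=> h.
have h0 : 0 < h by [].
have hb : h < b - a by near: h; apply: nbhs_right_lt; rewrite subr_gt0.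
have hE : (- h) *: (1 : R) = - h by rewrite /GRing.scale/= mulr1.
rewrite !fctE /= hE subr0 !gfE//.
- by rewrite invrN scaleNr opprK (addrC b).
- by rewrite lexx ltW.
- by apply/andP; split; lra.
Unshelve. all: by end_near. Qed.

(** The derivative of the height of the arc is the speed times the height of the
    tangent, so it changes sign from positive to negative at [t]. *)
Lemma piece_local_max e t : a < t < b -> dot e (T t) = 0 -> dot e (T1 t) < 0 ->
  (\forall h \near (0 : R)^'+, dot e (f (t + h)) < dot e (f t)) /\
  (\forall h \near (0 : R)^'+, dot e (f (t - h)) < dot e (f t)).
Proof.
move=> tab et0 et1; have tab' : a <= t <= b by case/andP: tab => *; rewrite !ltW.
have [_ dT _] := TC1.
have [d d0 hd] := derive_neg_sign (dT e t tab') et1.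
have dh x : is_derive x (1 : R) (fun y => dot e (g y)) (dot e (derive1 g x)).
  by apply: is_derive_dot => i; exact: coord_is_derive.
have ch x y : {within `[x, y], continuous (fun y => dot e (g y))}.
  by apply: derivable_within_continuous => z _; have [] := dh z.
have vT x : a <= x <= b -> dot e (derive1 g x) = enorm (derive1 g x) * dot e (T x).
  move=> xab; rewrite /T /unitize dotZr mulVKf// gt_eqF// enorm_gt0//.
  exact: v0E.
have nv x : a <= x <= b -> 0 < enorm (derive1 g x) by move=> xab; rewrite enorm_gt0// v0E.
have /andP[at_ tb] := tab.
split; near=> h.
- have h0 : 0 < h by [].
  have hb : h < b - t by near: h; apply: nbhs_right_lt; rewrite subr_gt0.
  have hd' : h < d by near: h; apply: nbhs_right_lt.
  have th : t < t + h by rewrite ltrDl.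
  have thab : a <= t + h <= b by apply/andP; split; lra.
  rewrite !gfE// -subr_lt0.
  have [z /[!in_itv]/= /andP[tz zh] ->] := MVT th (fun x _ => dh x) (ch t (t + h)).
  have zab : a <= z <= b by apply/andP; split; lra.
  rewrite addrAC subrr add0r vT// pmulr_llt0// pmulr_rlt0 ?nv//.
  have zd : `|z - t| < d by rewrite ltr_norml; apply/andP; split; lra.
  apply: lt_le_trans ((hd z zd).2 tz) _.
  by rewrite et0.
- have h0 : 0 < h by [].
  have hb : h < t - a by near: h; apply: nbhs_right_lt; rewrite subr_gt0.
  have hd' : h < d by near: h; apply: nbhs_right_lt.
  have th : t - h < t by rewrite gtrBl.
  have thab : a <= t - h <= b by apply/andP; split; lra.
  rewrite !gfE// -subr_gt0.
  have [z /[!in_itv]/= /andP[tz zh] ->] := MVT th (fun x _ => dh x) (ch (t - h) t).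
  have zab : a <= z <= b by apply/andP; split; lra.
  rewrite subKr vT// pmulr_lgt0// pmulr_rgt0 ?nv//.
  have zd : `|z - t| < d by rewrite ltr_norml; apply/andP; split; lra.
  apply: le_lt_trans ((hd z zd).1 zh).
  by rewrite et0.
Unshelve. all: by end_near. Qed.

Lemma piece_local_min e t : a < t < b -> dot e (T t) = 0 -> 0 < dot e (T1 t) ->
  (\forall h \near (0 : R)^'+, dot e (f t) < dot e (f (t + h))) /\
  (\forall h \near (0 : R)^'+, dot e (f t) < dot e (f (t - h))).
Proof.
move=> tab et0 et1; have := @piece_local_max (- e) t tab.
rewrite !dotNl et0 oppr0 oppr_lt0 => /(_ erefl et1) [h1 h2].
by split; [apply: filterS h1|apply: filterS h2] => h; rewrite !dotNl ltrN2.
Qed.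

End Piece.

(** * Subdivided intervals *)
Section Pieces.
Variable R : realType.
Local Notation mu := (@lebesgue_measure R).
Implicit Types (a b c t : R) (s : seq R) (p : R * R).

(** Consecutive pairs of the sequence [a], [s], [b]. *)
Definition pieces a s b := zip (a :: s) (rcons s b).

Lemma pieces_cons a c s b : pieces a (c :: s) b = (a, c) :: pieces c s b.
Proof. by []. Qed.

Lemma path_lt_last a s b : path <%R a (rcons s b) -> a < b.
Proof.
by move=> /(order_path_min lt_trans)/allP; apply; rewrite mem_rcons mem_head.
Qed.

Lemma pieces_bounds a s b p : path <%R a (rcons s b) -> p \in pieces a s b ->
  [/\ a <= p.1, p.1 < p.2 & p.2 <= b].
Proof.
elim: s a => [|c s IH] a /=; first by rewrite andbT => ab; rewrite inE => /eqP->.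
move=> /andP[ac pc]; rewrite pieces_cons inE => /predU1P[->|/(IH _ pc)[h1 h2 h3]].
  by split => //=; exact: ltW (path_lt_last pc).
by split => //; rewrite (le_trans (ltW ac)).
Qed.

Lemma pieces_infix a s b p : p \in pieces a s b ->
  infix [:: p.1; p.2] (a :: rcons s b).
Proof.
elim: s a => [|c s IH] a; first by rewrite inE => /eqP->/=; rewrite !eqxx.
rewrite pieces_cons inE => /predU1P[->|/IH h].
  by rewrite /= !eqxx prefix0s.
change (prefix [:: p.1; p.2] (a :: rcons (c :: s) b) ||
        infix [:: p.1; p.2] (c :: rcons s b)).
by rewrite h orbT.
Qed.

Lemma pieces_cover a s b t : path <%R a (rcons s b) ->
  a < t < b -> t \notin s -> exists2 p, p \in pieces a s b & p.1 < t < p.2.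
Proof.
elim: s a => [|c s IH] a /=; first by move=> _ atb _; exists (a, b); rewrite ?mem_head.
move=> /andP[ac pc] /andP[at_ tb]; rewrite inE negb_or => /andP[tc ts].
have [ct|] := ltP c t.
  have [|//|p ps pt] := IH c pc; first by rewrite ct.
  by exists p => //; rewrite pieces_cons inE ps orbT.
rewrite le_eqVlt (negbTE tc)/= => tc'; exists (a, c); first by rewrite pieces_cons mem_head.
by rewrite /= at_.
Qed.

Lemma pieces_avoid a s b p t : path <%R a (rcons s b) -> p \in pieces a s b ->
  p.1 < t < p.2 -> (a < t < b) && (t \notin s).
Proof.
elim: s a => [|c s IH] a /=; first by rewrite andbT inE => ab /eqP-> /= ->.
move=> /andP[ac pc]; rewrite pieces_cons inE => /predU1P[->/= /andP[at_ tc]|ps pt].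
  rewrite at_ (lt_trans tc (path_lt_last pc))/= inE negb_or lt_eqF//=.
  apply/negP => ts; have /(order_path_min lt_trans)/allP/(_ t) := pc.
  by rewrite mem_rcons inE ts orbT => /(_ isT); rewrite ltNge ltW.
have /andP[/andP[ct tb] ts] := IH c pc ps pt.
by rewrite (lt_trans ac ct) tb/= inE negb_or ts gt_eqF.
Qed.

Lemma pieces_disjoint a s b p q t : path <%R a (rcons s b) ->
  p \in pieces a s b -> q \in pieces a s b -> p.1 < t < p.2 -> q.1 < t < q.2 -> p = q.
Proof.
elim: s a => [|c s IH] a /=; first by move=> _; rewrite !inE => /eqP-> /eqP->.
move=> /andP[ac pc]; rewrite pieces_cons !inE.
have F r : r \in pieces c s b -> r.1 < t < r.2 -> t < c -> False.
  move=> /(pieces_bounds pc)[h1 _ _] /andP[h2 _] h3.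
  by move: (lt_trans h3 (le_lt_trans h1 h2)); rewrite ltxx.
move=> /predU1P[->|ps] /predU1P[->|qs] // pt qt.
- by exfalso; apply: (F q qs qt); case/andP: pt.
- by exfalso; apply: (F p ps pt); case/andP: qt.
- exact: IH pc ps qs pt qt.
Qed.

Lemma pieces_uniq a s b : path <%R a (rcons s b) -> uniq (pieces a s b).
Proof.
move=> pa; apply: (@map_uniq _ _ fst); rewrite -/(unzip1 _) unzip1_zip ?size_rcons//.
apply: (sorted_uniq lt_trans ltxx) => /=.
by move: pa; rewrite rcons_path => /andP[].
Qed.

Lemma pieces_left a s b t : t \in a :: s -> exists2 p, p \in pieces a s b & p.1 = t.
Proof.
elim: s a => [|c s IH] a.
  by rewrite inE => /eqP ->; exists (a, b); rewrite ?mem_head.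
rewrite inE => /predU1P[->|/IH[p ps pt]].
  by exists (a, c); rewrite ?mem_head.
by exists p => //; rewrite pieces_cons inE ps orbT.
Qed.

Lemma pieces_right a s b t : t \in rcons s b -> exists2 p, p \in pieces a s b & p.2 = t.
Proof.
elim: s a => [|c s IH] a /=.
  by rewrite inE => /eqP ->; exists (a, b); rewrite ?mem_head.
rewrite inE => /predU1P[->|/IH h].
  by exists (a, c); rewrite ?mem_head.
have [p ps pt] := h c.
by exists p => //; rewrite pieces_cons inE ps orbT.
Qed.

Lemma integral_pieces a s b (F : R -> \bar R) : path <%R a (rcons s b) ->
  (forall t, 0 <= F t)%E ->
  (forall p, p \in pieces a s b -> measurable_fun [set` `]p.1, p.2[%R] F) ->
  (\int[mu]_(t in [set t | (a < t < b)%R && (t \notin s)]) F t =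
   \sum_(p <- pieces a s b) \int[mu]_(t in [set` `]p.1, p.2[%R]) F t)%E.
Proof.
move=> pa F0 mF.
have -> : [set t | (a < t < b) && (t \notin s)] =
    \big[setU/set0]_(p <- pieces a s b) [set` `]p.1, p.2[%R].
  apply/seteqP; split => t.
    move=> /= /andP[tab ts]; have [p ps pt] := pieces_cover pa tab ts.
    by rewrite -bigcup_seq; exists p => //=; rewrite in_itv.
  rewrite -bigcup_seq => -[p /= ps]; rewrite in_itv/= => pt.
  exact: pieces_avoid ps pt.
rewrite ge0_integral_bigsetU//=.
- exact: pieces_uniq.
- apply/trivIsetP => p q ps qs pq; apply/seteqP; split => // t /= [].
  rewrite !in_itv/= => pt qt; move/eqP: pq; apply.
  exact: pieces_disjoint pa ps qs pt qt.
- have : forall p, p \in pieces a s b -> measurable_fun [set` `]p.1, p.2[%R] F by [].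
  elim: (pieces a s b) => [_|p l IH mFl].
    by rewrite big_nil; exact: measurable_fun_set0.
  rewrite big_cons; apply/measurable_funU => //.
    by apply: bigsetU_measurable => q _; exact: measurable_itv.
  split; first by apply: mFl; rewrite mem_head.
  by apply: IH => q ql; apply: mFl; rewrite inE ql orbT.
Qed.

End Pieces.

(** * Net total curvature *)
Section Graph.
Variables (R : realType) (G : graph) (X : graph_map R G) (brk : edge G -> seq R).
Hypothesis hX : C2_subdivision X brk.
Variable D : double_param brk.
Local Notation mu := (@lebesgue_measure R).
Implicit Types (e u : 'rV[R]_3) (q : Defs.point R G).

Let brk_path a : path <%R 0 (rcons (brk a) 1). Proof. by have [] := hX a. Qed.

(** The witnesses of [regular_C2_arc], kept as an explicit extension. *)
Definition C2_extension (f g : R -> 'rV[R]_3) (a b : R) : Prop :=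
  [/\ {in `[a, b], f =1 g},
      forall t, derivable g t 1,
      forall t, derivable (derive1 g) t 1,
      continuous (derive1 (derive1 g)) &
      {in `[a, b], forall t, derive1 g t != 0}].

Lemma extension_exists : exists ext : edge G * (R * R) -> R -> 'rV[R]_3,
  forall ap, ap.2 \in pieces 0 (brk ap.1) 1 ->
    C2_extension (Defs.arc X ap.1) (ext ap) ap.2.1 ap.2.2.
Proof.
have H ap : exists g, ap.2 \in pieces 0 (brk ap.1) 1 ->
    C2_extension (Defs.arc X ap.1) g ap.2.1 ap.2.2.
  have [ps|nps] := boolP (ap.2 \in pieces 0 (brk ap.1) 1); last by exists (fun=> 0).
  have [_ H] := hX ap.1.
  have [g fg [h1 h2 h3 h4]] := H _ _ (pieces_infix ps).
  by exists g => _; split; [exact: fg|exact: h1|exact: h2|exact: h3|exact: h4].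
by have [ext hext] := choice H; exists ext => ap; exact: hext.
Qed.

(** Every vertex, original or added, is an end of each piece that leaves it. *)
Lemma vertex_germ q g : q \in vertices brk -> g \in germs q ->
  exists2 V, V != 0 & germ_derivative (germ_curve X g) V.
Proof.
have [ext hext] := extension_exists.
have right a t : t \in 0 :: brk a -> exists2 V, V != 0 & germ_derivative (germ_curve X (a, t, true)) V.
  move=> /(pieces_left 1)[p ps <-].
  have [gf dg dv cw v0] := hext (a, p) ps; have [h0 plt h1] := pieces_bounds (brk_path a) ps.
  exists (derive1 (ext (a, p)) p.1).
    by apply: v0; rewrite inE/= in_itv/= lexx ltW.
  exact: (piece_germ_right plt gf dg).
have left a t : t \in rcons (brk a) 1 -> exists2 V, V != 0 & germ_derivative (germ_curve X (a, t, false)) V.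
  move=> /(pieces_right 0)[p ps <-].
  have [gf dg dv cw v0] := hext (a, p) ps; have [h0 plt h1] := pieces_bounds (brk_path a) ps.
  exists (- derive1 (ext (a, p)) p.2).
    by rewrite oppr_eq0; apply: v0; rewrite inE/= in_itv/= lexx ltW.
  exact: (piece_germ_left plt gf dg).
rewrite mem_cat => /orP[/mapP[v _ ->]|/allpairsPdep[a [t [_ ta ->]]]] /=.
  rewrite mem_cat => /orP[|] /mapP[a _ ->].
    by apply: right; rewrite mem_head.
  by apply: left; rewrite mem_rcons mem_head.
rewrite !inE => /orP[/eqP->|/eqP->].
  by apply: right; rewrite inE ta orbT.
by apply: left; rewrite mem_rcons inE ta orbT.
Qed.

Lemma tangent_unit q g : q \in vertices brk -> g \in germs q ->
  dot (tangent X g) (tangent X g) = 1.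
Proof.
move=> qv gq; have [V V0 hV] := vertex_germ qv gq.
by rewrite /tangent (germ_derivativeE hV) dot_unitize.
Qed.

(** The sign of the one-sided derivative decides on which side of its base value
    the height lies along the germ. *)
Lemma side_maxE q g e : q \in vertices brk -> g \in germs q -> dot e (tangent X g) != 0 ->
  `[< side_max X e g >] = (dot e (tangent X g) < 0) /\
  `[< side_min X e g >] = (0 < dot e (tangent X g)).
Proof.
move=> qv gq; have [V V0 hV] := vertex_germ qv gq.
have -> : tangent X g = unitize V by rewrite /tangent (germ_derivativeE hV).
have i0 : 0 < (enorm V)^-1 by rewrite invr_gt0 enorm_gt0.
rewrite /unitize dotZr mulf_eq0 gt_eqF//= pmulr_rgt0// pmulr_rlt0// => eV.
have [h|h|/eqP] := ltgtP (dot e V) 0; last by rewrite (negbTE eV).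
- have H := germ_decreasing hV h; split.
    by apply/asboolP; apply: filterS H => s /ltW.
  apply/asboolPn => H'; apply: (near_right_contra H H') => s /= h1 h2.
  by move: (lt_le_trans h1 h2); rewrite ltxx.
- have H := germ_increasing hV h; split.
    apply/asboolPn => H'; apply: (near_right_contra H H') => s /= h1 h2.
    by move: (lt_le_trans h1 h2); rewrite ltxx.
  by apply/asboolP; apply: filterS H => s /ltW.
Qed.

Definition vertex_generic e : Prop :=
  forall q, q \in vertices brk -> forall g, g \in germs q -> dot e (tangent X g) != 0.

Lemma vertex_generic_ae : sphere_ae vertex_generic.
Proof.
apply: sphere_ae_seq => q qv; apply: sphere_ae_seq => g gq.
exact: great_circle_null (tangent_unit qv gq).
Qed.

(** A point of the manifold over [q] whose sides have signs [x] and [y] adds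
    [(x + y) / 2] to the difference between maxima and minima: 1 if both descend,
    -1 if both ascend, 0 otherwise. Over [q], every germ occurs twice as a side,
    whichever way the ends are glued. *)
Lemma nlm_vertex q e : q \in vertices brk -> vertex_generic e ->
  nlm X D e q = (\sum_(g <- germs q) chi (tangent X g) e) / 2.
Proof.
move=> qv ge; rewrite /nlm; congr (_ / 2).
pose x_ g : R := chi (tangent X g) e.
have mem_dg (y : dgerm R G) : y \in dgerms q -> y.1 \in germs q.
  by move=> /allpairsP[[g c] /= [gq _ ->]].
have pf := branches_vertex D qv.
have step (x : dgerm R G * dgerm R G) : x \in branches D q ->
    (`[< local_max X e x >]%:R - `[< local_min X e x >]%:R : R) = (x_ x.1.1 + x_ x.2.1) / 2.
  move=> xb.
  have mem_x y : y \in [:: x.1; x.2] -> y.1 \in germs q.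
    move=> yx; apply: mem_dg; rewrite -(perm_mem pf); apply/flattenP.
    by exists [:: x.1; x.2] => //; apply/mapP; exists x.
  have g1 : x.1.1 \in germs q by apply: mem_x; rewrite mem_head.
  have g2 : x.2.1 \in germs q by apply: mem_x; rewrite !inE eqxx orbT.
  have n1 := ge q qv _ g1; have n2 := ge q qv _ g2.
  have [M1 m1] := side_maxE qv g1 n1; have [M2 m2] := side_maxE qv g2 n2.
  rewrite /local_max /local_min !asbool_and M1 M2 m1 m2 /x_ /chi !(dotC _ e).
  move: n1 n2; move: (dot e (tangent X x.1.1)) (dot e (tangent X x.2.1)) => r s.
  case: (ltgtP r 0) => _; case: (ltgtP s 0) => _ //= _ _; by field.
have cnt (s : seq (dgerm R G * dgerm R G)) (A : pred (dgerm R G * dgerm R G)) :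
    (count A s)%:R = \sum_(x <- s) (A x)%:R :> R.
  by elim: s => [|x s IH]; rewrite ?big_nil ?big_cons//= natrD IH.
rewrite /lmax /lmin !cnt -sumrB big_seq (eq_bigr _ step) -big_seq -mulr_suml.
have -> : \sum_(x <- branches D q) (x_ x.1.1 + x_ x.2.1) =
    \sum_(y <- flatten [seq [:: x.1; x.2] | x <- branches D q]) x_ y.1.
  rewrite big_flatten big_map; apply: eq_bigr => x _.
  by rewrite big_cons big_seq1.
rewrite (perm_big _ pf)/= /dgerms big_allpairs_dep/=.
rewrite (eq_bigr (fun g => 2 * x_ g)) => [|g _]; last first.
  by rewrite !big_cons big_nil addr0 mulr_natl mulr2n.
by rewrite -mulr_sumr mulrAC mulfV ?mul1r.
Qed.

End Graph.

Section Assembly.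
Variables (R : realType) (G : graph) (X : graph_map R G) (brk : edge G -> seq R).
Hypothesis hX : C2_subdivision X brk.
Variable D : double_param brk.
Local Notation mu := (@lebesgue_measure R).
Implicit Types (e u : 'rV[R]_3) (q : Defs.point R G) (ap : edge G * (R * R)).

Variable ext : edge G * (R * R) -> R -> 'rV[R]_3.
Hypothesis hext : forall ap, ap.2 \in pieces 0 (brk ap.1) 1 ->
  C2_extension (Defs.arc X ap.1) (ext ap) ap.2.1 ap.2.2.

Let brk_path a : path <%R 0 (rcons (brk a) 1). Proof. by have [] := hX a. Qed.

(* All C^2 pieces, with their unit tangents and the derivatives of these. *)
Let P := [seq (a, p) | a <- enum (edge G), p <- pieces 0 (brk a) 1].
Let Tan ap t := unitize (derive1 (ext ap) t).
Let Tan1 ap := derive1 (Tan ap).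

Let memP ap : (ap \in P) = (ap.2 \in pieces 0 (brk ap.1) 1).
Proof.
apply/allpairsPdep/idP => [[a [p [_ pa ->]]]//|h].
by exists ap.1, ap.2; rewrite mem_enum; case: (ap) h.
Qed.

Let plt ap : ap \in P -> ap.2.1 < ap.2.2.
Proof. by rewrite memP => /(pieces_bounds (brk_path _))[]. Qed.

Let TC1 ap : ap \in P -> C1_spherical (Tan ap) (Tan1 ap) ap.2.1 ap.2.2.
Proof.
rewrite memP => /hext[_ dg dv cw v0]; apply: indicatrix_C1 => // t tab.
by apply: v0; rewrite inE/= in_itv.
Qed.

Definition graph_generic e : Prop :=
  vertex_generic X brk e /\
  forall ap, ap \in P -> generic (Tan ap) (Tan1 ap) ap.2.1 ap.2.2 e.

Lemma graph_generic_ae : sphere_ae graph_generic.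
Proof.
apply: sphere_aeI; first exact: vertex_generic_ae.
by apply: sphere_ae_seq => ap apP; exact: generic_ae (plt apP) (TC1 apP).
Qed.

(** Both copies of the edge have a maximum or both have a minimum, so the
    contribution is 1 or -1, and only maxima survive in the positive part. *)
Lemma nlm_pos_interior ap t e : ap \in P -> ap.2.1 < t < ap.2.2 ->
  dot e (Tan ap t) = 0 -> dot e (Tan1 ap t) != 0 ->
  nlm_pos X D e (inr (ap.1, t)) = (dot e (Tan1 ap t) < 0)%R%:R.
Proof.
move=> apP tp et0 et1; have plt_ := plt apP.
have := apP; rewrite memP => aps; have [gf dg dv cw v0] := hext aps.
have tr : reg brk ap.1 t by exact: pieces_avoid (brk_path _) aps tp.
rewrite /nlm_pos /nlm /lmax /lmin (branches_interior D tr) /=.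
have [lt0|gt0|/eqP] := ltgtP (dot e (Tan1 ap t)) 0; last by rewrite (negbTE et1).
- have [hr hl] := piece_local_max gf dg dv cw v0 tp et0 lt0.
  have mx c : `[< local_max X e ((ap.1, t, false, c), (ap.1, t, true, c)) >] = true.
    apply/asboolP; split; rewrite /side_max /= ?subr0 ?addr0.
      by apply: filterS hl => h /ltW.
    by apply: filterS hr => h /ltW.
  have mn c : `[< local_min X e ((ap.1, t, false, c), (ap.1, t, true, c)) >] = false.
    apply/asboolPn => -[_]; rewrite /side_min /= addr0 => H.
    by apply: (near_right_contra H hr) => h /= h1 h2; move: (lt_le_trans h2 h1); rewrite ltxx.
  by rewrite !mx !mn /= subr0 divff// max_l.
- have [hr hl] := piece_local_min gf dg dv cw v0 tp et0 gt0.
  have mx c : `[< local_max X e ((ap.1, t, false, c), (ap.1, t, true, c)) >] = false.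
    apply/asboolPn => -[_]; rewrite /side_max /= addr0 => H.
    by apply: (near_right_contra H hr) => h /= h1 h2; move: (lt_le_trans h2 h1); rewrite ltxx.
  have mn c : `[< local_min X e ((ap.1, t, false, c), (ap.1, t, true, c)) >] = true.
    apply/asboolP; split; rewrite /side_min /= ?subr0 ?addr0.
      by apply: filterS hl => h /ltW.
    by apply: filterS hr => h /ltW.
  by rewrite !mx !mn /= max_r// sub0r mulNr oppr_le0 divr_ge0.
Qed.

Let zeros_of e (z : edge G * (R * R) -> seq R) : Prop :=
  forall ap, ap \in P -> uniq (z ap) /\
    forall t, (t \in z ap) = (ap.2.1 < t < ap.2.2) && (dot e (Tan ap t) == 0).

Let zeros_exist e : dot e e = 1 -> graph_generic e -> exists z, zeros_of e z.
Proof.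
move=> e1 [_ ge].
have H ap : exists s : seq R, ap \in P -> uniq s /\
    forall t, (t \in s) = (ap.2.1 < t < ap.2.2) && (dot e (Tan ap t) == 0).
  have [apP|nP] := boolP (ap \in P); last by exists [::].
  by have [s us hs] := zeros_finite (plt apP) (TC1 apP) e1 (ge _ apP); exists s.
by have [z hz] := choice H; exists z => ap; exact: hz.
Qed.

Let crit z : seq (Defs.point R G) := [seq inr (ap.1, t) | ap <- P, t <- z ap].

Let criticalE e z : zeros_of e z -> critical X brk e = [set` crit z].
Proof.
move=> hz; apply/seteqP; split => q /=.
  move=> [a [t [-> tr et]]]; have /andP[t01 tb] := tr.
  have [p pa pt] := pieces_cover (brk_path a) t01 tb.
  have apP : (a, p) \in P by rewrite memP.
  have [gf dg dv cw v0] := hext (ap := (a, p)) pa.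
  apply/allpairsPdep; exists (a, p), t; split => //.
  by rewrite (hz _ apP).2 pt/=; apply/eqP; apply/(piece_critical gf v0 e pt).
move=> /allpairsPdep[ap [t [apP tz ->]]].
move: tz; rewrite (hz _ apP).2 => /andP[pt /eqP et].
have aps : ap.2 \in pieces 0 (brk ap.1) 1 by rewrite -memP.
have [gf dg dv cw v0] := hext aps.
exists ap.1, t; split => //; first exact: pieces_avoid (brk_path _) aps pt.
exact/(piece_critical gf v0 e pt).
Qed.

Let P_uniq : uniq P.
Proof.
apply: allpairs_uniq_dep => [|a _|]; [exact: enum_uniq|exact: pieces_uniq (brk_path a)|].
by move=> [a p] [b q] _ _ /= [-> ->].
Qed.

Let crit_uniq e z : zeros_of e z -> uniq (crit z).
Proof.
move=> hz; apply: allpairs_uniq_dep => // [ap apP|]; first exact: (hz _ apP).1.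
have mem (u : {_ : edge G * (R * R) & R}) :
    u \in [seq @Tagged _ ap (fun=> R) t | ap <- P, t <- z ap] ->
    tag u \in P /\ (tag u).2.1 < tagged u < (tag u).2.2.
  case/allpairsPdep => ap [t [apP tz eu]]; rewrite eu /=; split => //.
  by move: tz; rewrite (hz _ apP).2 => /andP[].
move=> u v /mem[uP ut] /mem[vP vt] /= [e1 e2].
move: u v uP ut vP vt e1 e2 => [[a p] t] [[b q] s] /= uP ut vP vt e1 e2.
rewrite -e1 -e2 in vP vt *.
rewrite !memP /= in uP vP.
by rewrite (pieces_disjoint (brk_path a) uP vP ut vt).
Qed.

Let vertices_uniq : uniq (vertices (R := R) brk).
Proof.
rewrite /vertices cat_uniq map_inj_uniq ?enum_uniq; last by move=> x y [].
rewrite /=; apply/andP; split.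
  by apply/hasPn => q /allpairsPdep[a [t [_ _ ->]]]; apply/mapP => -[].
apply: allpairs_uniq_dep => [|a _|]; first exact: enum_uniq.
  have := brk_path a; rewrite rcons_path => /andP[+ _].
  by move=> /(path_sorted)/(sorted_uniq lt_trans ltxx).
by move=> [a t] [b s] _ _ /= [-> ->].
Qed.

Let multiplicityE e z : dot e e = 1 -> graph_generic e -> zeros_of e z ->
  multiplicity X D e =
  \sum_(q <- vertices brk) Num.max ((\sum_(g <- germs q) chi (tangent X g) e) / 2) 0 +
  \sum_(ap <- P) \sum_(t <- z ap) (dot e (Tan1 ap t) < 0)%R%:R.
Proof.
move=> e1 [gv gp] hz; rewrite /multiplicity (criticalE hz).
have -> : [set` vertices brk] `|` [set` crit z] = [set` vertices brk ++ crit z].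
  by apply/seteqP; split => q /=; rewrite (mem_cat q (vertices brk)); move/orP.
rewrite -fsbig_seq; last first.
  rewrite cat_uniq vertices_uniq (crit_uniq hz) andbT /=.
  apply/hasPn => q /allpairsPdep[ap [t [apP tz ->]]]; apply/negP.
  rewrite mem_cat => /orP[/mapP[]//|/allpairsPdep[a [s [_ sb [ea es]]]]].
  move: tz; rewrite (hz _ apP).2 => /andP[pt _].
  rewrite memP in apP; have /andP[_] := pieces_avoid (brk_path _) apP pt.
  by rewrite ea es sb.
rewrite big_cat /=; congr (_ + _).
  rewrite big_seq [RHS]big_seq; apply: eq_bigr => q qv.
  by rewrite /nlm_pos nlm_vertex.
rewrite /crit big_allpairs_dep/= big_seq [RHS]big_seq; apply: eq_bigr => ap apP.
rewrite big_seq [RHS]big_seq; apply: eq_bigr => t.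
rewrite (hz _ apP).2 => /andP[pt /eqP et].
apply: nlm_pos_interior => //.
by apply: (gp _ apP).2 => //; case/andP: pt => *; rewrite !ltW.
Qed.

Let vertex_term q e : \bar R := (Num.max (\sum_(g <- germs q) chi (tangent X g) e) 0)%:E.
Let crossing_term ap e : \bar R := crossing_number (Tan ap) ap.2.1 ap.2.2 e.

Let multiplicity_ae : sphere_ae (fun e => (multiplicity X D e)%:E =
  \sum_(q <- vertices brk) (2^-1)%:E * vertex_term q e +
  \sum_(ap <- P) crossing_term ap e)%E.
Proof.
move: graph_generic_ae; apply: sphere_aeS => e e1 ge.
have [z hz] := zeros_exist e1 ge.
rewrite (multiplicityE e1 ge hz) EFinD -!sumEFin; congr (_ + _)%E.
  apply: eq_bigr => q _; rewrite /vertex_term -EFinM; congr EFin.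
  by rewrite maxr_pMr// mulr0 mulrC.
rewrite big_seq [RHS]big_seq; apply: eq_bigr => ap apP.
have [uz hzt] := hz _ apP.
have [h _ _] := crossing_numberE (plt apP) (TC1 apP) e1 (ge.2 _ apP) uz hzt.
by rewrite /crossing_term h.
Qed.

Let vertex_term_ge0 q e : (0 <= vertex_term q e)%E.
Proof. by rewrite lee_fin le_max lexx orbT. Qed.

Let measurable_vertex_term q : sphere_measurable (vertex_term q).
Proof.
apply/measurable_EFinP; apply: measurable_maxr => //=.
apply: measurable_sum => g; rewrite /chi.
under eq_fun do rewrite dotC.
apply: measurable_fun_ifT => //; apply: measurable_fun_ltr => //.
exact: measurable_dot_sphere.
Qed.

Let nlm_pos_ge0 q e : 0 <= nlm_pos X D e q.
Proof. by rewrite le_max lexx orbT. Qed.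

Let multiplicity_ge0 e : 0 <= multiplicity X D e.
Proof. by apply: fsumr_ge0 => q _; exact: nlm_pos_ge0. Qed.

(** The multiplicity agrees almost everywhere with a sum of measurable terms, one
    for each vertex and one for each C^2 piece. The former integrate to the net
    total curvature of the vertices by definition, the latter by Crofton's
    formula. *)
Lemma multiplicity_integral :
  ((2^-1)%:E * sphere_integral (fun e => (multiplicity X D e)%:E) =
   \sum_(q <- vertices brk) ntc X q +
   \sum_(ap <- P) \int[mu]_(t in [set` `[ap.2.1, ap.2.2]%R]) (enorm (Tan1 ap t))%:E)%E.
Proof.
have h0 q e : (0 <= (2^-1)%:E * vertex_term q e)%E by rewrite mule_ge0// vertex_term_ge0.
have mh q : sphere_measurable (fun e => (2^-1)%:E * vertex_term q e)%E.
  exact: measurable_funeM (measurable_vertex_term q).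
have c0 ap e : (0 <= crossing_term ap e)%E by exact: crossing_number_ge0.
have mc ap : sphere_measurable (crossing_term ap) by exact: measurable_crossing_number.
rewrite (ae_eq_sphere_integral _ _ multiplicity_ae); last 2 first.
- by move=> e; rewrite lee_fin.
- by move=> e; rewrite adde_ge0// sume_ge0.
rewrite sphere_integralD; last 4 first.
- by move=> e; apply: sume_ge0.
- by move=> e; apply: sume_ge0.
- exact: sphere_measurable_sum.
- exact: sphere_measurable_sum.
rewrite !sphere_integral_sum// ge0_muleDr; last 2 first.
- by apply: sume_ge0 => q _; exact: sphere_integral_ge0.
- by apply: sume_ge0 => ap _; exact: sphere_integral_ge0.
rewrite !ge0_sume_distrr; last 2 first.
- by move=> ap _; exact: sphere_integral_ge0.
- by move=> q _; exact: sphere_integral_ge0.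
congr (_ + _)%E.
  apply: eq_bigr => q _; rewrite sphere_integralZl// muleA -EFinM /ntc.
  by congr (_%:E * _)%E; field.
rewrite big_seq [RHS]big_seq; apply: eq_bigr => ap apP.
rewrite (crossing_number_integral (plt apP) (TC1 apP)).
by rewrite muleA -EFinM mulVf// mul1e.
Qed.

Let NTC_E : NTC X brk = (\sum_(q <- vertices brk) ntc X q +
   \sum_(ap <- P) \int[mu]_(t in [set` `[ap.2.1, ap.2.2]%R]) (enorm (Tan1 ap t))%:E)%E.
Proof.
rewrite /NTC; congr (_ + _)%E.
rewrite /P big_allpairs_dep/= big_enum/=; apply: eq_bigr => a _.
have mT p : (a, p) \in P -> measurable_fun [set` `]p.1, p.2[%R] (fun t => (enorm (Tan1 (a, p) t))%:E).
  move=> apP; apply: (@measurable_funS _ _ _ _ [set` `[p.1, p.2]%R]) => //.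
    exact: subset_itv_oo_cc.
  apply/measurable_EFinP; apply: subspace_continuous_measurable_fun => //.
  apply: within_continuous_unif => k k0.
  have [_ _ /(_ k k0)[d d0 hd]] := TC1 apP.
  exists d => // x y xab yab xy; rewrite (le_trans (ler_dist_enorm _ _))//.
  exact: hd.
have E p t : p \in pieces 0 (brk a) 1 -> p.1 < t < p.2 ->
    enorm (curvature_vector (Defs.arc X a) t) * enorm (derive1 (Defs.arc X a) t) = enorm (Tan1 (a, p) t).
  move=> pa pt; have [gf dg dv cw v0] := hext (ap := (a, p)) pa.
  by have := piece_curvature gf v0 pt; apply.
rewrite (integral_pieces (brk_path a)); last 2 first.
- by move=> t; rewrite lee_fin mulr_ge0 ?enorm_ge0.
- move=> p pa; have := mT p; rewrite memP => /(_ pa); apply: eq_measurable_fun.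
  by move=> t /set_mem /=; rewrite in_itv/= => pt; rewrite (E p).
rewrite big_seq [RHS]big_seq; apply: eq_bigr => p pa.
rewrite [RHS]integral_itv_bndoo; last by apply: mT; rewrite memP.
by apply: eq_integral => t /set_mem /=; rewrite in_itv/= => pt; rewrite (E p).
Qed.

Lemma NTC_multiplicity :
  NTC X brk = ((2^-1)%:E * sphere_integral (fun e => (multiplicity X D e)%:E))%E.
Proof. by rewrite NTC_E multiplicity_integral. Qed.

Lemma finite_critical e : dot e e = 1 -> graph_generic e -> finite_set (critical X brk e).
Proof. by move=> e1 ge; have [z /criticalE->] := zeros_exist e1 ge; exact: finite_seq. Qed.

End Assembly.

Theorem theorem1 (R : realType) (G : graph) (hG : connected_graph G)
    (X : graph_map R G) (brk : edge G -> seq R)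
    (hX : C2_subdivision X brk) (D : double_param brk) :
  sphere_ae (fun e : 'rV[R]_3 => finite_set (critical X brk e)) /\
  NTC X brk =
    ((2^-1)%:E * sphere_integral (fun e : 'rV[R]_3 =>
                   (multiplicity X D e)%:E))%E.
Proof.
have [ext hext] := extension_exists hX; split.
  move: (graph_generic_ae hX hext); apply: sphere_aeS => e e1 ge.
  exact: (finite_critical hX hext e1 ge).
exact: (NTC_multiplicity hX D hext).
Qed.
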